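(* Let $X(t,x)$ be the mild solution of $dX=(AX+D_\xi F(X))dt+dW$, $X(0)=x$. Then $X(t,x)$ is differentiable with respect to $x$ $\mathbb P$-a.s., and for any $h\in H$ we have $$DX(t,x)\cdot h=\eta^h(t,x),\qquad \mathbb P\text{-a.s.},$$ and $$|\eta^h(t,x)|_2\le e^{\left(\frac{\|DF\|_0^2}{4}-1\right)t}|h|_2,\qquad t\ge 0 .$$
   Context: $H$ is the real Hilbert space of (classes of) $2\pi$-periodic square-integrable real functions with inner product $\langle x,y\rangle=\int_0^{2\pi}x(\xi)y(\xi)\,d\xi$ and norm $|\cdot|_2$. $D_\xi$ is differentiation in $\xi$, and $A:D(A)\subset H\to H$ is $Ax=D_\xi^2x-x$ with $D(A)=H^2_\#(0,2\pi)$ (periodic Sobolev space). For $t>0$, $K(t):=D_\xi e^{tA}$, which is a bounded linear operator on $H$. Standing assumption: $F\in C^1(H;H)$ with $DF\in C_b(H;\mathcal L(H))$; $\|DF\|_0=\sup_{x\in H}\|DF(x)\|_{\mathcal L(H)}$. $W$ is a cylindrical Wiener process on $H$ defined on a probability space $(\Omega,\mathcal F,\mathbb P)$, and $W_A(t)=\int_0^te^{(t-s)A}\,dW(s)$. $C_W([0,T];H)$ is the space of all stochastic processes in $C([0,T];L^2(\Omega;H))$ adapted to $W(t)$. For $x\in H$, $X(\cdot,x)$ denotes the unique mild solution, i.e. the process belonging to $C_W([0,T];H)$ for every $T>0$ with $$X(t,x)=e^{tA}x+\int_0^tK(t-s)F(X(s,x))\,ds+W_A(t).$$ For $h\in H$,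 $\eta^h(t,x)$ denotes the mild solution of $\frac{d}{dt}\eta^h=A\eta^h+D_\xi(DF(X(t,x))\cdot\eta^h)$, $\eta^h(0,x)=h$, i.e. the solution of $$\eta^h(t,x)=e^{tA}h+\int_0^tK(t-s)\,DF(X(s,x))\cdot\eta^h(s,x)\,ds,\qquad t\ge0 .$$ *)

(* Defs.v *)
From HB Require Import structures.
From mathcomp Require Import all_boot all_order all_algebra.
From mathcomp Require Import all_classical all_reals all_analysis.
From mathcomp Require Import measurable_realfun ess_sup_inf.

Set Implicit Arguments.
Unset Strict Implicit.
Unset Printing Implicit Defensive.

Import Order.TTheory GRing.Theory Num.Def Num.Theory.
Import numFieldNormedType.Exports.

Local Open Scope classical_set_scope.
Local Open Scope ring_scope.

Section ae_Lnorm.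
Context d (T : measurableType d) (R : realType).
Variables (mu : {measure set T -> \bar R}) (p : \bar R) (p1 : (1 <= p)%E).

Lemma ae_eq_Lnorm (f g : T -> R) :
  measurable_fun setT f -> measurable_fun setT g -> f = g %[ae mu] ->
  'N[mu]_p[EFin \o f]%E = 'N[mu]_p[EFin \o g]%E.
Proof.
move=> mf mg fg; rewrite unlock; case: p p1 => [r r1|_|//].
- congr (_ `^ _)%E; apply: ae_eq_integral => //.
  + apply/measurable_EFinP => //=.
    apply: (measurableT_comp (measurable_powR _)) => //.
    exact: measurableT_comp.
  + apply/measurable_EFinP => //=.
    apply: (measurableT_comp (measurable_powR _)) => //.
    exact: measurableT_comp.
  + by apply: filterS fg => x /= /(_ I) ->.
- case: ifPn => // _; apply: eq_ess_sup.
  by apply: filterS fg => x /= /(_ I) ->.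
Qed.

End ae_Lnorm.

Section Lspace_pi.
Context d (T : measurableType d) (R : realType).
Variables (mu : {measure set T -> \bar R}) (p : \bar R) (p1 : (1 <= p)%E).
Local Open Scope quotient_scope.
Local Notation Lf := (LfunType mu p1).
Local Notation Lp := (LspaceType mu p1).
Local Notation Q := ({mfun_ mu, T >-> measurableTypeR R}).

Let repr_fin (x : Lp) : (repr (x : Q) : T -> R) \in Lfun mu p.
Proof.
rewrite inE; apply/andP; split; rewrite inE/=.
  have /= := @measurable_funPT _ _ _ _ (repr (x : Q)).
  exact.
exact: (@Lebesgue_finite _ _ _ _ _ _ x).
Qed.

Definition Lrepr (x : Lp) : Lf := Lfun_Sub p1 (repr_fin x).

Let tomfun (f : Lf) : {mfun T >-> measurableTypeR R} :=
  MeasurableFun.Pack (MeasurableFun.Class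
    (@isMeasurableFun.Build _ _ T (measurableTypeR R) f
      (@measurable_funPT _ _ T R f))).

Let pi_repr (f : Lf) :
  (repr (\pi_Q (tomfun f)) : T -> R) = f %[ae mu].
Proof.
have : \pi_Q (repr (\pi_Q (tomfun f))) = \pi_Q (tomfun f) by rewrite reprK.
by move/eqP; rewrite eqmodE => /asboolP.
Qed.

Let pi_fin (f : Lf) : finite_norm mu p ((\pi_Q (tomfun f) : Q) : T -> R).
Proof.
rewrite /finite_norm (@ae_eq_Lnorm _ _ _ mu p p1 _ f).
- exact: Lfunction_finite.
- have /= := @measurable_funPT _ _ _ _ (repr (\pi_Q (tomfun f))); exact.
- exact: measurable_funPT.
- exact: pi_repr.
Qed.

Definition Lpi (f : Lf) : Lp :=
  LebesgueSpace.Pack (LebesgueSpace.Class (isFinLebesgue.Build _ _ _ _ _ p1 _ (pi_fin f))).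

Lemma LreprE (x : Lp) : Lrepr x = x :> (T -> R). Proof. by []. Qed.

Lemma LpiE (f : Lf) : (Lpi f : T -> R) = f %[ae mu].
Proof. exact: pi_repr. Qed.

Lemma Lspace_eqP (x y : Lp) : (x : T -> R) = y %[ae mu] <-> x = y.
Proof.
split=> [xy|->]; last exact: ae_eq_refl.
have : (x : Q) = (y : Q) by rewrite -[LHS]reprK -[RHS]reprK; apply/eqP;
  rewrite eqmodE; apply/asboolP.
case: x y {xy} => [x [[xf]]] [y [[yf]]] /= xy.
by subst y; rewrite (Prop_irrelevance xf yf).
Qed.

Lemma eq_Lpi (f g : Lf) : Lpi f = Lpi g <-> (f : T -> R) = g %[ae mu].
Proof.
rewrite -Lspace_eqP; split => fg.
  by apply: ae_eq_trans (ae_eq_trans (ae_eq_sym (LpiE f)) fg) (LpiE g).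
by apply: ae_eq_trans (ae_eq_trans (LpiE f) fg) (ae_eq_sym (LpiE g)).
Qed.

Lemma LreprK : cancel Lrepr Lpi.
Proof. by move=> x; apply/Lspace_eqP; exact: LpiE. Qed.

End Lspace_pi.

Section Lspace_normedMod.
Context d (T : measurableType d) (R : realType).
Variables (mu : {measure set T -> \bar R}) (p : \bar R) (p1 : (1 <= p)%E).
Local Notation Lf := (LfunType mu p1).
Local Notation Lp := (LspaceType mu p1).

HB.instance Definition _ := gen_eqMixin Lp.
HB.instance Definition _ := gen_choiceMixin Lp.

Let zero : Lp := Lpi 0.
Let opp (x : Lp) : Lp := Lpi (- Lrepr x).
Let add (x y : Lp) : Lp := Lpi (Lrepr x + Lrepr y).
Let scale (a : R) (x : Lp) : Lp := Lpi (a *: Lrepr x).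

Let add_pi (f g : Lf) : add (Lpi f) (Lpi g) = Lpi (f + g).
Proof.
apply/eq_Lpi; apply: filterS2 (LpiE f) (LpiE g) => t /= /(_ I) ft /(_ I) gt _.
exact: (congr2 +%R ft gt).
Qed.

Let opp_pi (f : Lf) : opp (Lpi f) = Lpi (- f).
Proof.
apply/eq_Lpi; apply: filterS (LpiE f) => t /= /(_ I) ft _.
exact: (congr1 -%R ft).
Qed.

Let scale_pi a (f : Lf) : scale a (Lpi f) = Lpi (a *: f).
Proof.
apply/eq_Lpi; apply: filterS (LpiE f) => t /= /(_ I) ft _.
exact: (congr1 ( *%R a) ft).
Qed.

Let addA : associative add.
Proof.
move=> x y z; rewrite -(LreprK x) -(LreprK y) -(LreprK z).
by rewrite !add_pi addrA.
Qed.

Let addC : commutative add.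
Proof. by move=> x y; rewrite /add addrC. Qed.

Let add0 : left_id zero add.
Proof. by move=> x; rewrite -(LreprK x) add_pi add0r. Qed.

Let addN : left_inverse zero opp add.
Proof. by move=> x; rewrite -(LreprK x) opp_pi add_pi addNr. Qed.

HB.instance Definition _ := GRing.isZmodule.Build Lp addA addC add0 addN.

Let scaleA a b x : scale a (scale b x) = scale (a * b) x.
Proof. by rewrite -(LreprK x) !scale_pi scalerA. Qed.

Let scale1 : left_id 1 scale.
Proof. by move=> x; rewrite -(LreprK x) scale_pi scale1r. Qed.

Let scaleDr : right_distributive scale +%R.
Proof.
move=> a x y; rewrite -(LreprK x) -(LreprK y) [_ + _]add_pi !scale_pi scalerDr.
by rewrite -add_pi.
Qed.

Let scaleDl x : {morph scale^~ x : a b / a + b}.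
Proof. by move=> a b /=; rewrite -(LreprK x) !scale_pi scalerDl -add_pi. Qed.

HB.instance Definition _ :=
  GRing.Zmodule_isLmodule.Build R Lp scaleA scale1 scaleDr scaleDl.

Lemma LpiD (f g : Lf) : Lpi (f + g) = Lpi f + Lpi g.
Proof. by rewrite [RHS]add_pi. Qed.

Lemma LpiZ a (f : Lf) : Lpi (a *: f) = a *: Lpi f.
Proof. by rewrite [RHS]scale_pi. Qed.

Definition Lspace_norm (x : Lp) : R := fine ('N[mu]_p[EFin \o (x : T -> R)])%E.

Let norm_pi (f : Lf) : Lspace_norm (Lpi f) = fine ('N[mu]_p[EFin \o f])%E.
Proof.
rewrite /Lspace_norm; congr fine; apply: ae_eq_Lnorm => //.
- exact: (measurable_funPT (Lrepr (Lpi f))).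
- exact: LpiE.
Qed.

Let normD x y : Lspace_norm (x + y) <= Lspace_norm x + Lspace_norm y.
Proof.
rewrite -(LreprK x) -(LreprK y) -LpiD !norm_pi; exact: ler_LnormD.
Qed.

Let normZ a x : Lspace_norm (a *: x) = `|a| * Lspace_norm x.
Proof.
rewrite -(LreprK x) -LpiZ !norm_pi.
apply: EFin_inj; rewrite EFinM !finite_norm_fine -LnormZ; exact.
Qed.

Let norm0_eq0 x : Lspace_norm x = 0 -> x = 0.
Proof.
rewrite -(LreprK x) norm_pi => /fine_Lnormr_eq0 h.
rewrite -[RHS]/(Lpi 0); apply/eq_Lpi; exact: h.
Qed.

HB.instance Definition _ := Lmodule_isNormed.Build R Lp normD normZ norm0_eq0.

Lemma Lspace_normE (x : Lp) : `|x| = fine ('N[mu]_p[EFin \o (x : T -> R)])%E.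
Proof. reflexivity. Qed.

End Lspace_normedMod.

Section periodic_space.
Variable R : realType.

Definition lebesgue_0_2pi : {measure set (measurableTypeR R) -> \bar R} :=
  mrestr (@lebesgue_measure R)
    (measurable_itv `[0, 2 * pi] : measurable (`[0, 2 * pi] : set R)).

Definition Hper : normedModType R := LspaceType2 lebesgue_0_2pi.

Implicit Types x y : Hper.

Definition ip x y : R := \int[lebesgue_0_2pi]_xi (x xi * y xi).

Lemma Hper_norm_sqr x : `|x| ^+ 2 = ip x x.
Proof.
rewrite Lspace_normE /ip /Rintegral.
apply: EFin_inj; rewrite EFin_expe (finite_norm_fine (Lrepr x)).
have f2 : ('N[lebesgue_0_2pi]_2%:R%:E[EFin \o Lrepr x] `^ 2)%E =
   (\int[lebesgue_0_2pi]_xi (x xi * x xi)%:E)%E.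
  rewrite powR_Lnorm//; apply: eq_integral => t _ /=.
  by rewrite powR_mulrn// real_normK ?num_real// expr2.
rewrite fineK -?f2.
  by rewrite -(finite_norm_fine (Lrepr x)) poweR_EFin powR_mulrn// fine_ge0// Lnorm_ge0.
by rewrite -(finite_norm_fine (Lrepr x)) poweR_EFin.
Qed.

Definition periodic_test (phi : R -> R) : Prop :=
  (forall n xi, derivable (phi^`(n)%classic) xi 1) /\
  (forall xi, phi (xi + 2 * pi) = phi xi).

(* Because the test functions are periodic and not compactly supported in
   ]0, 2 pi[, having a weak derivative in this sense includes the periodic
   boundary condition. *)
Definition is_wderiv x y : Prop :=
  forall phi, periodic_test phi ->
    \int[lebesgue_0_2pi]_xi (x xi * (phi^`()%classic) xi) =
    - \int[lebesgue_0_2pi]_xi (y xi * phi xi).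

Definition H1per : set Hper := [set x | exists y, is_wderiv x y].

(* Total function; meaningful on H1per, where the weak derivative is unique. *)
Definition Dxi x : Hper := xget 0 [set y | is_wderiv x y].

Definition H2per : set Hper := [set x | H1per x /\ H1per (Dxi x)].

Definition Aop x : Hper := Dxi (Dxi x) - x.

Definition C0_semigroup (S : R -> Hper -> Hper) : Prop :=
  [/\ forall t, 0 <= t -> linear (S t) /\ continuous (S t),
      forall x, S 0 x = x,
      forall s t x, 0 <= s -> 0 <= t -> S (s + t) x = S s (S t x) &
      forall x, S t x @[t --> 0^'+] --> x].

Definition has_generator (S : R -> Hper -> Hper) (D : set Hper)
    (A : Hper -> Hper) : Prop :=
  forall x y, (h^-1 *: (S h x - x) @[h --> 0^'+] --> y) <-> D x /\ y = A x.

Definition Kop (S : R -> Hper -> Hper) (t : R) x : Hper := Dxi (S t x).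

Definition opnorm (L : Hper -> Hper) : R :=
  sup [set `|L h| | h in [set h | `|h| <= 1]].

Definition C1_bounded_derivative (F : Hper -> Hper) : Prop :=
  [/\ forall x, differentiable F x,
      forall x, opnorm (fun h => 'd F y h - 'd F x h) @[y --> x] --> (0 : R) &
      has_ubound (range (fun x => opnorm ('d F x)))].

Definition supnorm_DF (F : Hper -> Hper) : R :=
  sup (range (fun x => opnorm ('d F x))).

End periodic_space.

Section processes.
Context d (Omega : measurableType d) (R : realType) (P : probability Omega R).
Local Notation H := (Hper R).
Implicit Types (X Y : Omega -> H) (beta : R -> Omega -> R) (J : set R).

Definition L2_norm Y : \bar R := 'N[P]_2%:E[EFin \o (fun w => `|Y w|%R)]%E.

Definition L2_rv Y : Prop :=
  (forall U : set H, open U -> measurable (Y @^-1` U)) /\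
  (L2_norm Y < +oo)%E.

Definition L2_cvg (Y : nat -> Omega -> H) Z : Prop :=
  L2_norm (fun w => Y n w - Z w) @[n --> \oo] --> 0%E.

Definition sigma_process beta J : set (set Omega) :=
  <<s [set E | exists s (B : set R),
        [/\ J s, measurable B & E = beta s @^-1` B]] >>.

Definition increment beta s t : Omega -> R := fun w => beta t w - beta s w.

Definition brownian_motion beta : Prop :=
  [/\ forall t, 0 <= t -> measurable_fun setT (beta t),
      {ae P, forall w, beta 0 w = 0},
      forall s t (B : set R), 0 <= s -> s < t -> measurable B ->
        P ((increment beta s t) @^-1` B) = normal_prob 0 (Num.sqrt (t - s)) B,
      forall s t (E : set Omega) (B : set R), 0 <= s -> s < t ->
        sigma_process beta `[0, s] E -> measurable B ->
        P (E `&` (increment beta s t) @^-1` B) =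
        (P E * P ((increment beta s t) @^-1` B))%E &
      {ae P, forall w, {within `[0, +oo[, continuous (beta ^~ w)}}].

Definition independent_family (I : eqType) (G : I -> set (set Omega)) : Prop :=
  forall (s : seq I) (E : I -> set Omega), uniq s ->
    (forall i, i \in s -> G i (E i)) ->
    P (\bigcap_(i in [set` s]) E i) = (\prod_(i <- s) P (E i))%E.

(* The cylindrical Wiener process W(t) = \sum_k beta_k(t) e_k is represented by
   the pair (e, beta), since the series does not converge in H. *)
Definition cylindrical_wiener (e : nat -> H) (beta : nat -> R -> Omega -> R) :
    Prop :=
  [/\ forall i j, ip (e i) (e j) = (i == j)%:R,
      forall x, (forall k, ip x (e k) = 0) -> x = 0,
      forall k, brownian_motion (beta k) &
      independent_family (fun k => sigma_process (beta k) `[0, +oo[)].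

Definition filtration (beta : nat -> R -> Omega -> R) (t : R) :
    set (set Omega) :=
  <<s [set E | exists k, sigma_process (beta k) `[0, t] E] >>.

(* Wiener integral \int_0^t g(s) dbeta(s) of a deterministic continuous
   H-valued function g. *)
Definition is_wiener_integral beta (t : R) (g : R -> H) Z : Prop :=
  L2_rv Z /\
  L2_cvg (fun n w => \sum_(i < n)
    (beta (t * i.+1%:R / n%:R) w - beta (t * i%:R / n%:R) w) *:
      g (t * i%:R / n%:R)) Z.

Definition is_stochastic_convolution (S : R -> H -> H) (e : nat -> H)
    (beta : nat -> R -> Omega -> R) (t : R) Z : Prop :=
  L2_rv Z /\
  exists V : nat -> Omega -> H,
    (forall k, is_wiener_integral (beta k) t (fun s => S (t - s) (e k)) (V k)) /\
    L2_cvg (fun n w => \sum_(k < n) V k w) Z.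

(* Bochner integral on [0, t] of a function with values in L^2(Omega; H),
   as the limit of the integrals of the simple functions
   \sum_(i < m n) \1_(A n i) Y_(n,i). *)
Definition is_bochner_integral (t : R) (G : R -> Omega -> H) Z : Prop :=
  L2_rv Z /\
  exists (m : nat -> nat) (A : nat -> nat -> set R)
         (Y : nat -> nat -> Omega -> H),
    let simple n s w := \sum_(i < m n) \1_(A n i) s *: Y n i w in
    [/\ forall n i, [/\ measurable (A n i), A n i `<=` `[0, t] & L2_rv (Y n i)],
        {ae @lebesgue_measure R, forall s, `[0, t]%classic s ->
          L2_rv (G s) /\ L2_cvg (fun n => simple n s) (G s)},
        (\int[@lebesgue_measure R]_(s in `[0%R, t])
           L2_norm (fun w => simple n s w - G s w)%R)%E @[n --> \oo] --> 0%E &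
        L2_cvg (fun n w =>
          \sum_(i < m n) fine (lebesgue_measure (A n i)) *: Y n i w) Z].

(* Processes of C_W([0,T];H) are determined up to modification, so that
   adaptedness is required of some representative of X(t). *)
Definition CW (beta : nat -> R -> Omega -> R) (T : R) (X : R -> Omega -> H) :
    Prop :=
  [/\ forall t, 0 <= t <= T -> L2_rv (X t),
      forall t, 0 <= t <= T -> forall eps : R, 0 < eps ->
        exists2 delta : R, 0 < delta & forall s, 0 <= s <= T ->
          `|s - t| < delta -> (L2_norm (fun w => X s w - X t w)%R < eps%:E)%E &
      forall t, 0 <= t <= T -> exists Y : Omega -> H,
        (forall U : set H, open U -> filtration beta t (Y @^-1` U)) /\
        {ae P, forall w, Y w = X t w}].

(* The drift integral is taken in L^2(Omega; H): X(s) is only determined up to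
   a null set depending on s. The value of Kop S 0 plays no role. *)
Definition mild_solution (S : R -> H -> H) (beta : nat -> R -> Omega -> R)
    (WA : R -> Omega -> H) (F : H -> H) (x : H) (X : R -> Omega -> H) : Prop :=
  (forall T, 0 < T -> CW beta T X) /\
  forall t, 0 <= t -> exists2 Z,
    is_bochner_integral t (fun s w => Kop S (t - s) (F (X s w))) Z &
    {ae P, forall w, X t w = S t x + Z w + WA t w}.

Definition linearized_mild_solution (S : R -> H -> H)
    (beta : nat -> R -> Omega -> R) (F : H -> H) (X : R -> Omega -> H) (h : H)
    (eta : R -> Omega -> H) : Prop :=
  (forall T, 0 < T -> CW beta T eta) /\
  forall t, 0 <= t -> exists2 Z,
    is_bochner_integral t
      (fun s w => Kop S (t - s) ('d F (X s w) (eta s w))) Z &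
    {ae P, forall w, eta t w = S t h + Z w}.

End processes.

(* Main.v *)
(* In the Fourier coordinates of H the mild equation becomes a family of scalar equations.
   For a difference u of solutions the noise cancels, and testing each coordinate against
   u itself, weighted by the indicator of an event B, gives
     e^(2t) E[1_B |u(t)|^2] <= P(B) |h|^2 + 1/2 \int_0^t e^(2s) E[1_B |g(s)|^2] ds,
   where D_xi g is the drift of u. With |g| <= ||DF|| |u|, Gronwall's lemma and the
   arbitrariness of B give the almost sure bound on eta, and Lipschitz dependence on the
   initial point. For second differences u of X, g is bounded by ||DF|| |u| plus a small
   multiple of the increment k, except where the oscillation of DF near X(s) is not small.
   The time spent there is estimated pathwise, along a common sequence of step
   approximations, for a countable dense additive set of initial points. Hence for almost
   every w the map x -> X(t,x)(w) on that set has second differences o(|k|), locally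
   uniformly near every point of H; its Lipschitz extension is then Frechet differentiable
   everywhere. The first-order version of the estimate identifies the derivative with
   eta. *)
Require Import Defs.
From HB Require Import structures.
From mathcomp Require Import all_boot all_order all_algebra.
From mathcomp Require Import all_classical all_reals all_analysis.
From mathcomp Require Import measurable_realfun.
From mathcomp Require Import ring lra.

Import Order.TTheory GRing.Theory Num.Def Num.Theory.
Import numFieldNormedType.Exports.

Set Implicit Arguments.
Unset Strict Implicit.
Unset Printing Implicit Defensive.

Local Open Scope classical_set_scope.
Local Open Scope ring_scope.

(** * Square-integrable functions *)

(** [X x t] is fixed only up to a null set depending on [x], so differentiability in [x] can only be
    proved for a version, built from countably many starting points. A fixed-point argument in
    L^2(Omega; H) does not help: the superposition operator of [F] is in general not Frechet
    differentiable there, and in infinite dimension [DF] need not be uniformly continuous on bounded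
    sets. Hence the pathwise control of the times where [DF] oscillates. Sample paths are not known
    to be continuous or jointly measurable, so time integrals along a path are replaced by finite
    mesh sums. The exact rate ||DF||^2 / 4 - 1 requires the singular kernel k exp (- (k^2 + 1) r) of
    D_xi exp (r A) to be absorbed without loss: Young's inequality is used mode by mode, and the k^2
    part of the exponent is spent on u(t), with a weight whose time integral is at most 1/2 for
    every k. The test variable 1_B u(t) may anticipate the noise; this is harmless because the
    tested equation contains no stochastic integral. *)

Section Rintegral_ae.
Context d (T : measurableType d) (R : realType) (mu : {measure set T -> \bar R}).

Lemma ae_mono (P Q : T -> Prop) : (forall x, P x -> Q x) ->
  {ae mu, forall x, P x} -> {ae mu, forall x, Q x}.
Proof. by move=> PQ; apply: filterS. Qed.

Lemma ae_setC (D : set T) : measurable D -> mu (~` D) = 0%E -> {ae mu, forall x, D x}.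
Proof. by move=> mD D0; exists (~` D); split => //; exact: measurableC. Qed.

Lemma ae_eq_integral_on (D : set T) (f g : T -> \bar R) : measurable D ->
  mu (~` D) = 0%E -> (forall x, D x -> f x = g x) ->
  measurable_fun setT f -> measurable_fun setT g ->
  (\int[mu]_x f x = \int[mu]_x g x)%E.
Proof.
move=> mD D0 fg mf mg; apply: ae_eq_integral => //.
by apply: filterS (ae_setC mD D0) => x Dx _; exact: fg.
Qed.

Lemma ae_eq_Rintegral (f g : T -> R) : measurable_fun setT f ->
  measurable_fun setT g -> f = g %[ae mu] ->
  \int[mu]_x f x = \int[mu]_x g x.
Proof.
move=> mf mg fg; rewrite /Rintegral; congr fine; apply: ae_eq_integral => //.
- exact/measurable_EFinP.
- exact/measurable_EFinP.
- by apply: filterS fg => t /= /(_ I) ->.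
Qed.

Lemma Rintegral_dominated_cvg (f_ : nat -> T -> R) (f g : T -> R) :
  (forall n, measurable_fun setT (f_ n)) -> measurable_fun setT f ->
  {ae mu, forall t, f_ ^~ t @ \oo --> f t} ->
  mu.-integrable setT (EFin \o g) ->
  {ae mu, forall t n, `|f_ n t| <= g t} ->
  mu.-integrable setT (EFin \o f) /\
  (fun n => \int[mu]_t f_ n t) @ \oo --> \int[mu]_t f t.
Proof.
move=> mf_ mf ff ig fg.
have ifn n : mu.-integrable setT (EFin \o f_ n).
  apply/integrableP; split; first exact/measurable_EFinP.
  move/integrableP : (ig) => [mg]; apply: le_lt_trans.
  apply: ae_ge0_le_integral => //.
  - by apply: measurableT_comp => //; exact/measurable_EFinP.
  - by apply: measurableT_comp.
  - by apply: filterS fg => t /(_ n) h _; rewrite /= lee_fin (le_trans h)// ler_norm.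
have [i1 _ i3] := @dominated_convergence _ _ R mu setT measurableT
  (fun n => EFin \o f_ n) (EFin \o f) (EFin \o g)
  (fun n => (measurable_EFinP _ _).2 (mf_ n)) ((measurable_EFinP _ _).2 mf)
  ltac:(by apply: filterS ff => t h _; apply: cvg_EFin => //; exact: nearW) ig
  ltac:(by apply: filterS fg => t h n _; rewrite /= lee_fin).
split=> //.
by move: i3; rewrite -[X in _ --> X -> _]fineK ?integrable_fin_num// => /fine_cvg.
Qed.

End Rintegral_ae.

Section L2_inner_product.
Context d (T : measurableType d) (R : realType) (mu : {measure set T -> \bar R}).
Local Notation H := (LspaceType2 mu).
Implicit Types x y z : H.

Lemma L2_Lfun x : (x : T -> R) \in Lfun mu 2%:E.
Proof. exact: (LfunP (Lrepr x)). Qed.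

Lemma L2_measurable x : measurable_fun setT (x : T -> R).
Proof. exact: (measurable_funPT (Lrepr x)). Qed.

Lemma measurable_L2M x y : measurable_fun (setT : set (T)) (fun t => x t * y t).
Proof. exact: (@measurable_funM _ _ _ _ (x : T -> R) y (L2_measurable x) (L2_measurable y)). Qed.

Definition L2of (f : T -> R) (hf : f \in Lfun mu 2%:E) : H :=
  Lpi (Lfun_Sub (lee1n 2) hf).

Lemma L2ofE f hf : (@L2of f hf : T -> R) = f %[ae mu].
Proof. exact: LpiE. Qed.

Lemma L2D_ae x y : ((x + y : H) : T -> R) = (x \+ y)%R %[ae mu].
Proof.
have -> : (x + y : H) = Lpi (Lrepr x + Lrepr y) by rewrite LpiD !LreprK.
exact: LpiE.
Qed.

Lemma L2Z_ae a x : ((a *: x : H) : T -> R) = (fun t => a * x t)%R %[ae mu].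
Proof.
have -> : (a *: x : H) = Lpi (a *: Lrepr x) by rewrite LpiZ !LreprK.
exact: LpiE.
Qed.

Lemma Lfun2_mul_integrable (f g : T -> R) : f \in Lfun mu 2%:E -> g \in Lfun mu 2%:E ->
  mu.-integrable setT (EFin \o (fun t => f t * g t)%R).
Proof. by move=> ff gg; apply/Lfun1_integrable; exact: Lfun2_mul_Lfun1. Qed.

Definition L2ip x y : R := \int[mu]_t (x t * y t).

Lemma L2ip_L2of x f hf : L2ip x (@L2of f hf) = \int[mu]_t (x t * f t).
Proof.
apply: ae_eq_Rintegral.
- exact: measurable_L2M.
- apply: (@measurable_funM _ _ _ _ (x : T -> R)); first exact: L2_measurable.
  by move: hf; rewrite inE => /andP[+ _]; rewrite inE.
- by apply: filterS (L2ofE hf) => t /= /(_ I) -> _.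
Qed.

Lemma L2ipC x y : L2ip x y = L2ip y x.
Proof. by apply: eq_Rintegral => t _; rewrite mulrC. Qed.

Lemma L2ipDl x y z : L2ip (x + y) z = L2ip x z + L2ip y z.
Proof.
rewrite /L2ip -RintegralD//; try by apply: Lfun2_mul_integrable; exact: L2_Lfun.
apply: ae_eq_Rintegral.
- exact: measurable_L2M.
- by apply: measurable_funD; exact: measurable_L2M.
- by apply: filterS (L2D_ae x y) => t /= /(_ I) -> _; rewrite /= mulrDl.
Qed.

Lemma L2ipZl a x z : L2ip (a *: x) z = a * L2ip x z.
Proof.
rewrite /L2ip -RintegralZl//; try by apply: Lfun2_mul_integrable; exact: L2_Lfun.
apply: ae_eq_Rintegral.
- exact: measurable_L2M.
- by apply: measurable_funM => //; exact: measurable_L2M.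
- by apply: filterS (L2Z_ae a x) => t /= /(_ I) -> _; rewrite /= mulrA.
Qed.

Lemma L2ipDr x y z : L2ip x (y + z) = L2ip x y + L2ip x z.
Proof. by rewrite L2ipC L2ipDl !(L2ipC x). Qed.
Lemma L2ipZr a x z : L2ip x (a *: z) = a * L2ip x z.
Proof. by rewrite L2ipC L2ipZl L2ipC. Qed.
Lemma L2ip0l x : L2ip 0 x = 0.
Proof. by rewrite -(scale0r 0) L2ipZl mul0r. Qed.
Lemma L2ip0r x : L2ip x 0 = 0.
Proof. by rewrite L2ipC L2ip0l. Qed.
Lemma L2ipNl x y : L2ip (- x) y = - L2ip x y.
Proof. by rewrite -scaleN1r L2ipZl mulN1r. Qed.
Lemma L2ipNr x y : L2ip x (- y) = - L2ip x y.
Proof. by rewrite L2ipC L2ipNl L2ipC. Qed.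
Lemma L2ipBl x y z : L2ip (x - y) z = L2ip x z - L2ip y z.
Proof. by rewrite L2ipDl L2ipNl. Qed.
Lemma L2ipBr x y z : L2ip x (y - z) = L2ip x y - L2ip x z.
Proof. by rewrite L2ipDr L2ipNr. Qed.
Lemma L2ip_suml (I : Type) (r : seq I) (P : pred I) (f : I -> H) y :
  L2ip (\sum_(i <- r | P i) f i) y = \sum_(i <- r | P i) L2ip (f i) y.
Proof. by apply: (big_morph (fun x => L2ip x y)) => [a b|]; rewrite ?L2ipDl ?L2ip0l. Qed.
Lemma L2ip_sumr (I : Type) (r : seq I) (P : pred I) (f : I -> H) y :
  L2ip y (\sum_(i <- r | P i) f i) = \sum_(i <- r | P i) L2ip y (f i).
Proof. by rewrite L2ipC L2ip_suml; apply: eq_bigr => i _; rewrite L2ipC. Qed.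

Lemma L2ipxx x : L2ip x x = `|x| ^+ 2. 
Proof.
rewrite Lspace_normE /L2ip /Rintegral.
apply: EFin_inj; rewrite EFin_expe (finite_norm_fine (Lrepr x)).
have f2 : ('N[mu]_2%:R%:E[EFin \o Lrepr x] `^ 2)%E =
   (\int[mu]_xi (x xi * x xi)%:E)%E.
  rewrite powR_Lnorm//; apply: eq_integral => t _ /=.
  by rewrite powR_mulrn// real_normK ?num_real// expr2.
rewrite fineK -?f2.
  by rewrite -(finite_norm_fine (Lrepr x)) poweR_EFin powR_mulrn// fine_ge0// Lnorm_ge0.
by rewrite -(finite_norm_fine (Lrepr x)) poweR_EFin.
Qed.

Lemma L2ip_le x y : `|L2ip x y| <= `|x| * `|y|.
Proof.
have [->|y0] := eqVneq y 0; first by rewrite L2ip0r !normr0 mulr0.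
have yp : 0 < `|y| by rewrite normr_gt0.
have : 0 <= `| (`|y| ^+ 2) *: x - L2ip x y *: y| ^+ 2 by rewrite exprn_ge0.
rewrite -[X in 0 <= X]L2ipxx L2ipBl !L2ipBr !L2ipZl !L2ipZr (L2ipC y x) !L2ipxx.
rewrite (_ : _ - _ = `|y| ^+ 2 * (`|x| ^+ 2 * `|y| ^+ 2 - L2ip x y ^+ 2)); last by ring.
rewrite pmulr_rge0 ?exprn_gt0// subr_ge0 -exprMn => h.
by rewrite -(@ler_pXn2r _ 2)// ?nnegrE ?mulr_ge0// real_normK ?num_real.
Qed.

End L2_inner_product.

Section summable_ae.
Context d (T : measurableType d) (R : realType) (mu : {measure set T -> \bar R}).

(** The integrals add up to at most C, so the sum is integrable and finite almost everywhere. This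
    plays the part of the Borel-Cantelli lemma wherever a rate 2^-n is at hand. *)
Lemma ae_cvg_series (f : nat -> T -> R) (C : R) : 0 <= C ->
  (forall n, measurable_fun setT (f n)) -> (forall n t, 0 <= f n t) ->
  (forall n, (\int[mu]_t (f n t)%:E <= (C / (2 ^ n.+1)%:R)%:E)%E) ->
  {ae mu, forall t, cvgn (series (f ^~ t))}.
Proof.
move=> C0 mf f0 fC.
pose G t := (\sum_(n <oo) (f n t)%:E)%E.
have mG : measurable_fun setT G.
  by apply: ge0_emeasurable_sum => [k x _ _|k _]; rewrite ?lee_fin//; apply/measurable_EFinP.
have G0 t : (0 <= G t)%E by apply: nneseries_ge0 => n _ _; rewrite lee_fin.
have iG : mu.-integrable setT G.
  apply/integrableP; split => //.
  under eq_integral do rewrite gee0_abs//.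
  rewrite integral_nneseries//; last 2 first.
  - by move=> n; apply/measurable_EFinP.
  - by move=> n x _; rewrite lee_fin.
  apply: (@le_lt_trans _ _ C%:E); last by rewrite ltry.
  apply: le_trans (epsilon_trick0 xpredT C0); apply: lee_nneseries => // n _ _.
  by apply: integral_ge0 => x _; rewrite lee_fin.
have := integrable_ae measurableT iG.
apply: filterS => t /(_ I) Gfin.
apply: nondecreasing_is_cvgn.
  by apply/nondecreasing_series => n _ _.
exists (fine (G t)) => _ [n _ <-].
rewrite -lee_fin fineK// /series/= -sumEFin.
rewrite big_mkord -(big_mkord xpredT (fun k => (f k t)%:E)).
by apply: (@nneseries_lim_ge _ (fun k => (f k t)%:E)) => k _ _; rewrite lee_fin.
Qed.

Lemma cvg_telescope (V : completeNormedModType R) (u : nat -> V) :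
  cvgn (series (fun n => `|u n.+1 - u n|)) -> cvgn u.
Proof.
move=> /normed_cvg; rewrite (telescopeK u) => h.
have -> : u = (fun n => (u n - u 0%N) + u 0%N) by apply/funext => n; rewrite subrK.
by apply: is_cvgD => //; exact: is_cvg_cst.
Qed.

End summable_ae.

(** * Completeness of L^2 *)

Section Riesz_Fischer.
Context d (T : measurableType d) (R : realType) (mu : {measure set T -> \bar R}).
Local Notation H := (LspaceType2 mu).
Implicit Types x y z : H.

Lemma Lfun2_sqr_intP (g : T -> R) : measurable_fun setT g ->
  (\int[mu]_t (g t ^+ 2)%:E < +oo)%E -> g \in Lfun mu 2%:E.
Proof.
move=> mg fing; rewrite inE; apply/andP; split; rewrite inE//=.
rewrite /finite_norm unlock; apply: poweR_lty.
under eq_integral => t _ do rewrite /= powR_mulrn// real_normK ?num_real//.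
exact: fing.
Qed.

Lemma Lfun2_int_sqr_lty (g : T -> R) : g \in Lfun mu 2%:E ->
  (\int[mu]_t (g t ^+ 2)%:E < +oo)%E.
Proof. by move/Lfun2_integrable_sqr => /integrable_lty; apply. Qed.

Lemma L2_norm_int x : ((`|x| ^+ 2)%:E = \int[mu]_t (x t ^+ 2)%:E)%E.
Proof.
rewrite -L2ipxx /L2ip /Rintegral; under eq_integral => t _ do rewrite -expr2.
rewrite fineK// ge0_fin_numE; last by apply: integral_ge0 => t _; rewrite lee_fin sqr_ge0.
exact/Lfun2_int_sqr_lty/L2_Lfun.
Qed.

Lemma L2of_norm_int g hg : ((`|@L2of _ _ _ mu g hg| ^+ 2)%:E = \int[mu]_t (g t ^+ 2)%:E)%E.
Proof.
have mg : measurable_fun setT g by move: hg; rewrite inE => /andP[+ _]; rewrite inE.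
rewrite L2_norm_int; apply: ae_eq_integral => //.
- by apply/measurable_EFinP; apply: measurable_funX; exact: L2_measurable.
- by apply/measurable_EFinP; apply: measurable_funX.
- by apply: filterS (L2ofE hg) => t /= /(_ I) ->.
Qed.

Lemma L2_sub_ae x y : ((x - y : H) : T -> R) = (fun t => x t - y t)%R %[ae mu].
Proof.
rewrite -scaleN1r.
by apply: filterS2 (L2D_ae x (-1 *: y)) (L2Z_ae (-1) y) => t h1 h2 _;
  exact: (etrans (h1 I) (congr1 (fun r => x t + r) (etrans (h2 I) (mulN1r _)))).
Qed.

Hypothesis muT : (mu setT < +oo)%E.

(** Hoelder's inequality against the constant 1, whose norm is finite because [mu] is. *)
Lemma L2_int_norm_le : exists2 C : R, 0 <= C & forall x,
  (\int[mu]_t (`|x t|)%:E <= (C * `|x|)%:E)%E.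
Proof.
exists (fine ('N[mu]_2%:E[EFin \o (cst (1%R : R) : T -> R)])%E).
  by rewrite fine_ge0// Lnorm_ge0.
move=> x; rewrite EFinM Lspace_normE (finite_norm_fine (Lrepr x)).
have fin1 : ('N[mu]_2%:E[EFin \o (cst (1%R : R) : T -> R)] \is a fin_num)%E.
  rewrite ge0_fin_numE ?Lnorm_ge0// unlock; apply: poweR_lty => /=.
  under eq_integral do rewrite normr1 powR1.
  by rewrite integral_cst// mul1e.
rewrite (fineK fin1) muleC.
have p22 : 2^-1 + 2^-1 = 1 :> R by rewrite [RHS]splitr !div1r.
have h := @hoelder _ _ _ mu (x : T -> R) (cst 1) 2 2 (L2_measurable x)
  (measurable_cst _) (ltr0n _ 2) (ltr0n _ 2) p22.
apply: le_trans h; rewrite Lnorm1 le_eqVlt; apply/orP; left; apply/eqP.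
by apply: eq_integral => t _ /=; rewrite mulr1.
Qed.

(** The increments are summable in L^1 as well, the measure being finite, so the sequence converges
    almost everywhere; Fatou's lemma then upgrades the pointwise limit to a limit in norm. *)
Lemma L2_cvg_summable (u : nat -> H) :
  (forall n, `|u n.+1 - u n| <= (2 ^ n.+1)%:R^-1) -> cvgn u.
Proof.
move=> hu.
have [C C0 hC] := L2_int_norm_le.
have cs : {ae mu, forall t, cvgn (series (fun n => `|(u n.+1 - u n : H) t|))}.
  apply: (ae_cvg_series C0) => [n|n t|n].
  - by apply: measurableT_comp => //; exact: L2_measurable.
  - by [].
  - by apply: (le_trans (hC _)); rewrite lee_fin ler_wpM2l.
have es : {ae mu, forall t n, (u n.+1 - u n : H) t = u n.+1 t - u n t}.
  by apply/ae_foralln => n; apply: filterS (L2_sub_ae (u n.+1) (u n)) => t /(_ I).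
have ac : {ae mu, forall t, cvgn (fun n => u n t)}.
  apply: filterS2 cs es => t ct et; apply: cvg_telescope.
  by move: ct; under [in X in X -> _]eq_fun do rewrite et.
have [N [mN N0 hN]] := ac.
(* Cutting off the null set makes the sequence converge at every point, so that its limit is
   measurable. *)
pose v n t := u n t * \1_(~` N) t.
have mv n : measurable_fun setT (v n).
  by apply: measurable_funM; [exact: L2_measurable|exact: measurable_indic (measurableC mN)].
have cv t : cvgn (v^~ t).
  rewrite /v indicE; case: (boolP (t \in ~` N)) => tN /=.
    apply: is_cvgM; last exact: is_cvg_cst.
    by apply: contrapT => ncv; move: tN; rewrite inE; apply; exact: hN.
  by under eq_fun do rewrite mulr0; exact: is_cvg_cst.
pose f t := limn (v^~ t).
have mf : measurable_fun setT f by apply: (measurable_fun_cvg mv) => t _; exact: cv.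
have uv n : (u n : T -> R) = v n %[ae mu].
  exists N; split => // t /=; apply: contra_notP => tN _.
  by rewrite /v indicE mem_set//= mulr1.
have dist m n : (n <= m)%N -> `|u m - u n| <= (2 ^ n)%:R^-1.
  move=> nm; rewrite -(subnK nm) addnC.
  have : forall k, `|u (n + k)%N - u n| <= (2 ^ n)%:R^-1 - (2 ^ (n + k)%N)%:R^-1.
    elim=> [|k ih]; first by rewrite addn0 !subrr normr0.
    rewrite -(subrKA (u (n + k)%N)) (le_trans (ler_normD _ _))//.
    rewrite addnS; apply: (le_trans (lerD (hu _) ih)).
    rewrite addrCA lerD2l expnS natrM invfM.
    by set a := _%:R^-1; lra.
  by move=> /(_ (m - n)%N)/le_trans; apply; rewrite gerBl.
have fat n : (\int[mu]_t ((f t - u n t) ^+ 2)%:E <= (((2 ^ n)%:R^-1) ^+ 2)%:E)%E.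
  have e1 : (\int[mu]_t ((f t - u n t) ^+ 2)%:E =
     \int[mu]_t limn_einf (fun m => ((v m t - u n t) ^+ 2)%:E))%E.
    apply: eq_integral => t _.
    suff h : (fun m => ((v m t - u n t) ^+ 2)%:E) @ \oo --> ((f t - u n t) ^+ 2)%:E.
      by rewrite (cvg_limn_einf_sup h).1.
    apply: cvg_EFin; first exact: nearW.
    have c1 : (fun m => v m t - u n t) @ \oo --> f t - u n t.
      by apply: cvgB; [exact: cv|exact: cvg_cst].
    exact: (cvgM c1 c1).
  rewrite e1; apply: le_trans (fatou _ _ _ _) _ => //.
  - move=> m; apply/measurable_EFinP; apply: measurable_funX; apply: measurable_funB => //.
    exact: L2_measurable.
  - by move=> m x _; rewrite lee_fin sqr_ge0.
  rewrite limn_einf_lim; apply: lime_le; first exact: is_cvg_einfs.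
  apply: nearW => k; apply: ereal_inf_le.
  (* The infimum over the tail m >= k is bounded by the term at [maxn k n], an index to which [dist]
     applies. *)
  exists (\int[mu]_t ((v (maxn k n) t - u n t) ^+ 2)%:E)%E.
    by exists (maxn k n) => //=; rewrite leq_maxl.
  have -> : (\int[mu]_t ((v (maxn k n) t - u n t) ^+ 2)%:E =
     (`|u (maxn k n) - u n| ^+ 2)%:E)%E.
    rewrite L2_norm_int; apply: ae_eq_integral => //.
    - apply/measurable_EFinP; apply: measurable_funX; apply: measurable_funB => //.
      exact: L2_measurable.
    - by apply/measurable_EFinP; apply: measurable_funX; exact: L2_measurable.
    - apply: filterS2 (uv (maxn k n)) (L2_sub_ae (u (maxn k n)) (u n)) => t.
      by move=> /(_ I) e2 /(_ I) -> _; rewrite e2.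
  by rewrite lee_fin lerXn2r ?nnegrE//; apply: dist; rewrite leq_maxr.
have mfn n : measurable_fun setT (fun t => f t - u n t).
  by apply: measurable_funB => //; exact: L2_measurable.
have Lfn n : (fun t => f t - u n t) \in Lfun mu 2%:E.
  by apply: Lfun2_sqr_intP => //; exact: le_lt_trans (fat n) (ltry _).
(* The limit is f, reassembled as (f - u 0) + u 0 because square integrability is known only for the
   differences f - u n. *)
apply/cvg_ex; exists (L2of (Lfn 0%N) + u 0%N).
have e n : (L2of (Lfn 0%N) + u 0%N) - u n = L2of (Lfn n).
  apply/Lspace_eqP.
  apply: filterS2 (L2_sub_ae (L2of (Lfn 0%N) + u 0%N) (u n))
    (filterI (L2D_ae (L2of (Lfn 0%N)) (u 0%N)) (filterI (L2ofE (Lfn 0%N)) (L2ofE (Lfn n)))).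
  move=> t /(_ I) -> [/(_ I) -> [/(_ I) /= -> /(_ I) ->]] _.
  by rewrite subrK.
apply/cvgrPdist_le => eps eps0.
have := @cvg_geometric _ 1 (2^-1 : R).
rewrite ger0_norm// => /(_ _) /cvgrPdist_le /(_ _ eps0).
rewrite invf_lt1// ltr1n => /(_ isT).
apply: filterS => n; rewrite sub0r normrN /geometric/= mul1r ger0_norm ?exprn_ge0// => /(le_trans _); apply.
rewrite e exprVn -natrX.
rewrite -(@ler_pXn2r _ 2)// ?nnegrE//.
by rewrite -lee_fin L2of_norm_int; exact: fat.
Qed.

End Riesz_Fischer.

Section complete_of_summable.
Variables (R : realType) (V : normedModType R).

(** A Cauchy filter contains balls of radius 2^-(n+2). Consecutive ones meet, so their centres form
    a sequence with increments below 2^-(n+1), and the filter converges to the limit of that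
    sequence. *)
Lemma complete_of_summable :
  (forall u : nat -> V, (forall n, `|u n.+1 - u n| <= (2 ^ n.+1)%:R^-1) -> cvgn u) ->
  forall F : set_system V, ProperFilter F -> cauchy F -> cvg F.
Proof.
move=> scvg F FF /cauchyP Fc.
have p2 n : 0 < (2 ^ n)%:R^-1 :> R by rewrite invr_gt0 ltr0n expn_gt0.
have /choice[x hx] : forall n, exists x : V, F (ball x (2 ^ n.+2)%:R^-1).
  by move=> n; have := Fc _ (p2 n.+2).
have cx : cvgn x.
  apply: scvg => n.
  have [z []] := filter_ex (filterI (hx n) (hx n.+1)).
  rewrite -ball_normE /= => z1 z2.
  rewrite -(subrKA z) (le_trans (ler_normD _ _))//.
  rewrite distrC in z1; rewrite (distrC z).
  have e : (2 ^ n.+1)%:R^-1 = (2 ^ n.+2)%:R^-1 + (2 ^ n.+2)%:R^-1 :> R.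
    by rewrite [in RHS]expnS natrM invfM; set a := _%:R^-1; lra.
  have l3 : (2 ^ n.+3)%:R^-1 <= (2 ^ n.+2)%:R^-1 :> R.
    by rewrite lef_pV2 ?posrE ?ltr0n ?expn_gt0// ler_nat leq_exp2l.
  rewrite e lerD//; last by rewrite distrC ltW.
  by rewrite (le_trans (ltW z2)).
apply/cvg_ex; exists (limn x); apply/cvgrPdist_lt => e e0.
have e2 : 0 < e / 2 by rewrite divr_gt0.
have c2 : (fun n => (2 ^ n)%:R^-1 : R) @ \oo --> 0.
  have := @cvg_geometric R 1 2^-1; rewrite ger0_norm// invf_lt1// ltr1n => /(_ isT).
  apply: cvg_trans; apply: near_eq_cvg; apply: nearW => n.
  by rewrite /geometric /= mul1r exprVn natrX.
have [N _ hN] : \forall n \near \oo, `|limn x - x n| < e / 2 /\ (2 ^ n)%:R^-1 < e / 2.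
  near=> n; split.
    by near: n; move/cvgrPdist_lt : cx; apply.
  have : `|0 - (2 ^ n)%:R^-1 : R| < e / 2 by near: n; move/cvgrPdist_lt : c2; apply.
  by rewrite sub0r normrN ger0_norm// ltW.
have [h1 h2] := hN N (leqnn N).
apply: filterS (hx N) => z; rewrite -ball_normE /= => hz.
rewrite -(subrKA (x N)) (le_lt_trans (ler_normD _ _))// [ltRHS]splitr ltrD//.
rewrite (lt_le_trans hz)// (le_trans _ (ltW h2))//.
by rewrite lef_pV2 ?posrE ?ltr0n ?expn_gt0// ler_nat leq_exp2l// (leq_trans _ (leqnSn _)).
Unshelve. all: by end_near. Qed.

(** Completeness is attached to the space on demand, for the few theorems stated over complete
    normed spaces. *)
Definition complete_pack
    (cV : forall F : set_system V, ProperFilter F -> cauchy F -> cvg F) :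
  completeNormedModType R := HB.pack (NormedModule.sort V) (Uniform_isComplete.Build V cV).

End complete_of_summable.

Section Lipschitz.
Variables (R : realType) (V W : normedModType R).

Lemma lipschitz_continuous (f : V -> W) (C : R) :
  (forall x y, `|f x - f y| <= C * `|x - y|) -> continuous f.
Proof.
move=> fC x; apply/cvgrPdist_le => e e0.
have C1 : 0 < `|C| + 1 by rewrite ltr_wpDl.
have e1 : 0 < e / (`|C| + 1) by rewrite divr_gt0.
have xx : z @[z --> x] --> x by exact: cvg_id.
move/cvgrPdist_le : xx => /(_ _ e1); apply: filterS => z hz.
rewrite (le_trans (fC _ _))// mulrC; rewrite ler_pdivlMr// in hz; apply: le_trans hz.
by rewrite ler_wpM2l// (le_trans (ler_norm C))// lerDl.
Qed.

End Lipschitz.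

Section Hper_inner_product.
Variable R : realType.
Local Notation mu := (@lebesgue_0_2pi R).
Local Notation H := (Hper R).
Implicit Types x y z : H.

Lemma ipC x y : ip x y = ip y x. Proof. exact: L2ipC. Qed.
Lemma ipDl x y z : ip (x + y) z = ip x z + ip y z. Proof. exact: L2ipDl. Qed.
Lemma ipZl a x z : ip (a *: x) z = a * ip x z. Proof. exact: L2ipZl. Qed.
Lemma ipZr a x z : ip x (a *: z) = a * ip x z. Proof. exact: L2ipZr. Qed.
Lemma ip0l x : ip 0 x = 0. Proof. exact: L2ip0l. Qed.
Lemma ipBl x y z : ip (x - y) z = ip x z - ip y z. Proof. exact: L2ipBl. Qed.
Lemma ipBr x y z : ip x (y - z) = ip x y - ip x z. Proof. exact: L2ipBr. Qed.
Lemma ip_suml (I : Type) (r : seq I) (P : pred I) (f : I -> H) y :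
  ip (\sum_(i <- r | P i) f i) y = \sum_(i <- r | P i) ip (f i) y.
Proof. exact: L2ip_suml. Qed.
Lemma ip_sumr (I : Type) (r : seq I) (P : pred I) (f : I -> H) y :
  ip y (\sum_(i <- r | P i) f i) = \sum_(i <- r | P i) ip y (f i).
Proof. exact: L2ip_sumr. Qed.
Lemma ipxx x : ip x x = `|x| ^+ 2. Proof. exact: L2ipxx. Qed.
Lemma ip_le x y : `|ip x y| <= `|x| * `|y|. Proof. exact: L2ip_le. Qed.

Lemma lebesgue_0_2pi_fin : (mu setT < +oo)%E.
Proof.
have -> : (mu setT = @lebesgue_measure R `[0%R, (2 * pi)%R])%E.
  by rewrite -[X in _ = lebesgue_measure X]setTI.
by rewrite lebesgue_measure_itv /= lte_fin; case: ifP => _; rewrite ?ltry// lte_fin.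
Qed.

Lemma Hper_complete (F : set_system H) : ProperFilter F -> cauchy F -> cvg F.
Proof.
apply: complete_of_summable; exact: (L2_cvg_summable lebesgue_0_2pi_fin).
Qed.

Definition Hper_completeType : completeNormedModType R :=
  complete_pack Hper_complete.

Lemma ip_continuousl y : continuous (fun x => ip x y).
Proof.
apply: (@lipschitz_continuous R H R _ `|y|) => a b; rewrite -ipBl mulrC; exact: ip_le.
Qed.

Lemma ip_cvgl (u : nat -> H) x y : u @ \oo --> x -> (fun n => ip (u n) y) @ \oo --> ip x y.
Proof. by move=> ux; exact: (cvg_comp u (fun x => ip x y) ux (@ip_continuousl y x)). Qed.

End Hper_inner_product.

(** * The trigonometric basis *)

Section integral_0_2pi.
Variable R : realType.
Local Notation mu := (@lebesgue_0_2pi R).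
Local Notation D := (`[0, 2 * pi]%classic : set R).

Lemma pi2_gt0 : 0 < 2 * pi :> R.
Proof. by rewrite mulr_gt0// pi_gt0. Qed.

Lemma integral_0_2piE (f : R -> \bar R) : measurable_fun setT f ->
  (\int[mu]_x f x = \int[@lebesgue_measure R]_(x in D) f x)%E.
Proof.
move=> mf.
have -> : (\int[@lebesgue_measure R]_(x in D) f x = \int[mu]_(x in D) f x)%E.
  apply: eq_measure_integral => A mA AD.
  by rewrite -[in LHS](setIidl AD).
have mD : measurable D by exact: measurable_itv.
rewrite [RHS]integral_mkcond; apply: (@ae_eq_integral_on _ (measurableTypeR R) R mu D) => //.
- rewrite -[LHS]/(@lebesgue_measure R (~` D `&` D)).
  by rewrite setICl measure0.
- by move=> x xD; rewrite patchE mem_set.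
- exact: (iffLR (@measurable_restrictT _ _ (measurableTypeR R) _ D f mD)
    (@measurable_funTS _ _ (measurableTypeR R) _ D f mf)).
Qed.

Lemma Rintegral_0_2piE (f : R -> R) : measurable_fun setT f ->
  \int[mu]_x f x = \int[@lebesgue_measure R]_(x in D) f x.
Proof.
by move=> mf; rewrite /Rintegral integral_0_2piE//; exact/measurable_EFinP.
Qed.

Lemma continuous_Lfun2 (f : R -> R) : continuous f -> f \in Lfun mu 2%:E.
Proof.
move=> cf; have mf : measurable_fun setT f by exact: continuous_measurable_fun.
have mf2 : measurable_fun setT (fun x => f x ^+ 2) by exact: measurable_funX.
apply: Lfun2_sqr_intP => //; rewrite integral_0_2piE; last exact/measurable_EFinP.
have cf2 : continuous (fun x => f x ^+ 2 : R^o).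
  by move=> x; apply: (@continuous_comp _ _ _ f (fun y => y ^+ 2)); [exact: cf|exact: exprn_continuous].
have cD : compact D by exact: segment_compact.
have := continuous_compact_integrable cD (continuous_subspaceT cf2).
by move/integrable_lty; apply.
Qed.

Lemma Rintegral_0_2pi_FTC (F f : R -> R) : (forall x : R, is_derive x 1 F (f x)) ->
  continuous f -> \int[mu]_x f x = F (2 * pi) - F 0.
Proof.
move=> Ff cf.
have cF : continuous F.
  move=> x; apply/differentiable_continuous/derivable1_diffP.
  by have := Ff x; case.
rewrite Rintegral_0_2piE; last exact: continuous_measurable_fun.
rewrite /Rintegral (@continuous_FTC2 _ f F)//; first exact: pi2_gt0.
- exact: continuous_subspaceT.
- split.
  + by move=> x _; have := Ff x; case.
  + by apply: cvg_at_right_filter; exact: cF.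
  + by apply: cvg_at_left_filter; exact: cF.
- by move=> x _; rewrite derive1E; apply: derive_val.
Qed.

End integral_0_2pi.

Section cas.
Variable R : realType.
Local Notation mu := (@lebesgue_0_2pi R).

(* Hartley's cos + sin: one real orthogonal family indexed by int, with (cas k)' = k cas (- k). *)
Definition cas (k : int) (x : R) : R := cos (k%:~R * x) + sin (k%:~R * x).

Let mul2 (k : int) (n : nat) (x : R) : x + n%:~R * (2 * pi) = x + pi *+ 2 *+ n.
Proof. by rewrite -[pi *+ 2]mulr_natl -[_ *+ n]mulr_natl. Qed.

Lemma cosz2pi (k : int) (x : R) : cos (x + k%:~R * (2 * pi)) = cos x.
Proof.
case: (intP k) => [|n|n]; first by rewrite mul0r addr0.
  by rewrite mul2// (periodicn (@cosD2pi R)).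
rewrite -[LHS](periodicn (@cosD2pi R) n.+1) -mul2//.
by rewrite mulrNz mulNr subrK.
Qed.

Lemma sinz2pi (k : int) (x : R) : sin (x + k%:~R * (2 * pi)) = sin x.
Proof.
case: (intP k) => [|n|n]; first by rewrite mul0r addr0.
  by rewrite mul2// (periodicn (@sinD2pi R)).
rewrite -[LHS](periodicn (@sinD2pi R) n.+1) -mul2//.
by rewrite mulrNz mulNr subrK.
Qed.

Lemma cas_periodic k x : cas k (x + 2 * pi) = cas k x.
Proof. by rewrite /cas mulrDr cosz2pi sinz2pi. Qed.

Lemma cas0 x : cas 0 x = 1.
Proof. by rewrite /cas mul0r cos0 sin0 addr0. Qed.

Lemma is_derive_cas k (x : R) : is_derive x 1 (cas k) (k%:~R * cas (- k) x).
Proof.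
have h : is_derive x 1 (fun y : R => k%:~R * y) k%:~R.
  by apply: is_derive_eq; rewrite -[RHS]mulr1.
have -> : k%:~R * cas (- k) x =
   k%:~R * - sin (k%:~R * x) + k%:~R * cos (k%:~R * x).
  by rewrite /cas mulrNz mulNr cosN sinN; ring.
apply: is_deriveD.
  rewrite mulrC.
  exact: (@is_derive1_comp _ (@cos R) (fun y => k%:~R * y) x _ _ (is_derive_cos _) h).
rewrite mulrC.
exact: (@is_derive1_comp _ (@sin R) (fun y => k%:~R * y) x _ _ (is_derive_sin _) h).
Qed.

Lemma continuous_cas k : continuous (cas k).
Proof.
move=> x; apply/differentiable_continuous/derivable1_diffP.
by have := is_derive_cas k x; case.
Qed.

(** The product is cos ((a - b) x) + sin ((a + b) x); each summand is written as the even or odd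
    part of a member of the family, so the span is closed under products. *)
Lemma casM a b (x : R) : cas a x * cas b x =
  (cas (a - b) x + cas (b - a) x) / 2 + (cas (a + b) x - cas (- (a + b)) x) / 2.
Proof.
rewrite -(opprB a b) /cas !mulrNz !mulNr !cosN !sinN.
rewrite [(a - b)%:~R]intrB [(a + b)%:~R]intrD [(_ - _) * x]mulrBl.
rewrite (mulrDl (a%:~R) (b%:~R) x) cosB cosD sinB sinD.
by field.
Qed.

Lemma Rintegral_cas k : \int[mu]_x cas k x = (k == 0)%:R * (2 * pi).
Proof.
have [->|k0] := eqVneq k 0.
  have h (x : R) : is_derive x 1 (@id R) (cas 0 x) by rewrite cas0; exact: is_derive_id.
  by rewrite (Rintegral_0_2pi_FTC h (@continuous_cas 0)) subr0 mul1r.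
have h (x : R) : is_derive x 1 (fun x => (- k%:~R)^-1 * cas (- k) x) (cas k x).
  have h := is_derive_cas (- k) x.
  apply: is_derive_eq.
  rewrite opprK mulrNz -[LHS]/(_ * _) mulrA mulVf ?mul1r//.
  by rewrite oppr_eq0 intr_eq0.
rewrite (Rintegral_0_2pi_FTC h (@continuous_cas k)).
by rewrite -[2 * pi]add0r cas_periodic subrr add0r mul0r.
Qed.

End cas.

Section trig_totality.
Variable R : realType.
Local Notation mu := (@lebesgue_0_2pi R).
Local Notation H := (Hper R).
Implicit Types (x y z : H) (f g : R -> R).

Inductive trig_poly : (R -> R) -> Prop :=
| trig_poly_cas k : trig_poly (cas k)
| trig_polyD f g : trig_poly f -> trig_poly g -> trig_poly (fun t => f t + g t)
| trig_polyZ a f : trig_poly f -> trig_poly (fun t => a * f t).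

Lemma eq_trig_poly f g : f =1 g -> trig_poly f -> trig_poly g.
Proof. by move=> /funext ->. Qed.

Lemma trig_poly_cst a : trig_poly (fun=> a).
Proof.
by apply: eq_trig_poly (trig_polyZ a (trig_poly_cas 0)) => t; rewrite cas0 mulr1.
Qed.

Lemma trig_polyM f g : trig_poly f -> trig_poly g -> trig_poly (fun t => f t * g t).
Proof.
move=> tf tg; elim: tf => {f} [k|f f' _ hf _ hf'|a f _ hf].
- elim: tg => {g} [l|g g' _ hg _ hg'|a g _ hg].
  + have h := trig_polyD
      (trig_polyZ 2^-1 (trig_polyD (trig_poly_cas (k - l)) (trig_poly_cas (l - k))))
      (trig_polyZ 2^-1 (trig_polyD (trig_poly_cas (k + l))
         (trig_polyZ (-1) (trig_poly_cas (- (k + l)))))).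
    by apply: eq_trig_poly h => t; rewrite casM mulN1r; field.
  + by apply: eq_trig_poly (trig_polyD hg hg') => t; rewrite mulrDr.
  + by apply: eq_trig_poly (trig_polyZ a hg) => t; rewrite mulrCA.
- by apply: eq_trig_poly (trig_polyD hf hf') => t; rewrite mulrDl.
- by apply: eq_trig_poly (trig_polyZ a hf) => t; rewrite mulrA.
Qed.

Lemma trig_polyX f n : trig_poly f -> trig_poly (fun t => f t ^+ n).
Proof.
move=> tf; elim: n => [|n ih].
  by apply: eq_trig_poly (trig_poly_cst 1) => t; rewrite expr0.
by apply: eq_trig_poly (trig_polyM tf ih) => t; rewrite exprS.
Qed.

Lemma trig_poly_cosB m : trig_poly (fun t => cos (t - m)).
Proof.
have h := trig_polyD
  (trig_polyZ (cos m / 2) (trig_polyD (trig_poly_cas 1) (trig_poly_cas (-1))))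
  (trig_polyZ (sin m / 2) (trig_polyD (trig_poly_cas 1)
     (trig_polyZ (-1) (trig_poly_cas (-1))))).
apply: eq_trig_poly h => t; rewrite /cas mulrNz mulN1r mul1r mulN1r cosN sinN cosB.
by field.
Qed.

Lemma trig_poly_continuous f : trig_poly f -> continuous f.
Proof.
elim=> {f} [k|f g _ hf _ hg|a f _ hf].
- exact: continuous_cas.
- by move=> t; apply: cvgD; [exact: hf|exact: hg].
- by move=> t; apply: cvgM; [exact: cvg_cst|exact: hf].
Qed.

Lemma Hper_mul_integrable x f : continuous f ->
  mu.-integrable setT (EFin \o (fun t => x t * f t)).
Proof.
by move=> cf; apply: Lfun2_mul_integrable; [exact: L2_Lfun|exact: continuous_Lfun2].
Qed.

Lemma trig_poly_orth x f : (forall k, \int[mu]_t (x t * cas k t) = 0) ->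
  trig_poly f -> \int[mu]_t (x t * f t) = 0.
Proof.
move=> hx; elim=> {f} [k|f g tf hf tg hg|a f tf hf]; first exact: hx.
- under eq_Rintegral do rewrite mulrDr.
  rewrite RintegralD// ?hf ?hg ?addr0//;
    exact/Hper_mul_integrable/trig_poly_continuous.
- under eq_Rintegral do rewrite mulrCA.
  rewrite RintegralZl// ?hf ?mulr0//.
  exact/Hper_mul_integrable/trig_poly_continuous.
Qed.

Lemma bernoulli_ge (u : R) n : -1 <= u -> 1 + u *+ n <= (1 + u) ^+ n.
Proof.
move=> u1; elim: n => [|n ih]; first by rewrite mulr0n addr0 expr0.
have h : 0 <= 1 + u by lra.
rewrite exprS (le_trans _ (ler_wpM2l h ih))// -subr_ge0.
rewrite (_ : _ - _ = u ^+ 2 * n%:R).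
  by rewrite mulr_ge0 ?sqr_ge0.
by rewrite -[u *+ n.+1]mulr_natl -[u *+ n]mulr_natl -natr1; ring.
Qed.

(** Bernoulli's inequality bounds the value below by 1 - (2 v)^n, and 2 v < 1. *)
Lemma step_poly_cvg1 (v : R) : 0 <= v -> v < 2^-1 ->
  (fun n => (1 - v ^+ n) ^+ (2 ^ n)%N) @ \oo --> (1 : R).
Proof.
move=> v0 v1.
have cv : (fun n => 1 - (2 * v) ^+ n) @ \oo --> (1 : R).
  rewrite -[X in _ --> X]subr0; apply: cvgB; first exact: cvg_cst.
  by apply: cvg_expr; rewrite ger0_norm; lra.
apply: (squeeze_cvgr _ cv (@cvg_cst R 1 _ _ _)); apply: nearW => n.
have vn0 : 0 <= v ^+ n by rewrite exprn_ge0.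
have vn1 : v ^+ n <= 1 by rewrite exprn_ile1//; lra.
apply/andP; split; last by rewrite exprn_ile1//; lra.
have := @bernoulli_ge (- v ^+ n) (2 ^ n)%N; rewrite lerN2 => /(_ vn1).
by apply: le_trans; rewrite mulNrn exprMn -natrX mulr_natl.
Qed.

(** Multiplying by (1 + v^n)^(2^n), which is at least (2 v)^n by Bernoulli, gives (1 - v^(2n))^(2^n)
    <= 1; so the value is at most (2 v)^-n. *)
Lemma step_poly_cvg0 (v : R) : v <= 1 -> 2^-1 < v ->
  (fun n => (1 - v ^+ n) ^+ (2 ^ n)%N) @ \oo --> (0 : R).
Proof.
move=> v1 v2; have v0 : 0 < v by lra.
have cv : (fun n => (2 * v)^-1 ^+ n) @ \oo --> (0 : R).
  apply: cvg_expr; rewrite ger0_norm ?invr_ge0; last by lra.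
  by rewrite invf_lt1; lra.
apply: (squeeze_cvgr _ (@cvg_cst R 0 _ _ _) cv); apply: nearW => n.
have vn0 : 0 <= v ^+ n by rewrite exprn_ge0// ltW.
have vn1 : v ^+ n <= 1 by rewrite exprn_ile1//; lra.
apply/andP; split; first by rewrite exprn_ge0//; lra.
have B : 1 + v ^+ n *+ (2 ^ n)%N <= (1 + v ^+ n) ^+ (2 ^ n)%N.
  by apply: bernoulli_ge; lra.
have B2 : (2 * v) ^+ n <= (1 + v ^+ n) ^+ (2 ^ n)%N.
  by apply: le_trans B; rewrite exprMn -natrX mulr_natl; lra.
have p2 : 0 < (2 * v) ^+ n by rewrite exprn_gt0//; lra.
rewrite exprVn -[leRHS]mul1r ler_pdivlMr//.
have q0 : 0 <= (1 - v ^+ n) ^+ (2 ^ n) by rewrite exprn_ge0//; lra.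
apply: (le_trans (ler_wpM2l q0 B2)).
rewrite -exprMn exprn_ile1//; last by rewrite -subr_sqr expr1n gerBl sqr_ge0.
by rewrite mulr_ge0//; lra.
Qed.

Lemma cos_gt_in (b t : R) : 0 < b -> b < 2 * pi -> 0 < t -> t < b ->
  cos (b / 2) < cos (t - b / 2).
Proof.
move=> b0 b2 t0 tb.
have [h|h] := leP 0 (t - b / 2).
  by rewrite ltr_cos ?in_itv/=; lra.
by rewrite -(cosN (t - _)) ltr_cos ?in_itv/=; lra.
Qed.

Lemma cos_lt_out (b t : R) : 0 < b -> b < 2 * pi -> b < t -> t < 2 * pi ->
  cos (t - b / 2) < cos (b / 2).
Proof.
move=> b0 b2 t0 tb.
have [h|h] := leP (t - b / 2) pi.
  by rewrite ltr_cos ?in_itv/=; lra.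
have -> : cos (t - b / 2) = cos (2 * pi - (t - b / 2)).
  rewrite -[LHS]cosN -(cosz2pi 1 (- _)) mul1r; congr cos; ring.
by rewrite ltr_cos ?in_itv/=; lra.
Qed.

Lemma mu_0_2pi_ae (P : R -> Prop) (b : R) :
  (forall t, 0 < t < 2 * pi -> t != b -> P t) ->
  {ae mu, forall t, P t}.
Proof.
move=> hP; pose D : set R := `]0, 2 * pi[ `\ b.
have mD : measurable D by apply: measurableD; [exact: measurable_itv|exact: measurable_set1].
apply: (@ae_mono _ (measurableTypeR R) R mu D).
  by move=> t [/=]; rewrite in_itv/= => t1 /eqP tb; exact: hP.
apply: ae_setC; first exact: mD.
rewrite -[LHS]/(@lebesgue_measure R (~` D `&` `[0, 2 * pi])).
apply: (@subset_measure0 _ _ _ lebesgue_measure _ ([set 0] `|` [set 2 * pi] `|` [set b])).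
- apply: measurableI; last exact: measurable_itv.
  exact: measurableC.
- by apply: measurableU => //; apply: measurableU.
- move=> t [/= nD]; rewrite in_itv/= => /andP[t0 t1].
  have [->|tb] := eqVneq t b; first by right.
  have [->|tn0] := eqVneq t 0; first by left; left.
  have [->|tn1] := eqVneq t (2 * pi); first by left; right.
  exfalso; apply: nD; split; last by apply/eqP.
  by rewrite /= in_itv/= !lt_neqAle t0 t1 tn1 eq_sym tn0.
- apply: countable_lebesgue_measure0; apply: finite_set_countable.
  by rewrite !finite_setU; split; [split|]; exact: finite_set1.
Qed.

(* The indicator of [0, b] is the bounded limit of the trigonometric polynomials
   (1 - v ^ n) ^ (2 ^ n), where v < 1/2 exactly on ]0, b[. *)
Lemma orth_initial_segment x (b : R) : (forall k, \int[mu]_t (x t * cas k t) = 0) ->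
  \int[mu]_t (x t * \1_(`]-oo, b]) t) = 0.
Proof.
move=> hx.
have mx := L2_measurable x.
have m1 : measurable_fun setT (\1_(`]-oo, b]) : R -> R) by exact: measurable_indic.
have [b0|b0] := leP b 0.
  rewrite (@ae_eq_Rintegral _ _ R mu _ (fun=> 0)).
  - by rewrite Rintegral_cst// mul0r.
  - exact: measurable_funM.
  - exact: measurable_cst.
  - apply: (@mu_0_2pi_ae _ 0) => t /andP[t0 _] _ _.
    by rewrite indicE memNset ?mulr0//= in_itv/=; lra.
have [b1|b1] := leP (2 * pi) b.
  rewrite -(hx 0); apply: (@ae_eq_Rintegral _ _ R mu).
  - exact: measurable_funM.
  - apply: measurable_funM => //; apply: continuous_measurable_fun; exact: continuous_cas.
  - apply: (@mu_0_2pi_ae _ 0) => t /andP[_ t0] _ _.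
    by rewrite cas0 indicE mem_set ?mulr1//= in_itv/=; lra.
(* A difference of two cosines is at most 2 in absolute value, so the factor 1/4 keeps v in [0, 1];
   for t in ]0, 2 pi[ its sign tells on which side of b the point t lies. *)
pose v t := 2^-1 - (cos (t - b / 2) - cos (b / 2)) / 4.
pose T n t := (1 - v t ^+ n) ^+ (2 ^ n)%N.
have tT n : trig_poly (T n).
  have tv : trig_poly v.
    have h := trig_polyD (trig_poly_cst (2^-1 + cos (b / 2) / 4))
      (trig_polyZ (- 4^-1) (trig_poly_cosB (b / 2))).
    by apply: eq_trig_poly h => t; rewrite /v; field.
  have h := trig_polyX (2 ^ n)%N (trig_polyD (trig_poly_cst 1)
    (trig_polyZ (-1) (trig_polyX n tv))).
  by apply: eq_trig_poly h => t; rewrite mulN1r.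
have v01 t : 0 <= v t <= 1.
  have := cos_le1 (t - b / 2); have := cos_geN1 (t - b / 2).
  have := cos_le1 (b / 2); have := cos_geN1 (b / 2).
  by rewrite /v; lra.
have T01 n t : 0 <= T n t <= 1.
  have /andP[v0 v1] := v01 t.
  have w0 : 0 <= v t ^+ n by rewrite exprn_ge0.
  have w1 : v t ^+ n <= 1 by rewrite exprn_ile1.
  by rewrite exprn_ge0 ?exprn_ile1//; lra.
have mT n : measurable_fun setT (T n).
  by apply: continuous_measurable_fun; exact: trig_poly_continuous.
have cT : {ae mu, forall t, (fun n => x t * T n t) @ \oo --> x t * \1_(`]-oo, b]) t}.
  apply: (@mu_0_2pi_ae _ b) => t /andP[t0 t1] tb.
  apply: cvgM; first exact: cvg_cst.
  have /andP[v0 v1] := v01 t.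
  rewrite indicE; have [h|h] := ltP t b.
    rewrite mem_set/= ?in_itv/= ?(ltW h)//; apply: step_poly_cvg1 => //.
    by have := cos_gt_in b0 b1 t0 h; rewrite /v; lra.
  have {}h : b < t by rewrite lt_neqAle eq_sym tb.
  rewrite memNset/= ?in_itv/=; last by rewrite leNgt h.
  apply: step_poly_cvg0 => //.
  by have := cos_lt_out b0 b1 h t1; rewrite /v; lra.
have ix : mu.-integrable setT (EFin \o (fun t => `|x t|)).
  apply: (@integrable_norm _ _ _ mu setT x).
  have := @Hper_mul_integrable x (cas 0) (@continuous_cas R 0).
  apply: eq_integrable => // t _; by rewrite /= cas0 mulr1.
have [_] := @Rintegral_dominated_cvg _ _ R mu
  (fun n t => x t * T n t) (fun t => x t * \1_(`]-oo, b]) t) (fun t => `|x t|)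
  (fun n => measurable_funM mx (mT n)) (measurable_funM mx m1) cT ix
  ltac:(apply: aeW => t n; rewrite normrM ler_piMr//;
        by have /andP[h1 h2] := T01 n t; rewrite ger0_norm).
have -> : (fun n => \int[mu]_t (x t * T n t)) = cst 0.
  by apply/funext => n; exact: trig_poly_orth.
by move=> /(cvg_lim (@Rhausdorff R)) <-; rewrite lim_cst.
Qed.

End trig_totality.

Section trig_basis.
Variable R : realType.
Local Notation mu := (@lebesgue_0_2pi R).
Local Notation leb := (@lebesgue_measure R).
Local Notation H := (Hper R).
Implicit Types (x y z : H) (f g : R -> R).

(** Orthogonality to the indicators of all initial segments says that the primitive of x vanishes;
    by Lebesgue differentiation x = 0 almost everywhere. *)
Lemma cas_total x : (forall k, \int[mu]_t (x t * cas k t) = 0) -> x = 0.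
Proof.
move=> hx.
pose D : set R := `[0, 2 * pi]%classic.
have mD : measurable D by exact: measurable_itv.
have mx : measurable_fun setT (x : R -> R) := @L2_measurable _ _ _ mu x.
pose f : R -> R := x \_ D.
have ix : leb.-integrable D (EFin \o x).
  apply/integrableP; split; first by apply/measurable_EFinP; exact: measurable_funTS.
  have := @Hper_mul_integrable R x (cas 0) (@continuous_cas R 0) => /integrableP[_].
  rewrite integral_0_2piE; last first.
    apply: measurableT_comp => //; apply/measurable_EFinP.
    by apply: measurable_funM => //; apply: continuous_measurable_fun; exact: continuous_cas.
  by under eq_integral do rewrite /= cas0 mulr1.
have fi : leb.-integrable setT (EFin \o f).
  by have := (integrable_mkcond (EFin \o x) mD).1 ix; rewrite restrict_EFin.
have F0 (y : R) : \int[leb]_(t in `]-oo, y]) f t = 0.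
  rewrite -(orth_initial_segment y hx) Rintegral_0_2piE; last first.
    by apply: measurable_funM => //; exact: measurable_indic.
  rewrite Rintegral_mkcond [RHS]Rintegral_mkcond; apply: eq_Rintegral => t _.
  rewrite /f !patchE indicE; by case: (t \in `]-oo, y]%classic); case: ifPn => _; rewrite ?mulr1 ?mulr0.
have locf : locally_integrable setT f.
  apply: integrable_locally => //; exact: openT.
have ify (b : R) : leb.-integrable `]-oo, b] (EFin \o f).
  by apply: integrableS fi => //; exact: measurable_itv.
have := FTC1Ny ify locf.
have -> : (fun y : R => \int[leb]_(t in `]-oo, y]) f t) = cst 0 by exact/funext.
move=> f0.
have {}f0 : {ae leb, forall t, D t -> x t = 0}.
  apply: ae_mono f0 => t [_ +] Dt; rewrite derive1_cst /f patchE mem_set//.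
have {}f0 : {ae mu, forall t, x t = 0}.
  have [N [mN N0 hN]] := f0.
  exists (N `|` ~` D); split.
  - by apply: measurableU => //; exact: measurableC.
  - rewrite -[LHS]/(leb ((N `|` ~` D) `&` D)).
    rewrite setIUl setICl setU0; apply: (subset_measure0 _ _ _ N0) => //.
    exact: measurableI.
  - move=> t /= xt; have [Dt|nDt] := pselect (D t); last by right.
    by left; apply: hN => /= /(_ Dt).
apply/eqP; rewrite -normr_eq0 -sqrf_eq0 -ipxx /ip.
rewrite (@ae_eq_Rintegral _ _ R mu _ (fun=> 0)) ?Rintegral_cst ?mul0r//.
  exact: measurable_funM.
by apply: ae_mono f0 => t -> _; rewrite mul0r.
Qed.

Definition cbasis_fun (k : int) (t : R) : R := (Num.sqrt (2 * pi))^-1 * cas k t.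

Lemma cbasis_continuous k : continuous (cbasis_fun k).
Proof. by move=> t; apply: cvgM; [exact: cvg_cst|exact: continuous_cas]. Qed.

Definition cbasis (k : int) : H := L2of (continuous_Lfun2 (@cbasis_continuous k)).

Lemma ip_L2ofE x f (hf : f \in Lfun mu 2%:E) : ip x (L2of hf : H) = \int[mu]_t (x t * f t).
Proof. exact: L2ip_L2of. Qed.

Lemma ip_cbasis x k : ip x (cbasis k) = (Num.sqrt (2 * pi))^-1 * \int[mu]_t (x t * cas k t).
Proof.
rewrite ip_L2ofE -RintegralZl//; first by apply: eq_Rintegral => t _; rewrite mulrCA.
by apply: Hper_mul_integrable; exact: continuous_cas.
Qed.

Let sqrt2pi_neq0 : Num.sqrt (2 * pi) != 0 :> R.
Proof. by rewrite sqrtr_eq0 -ltNge pi2_gt0. Qed.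

Lemma cbasis_total x : (forall k, ip x (cbasis k) = 0) -> x = 0.
Proof.
move=> hx; apply: cas_total => k; have /eqP := hx k.
by rewrite ip_cbasis mulf_eq0 invr_eq0 (negbTE sqrt2pi_neq0) => /eqP.
Qed.

Lemma cbasis_on j k : ip (cbasis j) (cbasis k) = (j == k)%:R.
Proof.
rewrite ip_cbasis.
have -> : \int[mu]_t (cbasis j t * cas k t) =
    (Num.sqrt (2 * pi))^-1 * \int[mu]_t (cas j t * cas k t).
  rewrite -RintegralZl//; last first.
    by apply: Lfun2_mul_integrable; apply: continuous_Lfun2; exact: continuous_cas.
  apply: ae_eq_Rintegral.
  - apply: measurable_funM; first exact: L2_measurable.
    by apply: continuous_measurable_fun; exact: continuous_cas.
  - apply: measurable_funM => //; apply: measurable_funM;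
      apply: continuous_measurable_fun; exact: continuous_cas.
  - apply: ae_mono (L2ofE (continuous_Lfun2 (@cbasis_continuous j))) => t /(_ I) /= e _.
    by rewrite [cbasis j t]e /cbasis_fun mulrA.
have ic l : mu.-integrable setT (EFin \o (cas l : R -> R)).
  have := @Lfun2_mul_integrable _ _ _ mu (cas l : R -> R) (cas 0)
    (continuous_Lfun2 (@continuous_cas R l)) (continuous_Lfun2 (@continuous_cas R 0)).
  by apply: eq_integrable => // t _; rewrite /= cas0 mulr1.
have -> : \int[mu]_t (cas j t * cas k t) = (j == k)%:R * (2 * pi).
  have e t : cas j t * cas k t = 2^-1 * (cas (j - k) t + cas (k - j) t)
      + 2^-1 * (cas (j + k) t - cas (- (j + k)) t) :> R.
    by rewrite casM; field.
  under eq_Rintegral do rewrite e.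
  have i1 : mu.-integrable setT (EFin \o (fun t : R => cas (j - k) t + cas (k - j) t)).
    by have := integrableD measurableT (ic (j - k)) (ic (k - j)).
  have i2 : mu.-integrable setT (EFin \o (fun t : R => cas (j + k) t - cas (- (j + k)) t)).
    by have := integrableB measurableT (ic (j + k)) (ic (- (j + k))).
  have iZ (f : R -> R) : mu.-integrable setT (EFin \o f) ->
      mu.-integrable setT (EFin \o (fun t => 2^-1 * f t)).
    by move=> h; have := integrableZl measurableT 2^-1 h.
  rewrite (RintegralD measurableT (iZ _ i1) (iZ _ i2)).
  rewrite (RintegralZl _ measurableT i1) (RintegralZl _ measurableT i2).
  rewrite (RintegralD measurableT (ic _) (ic _)) (RintegralB measurableT (ic _) (ic _)).
  rewrite !Rintegral_cas oppr_eq0 subrr mulr0 addr0.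
  rewrite -(opprB j k) oppr_eq0 subr_eq0; by field.
rewrite mulrCA mulrA -invfM mulrCA mulrC -mulrA -expr2 sqr_sqrtr ?ltW ?pi2_gt0//.
by rewrite mulrA mulVf ?mul1r// gt_eqF// pi2_gt0.
Qed.

End trig_basis.

(** * Orthonormal expansions in H *)

Section orthonormal.
Variable R : realType.
Local Notation H := (Hper R).
Variable e : nat -> H.
Hypothesis e_on : forall i j, ip (e i) (e j) = (i == j)%:R.
Implicit Types (x y z : H).

Lemma on_norm_sqr (s : seq nat) (a : nat -> R) : uniq s ->
  `|\sum_(i <- s) a i *: e i| ^+ 2 = \sum_(i <- s) a i ^+ 2.
Proof.
move=> us; rewrite -ipxx ip_suml; apply: eq_big_seq => i si.
rewrite ip_sumr (bigD1_seq i)//= ipZl ipZr e_on eqxx mulr1 big1 ?addr0//.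
by move=> j ji; rewrite ipZl ipZr e_on eq_sym (negbTE ji) !mulr0.
Qed.

Lemma bessel (s : seq nat) x : uniq s -> \sum_(i <- s) ip x (e i) ^+ 2 <= `|x| ^+ 2.
Proof.
move=> us; pose p := \sum_(i <- s) ip x (e i) *: e i.
have : 0 <= `|x - p| ^+ 2 by rewrite exprn_ge0.
rewrite -[X in 0 <= X]ipxx ipBl !ipBr (ipC p x) !ipxx (on_norm_sqr _ us).
have -> : ip x p = \sum_(i <- s) ip x (e i) ^+ 2.
  by rewrite ip_sumr; apply: eq_bigr => i _; rewrite ipZr -expr2.
lra.
Qed.

Lemma on_series_cvg (a : nat -> R) : cvgn (series (fun i => a i ^+ 2)) ->
  cvgn (fun n => \sum_(0 <= i < n) a i *: e i : H).
Proof.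
move=> ca.
have : cvgn (series (fun i => a i *: e i : Hper_completeType R)); last by [].
apply/cauchy_cvgP/cauchy_seriesP => eps eps0.
move/cauchy_cvgP/cauchy_seriesP : ca => /(_ (eps ^+ 2)) /(_ (exprn_gt0 _ eps0)).
apply: filterS => -[m n] /=.
rewrite ger0_norm ?sumr_ge0//; last by move=> *; rewrite sqr_ge0.
have /(on_norm_sqr a) <- := iota_uniq m (n - m).
by move=> h; rewrite -(@ltr_pXn2r _ 2)// nnegrE// ltW.
Qed.

Hypothesis e_total : forall x, (forall i, ip x (e i) = 0) -> x = 0.

Lemma on_expansion x : (fun n => \sum_(0 <= i < n) ip x (e i) *: e i : H) @ \oo --> x.
Proof.
have cs : cvgn (series (fun i => ip x (e i) ^+ 2)).
  apply: nondecreasing_is_cvgn; first by apply/nondecreasing_series => n _ _; rewrite sqr_ge0.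
  exists (`|x| ^+ 2) => _ [n _ <-]; rewrite /series/=; apply: bessel; exact: iota_uniq.
have := on_series_cvg cs => /cvg_ex[l hl].
suff xl : x = l by rewrite xl; rewrite xl in hl.
apply/eqP; rewrite -subr_eq0; apply/eqP; apply: e_total => k.
have h := ip_cvgl (y := e k) hl.
rewrite ipBl; apply/eqP; rewrite subr_eq0; apply/eqP.
apply: (cvg_unique _ _ h) => //=.
apply: cvg_near_cst; exists k.+1 => // n /= kn.
rewrite ip_suml (bigD1_seq k) ?iota_uniq//=; last first.
  by rewrite mem_index_iota.
rewrite ipZl e_on eqxx mulr1 big1 ?addr0// => j jk.
by rewrite ipZl e_on (negbTE jk) mulr0.
Qed.

Lemma parseval x : (fun n => \sum_(0 <= i < n) ip x (e i) ^+ 2) @ \oo --> `|x| ^+ 2.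
Proof.
have := ip_cvgl (y := x) (on_expansion (x := x)); rewrite ipxx.
apply: cvg_trans; apply: near_eq_cvg; apply: nearW => n.
by rewrite ip_suml; apply: eq_bigr => i _; rewrite ipZl (ipC (e i)) expr2.
Qed.

End orthonormal.

(** * The heat semigroup in Fourier coordinates *)

(** Used with a = S h c, E = exp (- l h) and z = l h: the error of one small step of the semigroup
    splits into the defect of the generator and the Taylor remainder of the exponential. *)
Lemma scale_defect_split (R : realType) (V : lmodType R) (a c : V) (E z : R) :
  a - E *: c = (a - c + z *: c) - (E - 1 + z) *: c.
Proof.
rewrite scalerDl scalerBl scale1r opprD opprB addrA addrA.
by rewrite (addrAC (a - c)) subrK addrAC addrK.
Qed.

Section weak_derivative.
Variable R : realType.
Local Notation mu := (@lebesgue_0_2pi R).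
Local Notation H := (Hper R).
Implicit Types (x y z : H).

(** Runs through 0, -1, 1, -2, 2, ...: series in H are indexed by nat, Fourier modes by int. *)
Definition int_enum (n : nat) : int := if odd n then Negz n./2 else Posz n./2.

Lemma int_enum_inj : injective int_enum.
Proof.
move=> m n; rewrite /int_enum; case: ifPn => om; case: ifPn => on //= -[e].
  by rewrite -(odd_double_half m) -(odd_double_half n) om on e.
by rewrite -(odd_double_half m) -(odd_double_half n) (negbTE om) (negbTE on) e.
Qed.

Lemma int_enum_surj k : exists n, int_enum n = k.
Proof.
case: k => n; first by exists n.*2; rewrite /int_enum odd_double doubleK.
by exists n.*2.+1; rewrite /int_enum /= odd_double /= uphalf_double.
Qed.

Definition fbasis (n : nat) : H := cbasis R (int_enum n).
(** The derivative of [fbasis n] is a multiple of [gbasis n]. This family is orthonormal too, so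
    convergence criteria and Bessel's inequality apply to differentiated series. *)
Definition gbasis (n : nat) : H := cbasis R (- int_enum n).

Lemma fbasis_on i j : ip (fbasis i) (fbasis j) = (i == j)%:R.
Proof. by rewrite cbasis_on (inj_eq int_enum_inj). Qed.

Lemma gbasis_on i j : ip (gbasis i) (gbasis j) = (i == j)%:R.
Proof. by rewrite cbasis_on (inj_eq oppr_inj) (inj_eq int_enum_inj). Qed.

Lemma fbasis_total x : (forall i, ip x (fbasis i) = 0) -> x = 0.
Proof.
by move=> hx; apply: cbasis_total => k; have [n <-] := int_enum_surj k; exact: hx.
Qed.

Lemma is_derive_cbasis_fun k (t : R) :
  is_derive t 1 (cbasis_fun k : R -> R) (k%:~R * cbasis_fun (- k) t).
Proof.
have h := is_derive_cas k t.
apply: is_derive_eq.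
by rewrite /cbasis_fun mulrCA.
Qed.

Lemma derive1_cbasis_fun k : (cbasis_fun k : R -> R)^`()%classic =
  (fun t => k%:~R * cbasis_fun (- k) t).
Proof.
apply/funext => t; rewrite derive1E.
exact: (@derive_val _ _ _ _ _ _ _ (is_derive_cbasis_fun k t)).
Qed.

Lemma periodic_test_cbasis k : periodic_test (cbasis_fun k : R -> R).
Proof.
split=> [n t|t]; last by rewrite /cbasis_fun cas_periodic.
suff [a [j ->]] : exists a j, (cbasis_fun k : R -> R)^`(n)%classic = (fun t => a * cbasis_fun j t).
  have h := is_derive_cbasis_fun j t.
  have hh : is_derive t 1 (fun t : R => a * cbasis_fun j t) (a * (j%:~R * cbasis_fun (- j) t)).
    by apply: is_derive_eq.
  by case: hh.
elim: n => [|n [a [j ih]]]; first by exists 1, k; apply/funext => s; rewrite mul1r.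
exists (a * j%:~R), (- j); rewrite derive1nS ih; apply/funext => s.
rewrite derive1E.
have h := is_derive_cbasis_fun j s.
rewrite (@derive_val _ _ _ _ _ _ (a * (j%:~R * cbasis_fun (- j) s)) _) ?mulrA//.
Qed.

Lemma periodic_test_continuous (phi : R -> R) : periodic_test phi ->
  continuous phi /\ continuous (phi^`()%classic).
Proof.
move=> [h _]; split=> t; apply/differentiable_continuous/derivable1_diffP.
  exact: (h 0%N).
by have := h 1%N t; rewrite derive1n1.
Qed.

Lemma is_wderivP x y : is_wderiv x y <->
  forall phi (h : periodic_test phi),
    ip x (L2of (continuous_Lfun2 (periodic_test_continuous h).2) : H) =
    - ip y (L2of (continuous_Lfun2 (periodic_test_continuous h).1) : H).
Proof.
by split=> hx phi hphi; [rewrite !ip_L2ofE; exact: hx|have := hx phi hphi; rewrite !ip_L2ofE].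
Qed.

Lemma is_wderivD x x' y y' : is_wderiv x y -> is_wderiv x' y' -> is_wderiv (x + x') (y + y').
Proof.
move=> /is_wderivP h /is_wderivP h'; apply/is_wderivP => phi hphi.
by rewrite !ipDl h h' opprD.
Qed.

Lemma is_wderivZ a x y : is_wderiv x y -> is_wderiv (a *: x) (a *: y).
Proof.
by move=> /is_wderivP h; apply/is_wderivP => phi hphi; rewrite !ipZl h mulrN.
Qed.

Lemma is_wderiv0 : is_wderiv (0 : H) 0.
Proof. by apply/is_wderivP => phi hphi; rewrite !ip0l oppr0. Qed.

Lemma is_wderiv_sum (I : Type) (s : seq I) (x y : I -> H) :
  (forall i, is_wderiv (x i) (y i)) ->
  is_wderiv (\sum_(i <- s) x i) (\sum_(i <- s) y i).
Proof.
move=> h; elim: s => [|i s ih]; first by rewrite !big_nil; exact: is_wderiv0.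
by rewrite !big_cons; exact: is_wderivD.
Qed.

Lemma is_wderiv_cvg (u v : nat -> H) x y : (forall n, is_wderiv (u n) (v n)) ->
  u @ \oo --> x -> v @ \oo --> y -> is_wderiv x y.
Proof.
move=> uv ux vy; apply/is_wderivP => phi hphi.
set f := L2of _; set g := L2of _.
have c1 := ip_cvgl (y := f) ux.
have c2 : (fun n => - ip (v n) g) @ \oo --> - ip y g by apply: cvgN; exact: ip_cvgl.
apply: (cvg_unique (@Rhausdorff R) c1).
suff -> : (fun n => ip (u n) f) = (fun n => - ip (v n) g) by [].
by apply/funext => n; have /is_wderivP/(_ _ hphi) := uv n.
Qed.

Lemma is_wderiv_cbasis k : is_wderiv (cbasis R k) (k%:~R *: cbasis R (- k)).
Proof.
apply/is_wderivP => phi hphi; rewrite ipZl !ip_L2ofE.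
have [cphi cphi'] := periodic_test_continuous hphi.
have [d per] := hphi.
have e (j : int) (f : R -> R) : continuous f ->
   \int[mu]_t (cbasis R j t * f t) = \int[mu]_t (cbasis_fun j t * f t).
  move=> cf; have mf := continuous_measurable_fun cf.
  have mb : measurable_fun setT (cbasis_fun j : R -> R).
    by apply: continuous_measurable_fun; exact: cbasis_continuous.
  apply: (@ae_eq_Rintegral _ _ R mu).
  - by apply: measurable_funM => //; exact: L2_measurable.
  - exact: measurable_funM.
  - by apply: ae_mono (L2ofE (continuous_Lfun2 (@cbasis_continuous R j))) => t /(_ I) e _; rewrite [cbasis R j t]e.
rewrite !e//.
have i (j : int) (f : R -> R) : continuous f ->
    mu.-integrable setT (EFin \o (fun t => cbasis_fun j t * f t)).
  move=> cf; apply: Lfun2_mul_integrable; apply: continuous_Lfun2 => //.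
  exact: cbasis_continuous.
apply/eqP; rewrite -subr_eq0 opprK -RintegralZl//; last exact: i.
rewrite -RintegralD//; [|exact: i|]; last first.
  by have := integrableZl measurableT k%:~R (i (- k) _ cphi).
have FT (t : R) : is_derive t 1 (fun t => cbasis_fun k t * phi t)
    (cbasis_fun k t * phi^`()%classic t + k%:~R * (cbasis_fun (- k) t * phi t)).
  have h1 := is_derive_cbasis_fun k t.
  have h2 : is_derive t 1 phi (phi^`()%classic t).
    by apply: DeriveDef; [exact: (d 0%N)|rewrite derive1E].
  apply: is_derive_eq.
  by rewrite /GRing.scale/=; ring.
rewrite (Rintegral_0_2pi_FTC FT); last first.
  move=> t; apply: cvgD.
    by apply: cvgM; [exact: cbasis_continuous|exact: cphi'].
  apply: cvgM; first exact: cvg_cst.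
  by apply: cvgM; [exact: cbasis_continuous|exact: cphi].
rewrite -[2 * pi]add0r per /cbasis_fun cas_periodic; by rewrite subrr.
Qed.

Lemma is_wderiv_coef x y k : is_wderiv x y ->
  ip y (cbasis R k) = - k%:~R * ip x (cbasis R (- k)).
Proof.
move=> /(_ _ (periodic_test_cbasis k)).
rewrite derive1_cbasis_fun => h.
have e (z : H) (j : int) : ip z (cbasis R j) = \int[mu]_t (z t * cbasis_fun j t).
  exact: ip_L2ofE.
rewrite !e mulNr -RintegralZl//; last first.
  by apply: Hper_mul_integrable; exact: cbasis_continuous.
have e2 : \int[mu]_t (k%:~R * (x t * cbasis_fun (- k) t)) =
    \int[mu]_t (x t * (k%:~R * cbasis_fun (- k) t)).
  by apply: eq_Rintegral => t _; rewrite mulrCA.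
by rewrite e2 h opprK.
Qed.

(** Testing against the basis functions determines every Fourier coefficient of a weak derivative,
    so the choice made by [Dxi] is forced. *)
Lemma DxiE x y : is_wderiv x y -> Dxi x = y.
Proof.
move=> xy; have h : is_wderiv x (Dxi x).
  by apply: (@xgetPex _ 0 [set y | is_wderiv x y]); exists y.
apply/eqP; rewrite -subr_eq0; apply/eqP; apply: cbasis_total => k.
by rewrite ipBl !(is_wderiv_coef _ h, is_wderiv_coef _ xy) subrr.
Qed.

(** The eigenvalue of - [Aop] on the mode k. *)
Definition lam (k : int) : R := k%:~R ^+ 2 + 1.

Lemma lamN k : lam (- k) = lam k.
Proof. by rewrite /lam mulrNz sqrrN. Qed.

Lemma cbasis_H2per k : H2per (cbasis R k).
Proof.
split; first by exists (k%:~R *: cbasis R (- k)); exact: is_wderiv_cbasis.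
rewrite (DxiE (is_wderiv_cbasis k)).
by exists (k%:~R *: ((- k)%:~R *: cbasis R (- - k))); apply: is_wderivZ; exact: is_wderiv_cbasis.
Qed.

Lemma Aop_cbasis k : Aop (cbasis R k) = - lam k *: cbasis R k.
Proof.
rewrite /Aop (DxiE (is_wderiv_cbasis k)).
rewrite (DxiE (is_wderivZ k%:~R (is_wderiv_cbasis (- k)))).
rewrite opprK scalerA -{2}(scale1r (cbasis R k)) -scalerBl; congr (_ *: _).
by rewrite /lam mulrNz; ring.
Qed.

End weak_derivative.

Section linear_fun.
Variables (R : realType) (V W : lmodType R) (f : V -> W).
Hypothesis lf : linear f.

Lemma linear_fun0 : f 0 = 0.
Proof. by have := lf (-1) 0 0; rewrite scaler0 addr0 scaleN1r addNr. Qed.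

Lemma linear_funD x y : f (x + y) = f x + f y.
Proof. by have := lf 1 x y; rewrite !scale1r. Qed.

Lemma linear_funZ a x : f (a *: x) = a *: f x.
Proof. by have := lf a x 0; rewrite linear_fun0 !addr0. Qed.

Lemma linear_funB x y : f (x - y) = f x - f y.
Proof. by rewrite -scaleN1r linear_funD linear_funZ scaleN1r. Qed.

Lemma linear_fun_sum (I : Type) (s : seq I) (a : I -> V) :
  f (\sum_(i <- s) a i) = \sum_(i <- s) f (a i).
Proof. by apply: (big_morph f) => [x y|]; [exact: linear_funD|exact: linear_fun0]. Qed.

End linear_fun.

Lemma linear_continuous_le (R : realType) (V W : normedModType R) (f : V -> W) :
  linear f -> continuous f -> exists2 C, 0 <= C & forall x, `|f x| <= C * `|x|.
Proof.
move=> lf cf.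
pose f' : {linear V -> W} := HB.pack f (GRing.isLinear.Build _ _ _ _ _ lf).
have /linear_boundedP : bounded_near f' (nbhs 0).
  by apply: continuous_linear_bounded; exact: cf.
move=> [r [_ hr]]; exists (`|r| + 1); first by rewrite addr_ge0.
by move=> x; apply: hr; rewrite (le_lt_trans (ler_norm r))// ltrDl.
Qed.

Section semigroup.
Variables (R : realType) (S : R -> Hper R -> Hper R).
Hypothesis (hS : C0_semigroup S) (hSA : has_generator S (@H2per R) (@Aop R)).
Local Notation H := (Hper R).

Let S_lin t : 0 <= t -> linear (S t). Proof. by case: hS => h _ _ _ /h[]. Qed.
Let S_cont t : 0 <= t -> continuous (S t). Proof. by case: hS => h _ _ _ /h[]. Qed.
Let S_0 x : S 0 x = x. Proof. by case: hS. Qed.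
Let S_D s t x : 0 <= s -> 0 <= t -> S (s + t) x = S s (S t x). Proof. by case: hS => _ _ + _; exact. Qed.
Let S_cvg0 x : S t x @[t --> 0^'+] --> x. Proof. by case: hS. Qed.

(** Otherwise there are times t n <= 1 / (n + 1) at which the operator norm exceeds n. But the
    vectors S (t n) x stay bounded for each x by strong continuity at 0, and Banach-Steinhaus bounds
    the operators uniformly. *)
Lemma S_bounded_near0 : exists M delta, [/\ 0 <= M, 0 < delta &
  forall t x, 0 <= t <= delta -> `|S t x| <= M * `|x|].
Proof.
apply: contrapT => nM.
have /choice[t ht] : forall n : nat, exists t : R, 0 <= t <= n.+1%:R^-1 /\
    exists x, `|x| <= 1 /\ n%:R < `|S t x|.
  move=> n; apply: contrapT => nt; apply: nM; exists n%:R, n.+1%:R^-1; split => //.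
  move=> t x tn; have [->|x0] := eqVneq x 0.
    have t0 : 0 <= t by case/andP: tn.
    by rewrite (linear_fun0 (S_lin t0)) !normr0 mulr0.
  have t0 : 0 <= t by case/andP: tn.
  have xp : 0 < `|x| by rewrite normr_gt0.
  rewrite leNgt; apply/negP => h; apply: nt; exists t; split => //.
  exists (`|x|^-1 *: x); split.
    by rewrite normrZ ger0_norm ?invr_ge0// mulVf ?gt_eqF.
  rewrite (linear_funZ (S_lin t0)) normrZ ger0_norm ?invr_ge0//.
  by rewrite mulrC ltr_pdivlMr.
have tge0 n : 0 <= t n by have [/andP[]] := ht n.
have [||M hM] := @Banach_Steinhauss R (Hper_completeType R) H [set f | exists n, f = S (t n)] _ _ 1.
- move=> f [n ->]; split; last exact: S_lin (tge0 n).
  have [C C0 hC] := linear_continuous_le (S_lin (tge0 n)) (S_cont (tge0 n)).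
  move=> r; exists (C * r) => x xr; apply: (le_trans (hC x)).
  by rewrite ler_wpM2l.
- move=> x.
  have /cvgrPdist_lt/(_ 1 ltr01)[d /= d0 hd] := @S_cvg0 x.
  have [N hN] : exists N : nat, N.+1%:R^-1 < d.
    exists (Num.bound d^-1).
    rewrite -[ltRHS]invrK ltf_pV2 ?posrE ?invr_gt0//.
    have B := @archi_boundP R d^-1; rewrite invr_ge0 in B.
    by rewrite (lt_trans (B (ltW d0)))// ltr_nat.
  (* The orbit is within 1 of x once t n < d, in particular for n >= N; the sum takes care of the
     finitely many other indices. *)
  exists (`|x| + 1 + \sum_(i < N) `|S (t i) x|) => f [n ->].
  have [nN|Nn] := ltnP n N.
    rewrite (bigD1 (Ordinal nN))//= addrCA lerDl addr_ge0 ?sumr_ge0//.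
  rewrite ler_wpDr ?sumr_ge0//.
  have [->|tn0] := eqVneq (t n) 0; first by rewrite S_0 lerDl.
  have tn : 0 < t n by rewrite lt0r tn0 tge0.
  have tnd : t n < d.
    have [/andP[_ h] _] := ht n; rewrite (le_lt_trans h)//.
    rewrite (le_lt_trans _ hN)// lef_pV2 ?posrE ?ltr0n// ler_nat ltnS//.
  have := hd (t n); rewrite /= sub0r normrN gtr0_norm// => /(_ tnd tn) h.
  rewrite -[S _ _](subrK x) (le_trans (ler_normD _ _))// addrC lerD2l.
  by rewrite distrC ltW.
- have := ht (Num.bound `|M|) => -[_ [x [x1]]].
  apply/negP; rewrite -leNgt; apply: le_trans (hM _ _ x x1) _; first by exists (Num.bound `|M|).
  by rewrite (le_trans (ler_norm M))// ltW// archi_boundP.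
Qed.

Lemma S_bounded (T : R) : exists2 C, 0 <= C &
  forall t x, 0 <= t <= T -> `|S t x| <= C * `|x|.
Proof.
have [M [d [M0 d0 hM]]] := S_bounded_near0.
suff h n : exists2 C, 0 <= C & forall t x, 0 <= t <= n%:R * d -> `|S t x| <= C * `|x|.
  have [C C0 hC] := h (Num.bound (T / d)); exists C => // t x /andP[t0 tT].
  apply: hC; rewrite t0 (le_trans tT)//.
  have [T0|T0] := leP 0 T; first by rewrite -ler_pdivrMr// ltW// archi_boundP// divr_ge0// ltW.
  by rewrite (le_trans (ltW T0))// mulr_ge0// ltW.
elim: n => [|n [C C0 ih]].
  exists 1 => // t x; rewrite mul0r => t0; have -> : t = 0 by apply/eqP; rewrite eq_le andbC.
  by rewrite S_0 mul1r.
exists (Num.max C (M * C)); first by rewrite le_max C0.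
move=> t x /andP[t0]; rewrite -natr1 mulrDl mul1r => tn.
have [h|h] := leP t (n%:R * d).
  by apply: (le_trans (ih t x _)); rewrite ?t0// ler_wpM2r// le_max lexx.
have nd0 : 0 <= n%:R * d by rewrite mulr_ge0// ltW.
have td : 0 <= t - n%:R * d <= d by lra.
rewrite -(subrK (n%:R * d) t) S_D//; last by case/andP: td.
apply: (le_trans (hM _ _ td)); rewrite (@le_trans _ _ (M * (C * `|x|)))//.
  by rewrite ler_wpM2l// ih// nd0 lexx.
by rewrite mulrA ler_wpM2r// le_max lexx orbT.
Qed.

(** Both bounds come from 1 + v <= exp v, at v = - u and at v = u. *)
Lemma expRN_sub_le (u : R) : 0 <= u -> `|expR (- u) - 1 + u| <= u ^+ 2.
Proof.
move=> u0.
have h1 : 1 - u <= expR (- u) by have := expR_ge1Dx (- u).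
have h2 : expR (- u) <= 1 / (1 + u).
  rewrite expRN div1r lef_pV2 ?posrE ?expR_gt0 ?expR_ge1Dx//; lra.
rewrite ger0_norm; last by lra.
have h3 : 1 / (1 + u) - 1 + u = u ^+ 2 / (1 + u).
  by field; rewrite gt_eqF//; lra.
have h4 : u ^+ 2 / (1 + u) <= u ^+ 2.
  by rewrite ler_pdivrMr ?ler_peMr ?sqr_ge0//; lra.
lra.
Qed.

(** An eigenvector c of the generator satisfies S h c = exp (- l h) c + o(h). Over N = t / h steps
    these errors are propagated by bounded operators and add up to N o(h), which is small; the orbit
    is never differentiated at positive times. *)
Lemma S_cbasis t k : 0 <= t -> S t (cbasis R k) = expR (- lam R k * t) *: cbasis R k.
Proof.
move=> t0; set c := cbasis R k; set l := lam R k.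
have l0 : 0 < l by rewrite /l /lam ltr_wpDl// sqr_ge0.
apply/eqP; rewrite -subr_eq0 -normr_eq0; apply/eqP.
apply/eqP; rewrite eq_le normr_ge0 andbT; apply/ler_addgt0Pl => eps eps0.
rewrite addr0.
have [C C0 hC] := S_bounded t.
(* Chosen so that the accumulated error [C * (e1 * t)] stays below [eps]. *)
pose e1 := eps / ((C + 1) * (t + 1)).
have e10 : 0 < e1 by rewrite divr_gt0// mulr_gt0//; lra.
have [d d0 hd] : exists2 d, 0 < d & forall h, 0 <= h -> h < d ->
    `|S h c - expR (- l * h) *: c| <= e1 * h.
  have gen : h^-1 *: (S h c - c) @[h --> 0^'+] --> - l *: c.
    by apply/hSA; split; [exact: cbasis_H2per|rewrite Aop_cbasis].
  move/cvgrPdist_lt : gen => /(_ (e1 / 2)).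
  rewrite divr_gt0// => /(_ isT)[d1 /= d10 hd1].
  have c1 : `|c| = 1.
    by apply/eqP; rewrite -(@eqrXn2 _ 2)// -ipxx cbasis_on eqxx expr1n.
  exists (Num.min d1 (e1 / (2 * l ^+ 2))).
    by rewrite lt_min d10 divr_gt0// mulr_gt0// exprn_gt0.
  move=> h h0; rewrite lt_min => /andP[hd hl].
  have [->|hn0] := eqVneq h 0; first by rewrite S_0 !mulr0 expR0 scale1r subrr normr0.
  have hp : 0 < h by rewrite lt0r hn0.
  have := hd1 h; rewrite /= sub0r normrN gtr0_norm// => /(_ hd hp) A1.
  have A2 : `|S h c - c + (l * h) *: c| <= e1 / 2 * h.
    rewrite -ler_pdivrMr// mulrC -[h^-1]gtr0_norm ?invr_gt0// -normrZ.
    rewrite -normrN -scalerN opprD scalerDr !scalerN scalerA mulrCA mulVf// mulr1.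
    by rewrite addrC -scaleNr ltW.
  have A3 : `|(expR (- (l * h)) - 1 + l * h) *: c| <= e1 / 2 * h.
    rewrite normrZ c1 mulr1 (le_trans (expRN_sub_le _))//; first by rewrite mulr_ge0// ltW.
    rewrite exprMn expr2 -expr2 mulrA [X in X <= _](_ : _ = (l ^+ 2 * h) * h); last by ring.
    rewrite ler_wpM2r// mulrC -ler_pdivlMr ?exprn_gt0// ltW// (lt_le_trans hl)//.
    by rewrite invfM mulrA.
  have -> : S h c - expR (- l * h) *: c =
     (S h c - c + (l * h) *: c) - (expR (- (l * h)) - 1 + l * h) *: c.
    by rewrite mulNr; exact: scale_defect_split.
  rewrite (le_trans (ler_normB _ _))// (le_trans (lerD A2 A3))//.
  by rewrite -mulrDl -splitr.
pose N := (Num.bound (t / d)).+1.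
pose h := t / N%:R.
have N0 : 0 < N%:R :> R by rewrite ltr0n.
have h0 : 0 <= h by rewrite divr_ge0.
have hd' : h < d.
  rewrite /h ltr_pdivrMr// mulrC -ltr_pdivrMr//.
  have B := @archi_boundP R (t / d); rewrite divr_ge0 ?(ltW d0)// in B.
  by rewrite (lt_trans (B isT))// ltr_nat.
have step j : (j <= N)%N -> `|S (j%:R * h) c - expR (- l * (j%:R * h)) *: c| <= j%:R * (C * (e1 * h)).
  elim: j => [|j ih] jN; first by rewrite !mul0r mulr0 expR0 S_0 scale1r subrr normr0.
  have jh0 : 0 <= j%:R * h by rewrite mulr_ge0.
  have jht : j%:R * h <= t.
    rewrite /h mulrCA ler_piMr// ler_pdivrMr// mul1r ler_nat; exact: ltnW.
  rewrite -natr1 !mulrDl !mul1r S_D// mulrDr expRD.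
  have -> : S (j%:R * h) (S h c) - (expR (- l * (j%:R * h)) * expR (- l * h)) *: c =
     expR (- l * h) *: (S (j%:R * h) c - expR (- l * (j%:R * h)) *: c) +
     S (j%:R * h) (S h c - expR (- l * h) *: c).
    rewrite (linear_funB (S_lin jh0)) (linear_funZ (S_lin jh0)) scalerBr scalerA.
    by rewrite (mulrC (expR (- l * h))) [RHS]addrC subrKA.
  rewrite (le_trans (ler_normD _ _))// lerD//.
    rewrite normrZ ger0_norm ?expR_ge0//.
    apply: le_trans (ih (ltnW jN)); rewrite ler_piMl// -expR0 ler_expR.
    by rewrite mulNr oppr_le0 mulr_ge0// ltW.
  apply: (le_trans (hC _ _ _)); first by rewrite jh0.
  by rewrite ler_wpM2l// hd.
have := step N (leqnn _).
have -> : N%:R * h = t by rewrite /h mulrC divfK// gt_eqF.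
move=> /le_trans; apply.
rewrite [X in X <= _](_ : _ = C * (e1 * t)); last by rewrite /h; field; rewrite gt_eqF.
rewrite /e1 [X in X <= _](_ : _ = eps * ((C * t) / ((C + 1) * (t + 1)))); last first.
  by field; rewrite !gt_eqF//; lra.
rewrite ler_piMr ?ltW// ltr_pdivrMr ?mul1r ?mulr_gt0//; try lra.
Qed.

Lemma S_coef t x k : 0 <= t ->
  ip (S t x) (cbasis R k) = expR (- lam R k * t) * ip x (cbasis R k).
Proof.
move=> t0.
have [j jk] := int_enum_surj k.
have ex := on_expansion (@fbasis_on R) (@fbasis_total R) (x := x).
have c1 : (fun n => S t (\sum_(0 <= i < n) ip x (fbasis R i) *: fbasis R i)) @ \oo --> S t x.
  exact: (cvg_comp _ (S t) ex (S_cont t0 (x := x))).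
have := ip_cvgl (y := cbasis R k) c1.
move=> /(cvg_lim (@Rhausdorff R)) <-; apply: lim_near_cst => //.
exists j.+1 => // n /= jn.
rewrite (linear_fun_sum (S_lin t0)) ip_suml (bigD1_seq j) ?iota_uniq//=; last first.
  by rewrite mem_index_iota.
rewrite (linear_funZ (S_lin t0)) S_cbasis// !ipZl -jk cbasis_on eqxx mulr1.
rewrite big1 ?addr0 ?(mulrC (ip _ _))// => i ij.
rewrite (linear_funZ (S_lin t0)) S_cbasis// !ipZl -/(fbasis R j) fbasis_on (negbTE ij).
by rewrite !mulr0.
Qed.

(** Smoothing: exp (- 2 lam r) k^2 <= k^2 / (1 + 2 k^2 r) <= 1 / (2 r), so the differentiated
    Fourier series has square summable coefficients. *)
Lemma S_H1per r g : 0 < r -> exists y, is_wderiv (S r g) y.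
Proof.
move=> r0.
pose a i := (ip (S r g) (fbasis R i)) * (int_enum i)%:~R.
have ca : cvgn (series (fun i => a i ^+ 2)).
  apply: nondecreasing_is_cvgn; first by apply/nondecreasing_series => n _ _; rewrite sqr_ge0.
  exists ((2 * r)^-1 * `|g| ^+ 2) => _ [n _ <-].
  apply: (@le_trans _ _ (\sum_(0 <= i < n) (2 * r)^-1 * ip g (fbasis R i) ^+ 2)); last first.
    rewrite -mulr_sumr ler_wpM2l ?invr_ge0//; first by lra.
    apply: bessel; [exact: fbasis_on|exact: iota_uniq].
  apply: ler_sum => i _; rewrite /a S_coef; last exact: ltW.
  set k : R := (int_enum i)%:~R.
  rewrite [X in X <= _](_ : _ = (expR (- lam R (int_enum i) * r) ^+ 2 * k ^+ 2) *
     ip g (fbasis R i) ^+ 2); last by rewrite /fbasis; ring.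
  rewrite ler_wpM2r ?sqr_ge0// -expRM_natl.
  have k0 : 0 <= k ^+ 2 by exact: sqr_ge0.
  have h : expR (2%:R * (- lam R (int_enum i) * r)) <= (1 + 2 * k ^+ 2 * r)^-1.
    rewrite mulNr mulrN expRN lef_pV2 ?posrE ?expR_gt0//; last first.
      by rewrite ltr_wpDr// mulr_ge0//; lra.
    apply: le_trans (expR_ge1Dx _); rewrite lerD2l /lam -/k.
    by nra.
  apply: (le_trans (ler_wpM2r k0 h)).
  have p1 : 0 < 1 + 2 * k ^+ 2 * r by rewrite ltr_wpDr// mulr_ge0//; lra.
  rewrite mulrC ler_pdivrMr// mulrC ler_pdivlMr; last by lra.
  by lra.
have /cvg_ex[y hy] := on_series_cvg (@gbasis_on R) ca.
exists y; apply: (is_wderiv_cvg _ (on_expansion (@fbasis_on R) (@fbasis_total R) (x := S r g)) hy).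
move=> n; apply: is_wderiv_sum => i.
by rewrite /a -scalerA; apply: is_wderivZ; exact: is_wderiv_cbasis.
Qed.

Lemma Kop_coef r g k : 0 < r ->
  ip (Kop S r g) (cbasis R k) =
  - k%:~R * expR (- lam R k * r) * ip g (cbasis R (- k)).
Proof.
move=> r0; have [y hy] := S_H1per g r0.
by rewrite /Kop (DxiE hy) (is_wderiv_coef _ hy) S_coef ?ltW// lamN mulrA.
Qed.

End semigroup.

(** * Differentiability from second differences *)

Section strict_differentiability.
Variables (R : realType) (V W : normedModType R) (f : V -> W).
Hypothesis W_complete : forall F : set_system W, ProperFilter F -> cauchy F -> cvg F.

Lemma differentiable_of_linear (x : V) (L : V -> W) (C : R) : linear L ->
  (forall h, `|L h| <= C * `|h|) ->
  (forall e, 0 < e -> exists2 d, 0 < d &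
     forall h, `|h| < d -> `|f (x + h) - f x - L h| <= e * `|h|) ->
  differentiable f x.
Proof.
move=> linL LC hL.
pose L' : {linear V -> W} := HB.pack L (GRing.isLinear.Build _ _ _ _ _ linL).
have cL : continuous L'.
  by apply: (@lipschitz_continuous R V W L' C) => a b; rewrite -linearB; exact: LC.
have eL : f \o shift x = cst (f x) + L' +o_ 0 id.
  apply/eqaddoP => e e0.
  have [d d0 hd] := hL _ e0.
  apply/nbhs_normP; exists d => //= h /=; rewrite sub0r normrN => hd'.
  rewrite -[(_ - _) h]/(f (h + x) - (f x + L h)).
  by rewrite opprD addrA addrC (addrC h) [X in `|X|]addrC; exact: hd.
have dE : 'd f x = L' :> (V -> W) by exact: diff_unique.
by apply/diff_locallyP; rewrite dE.
Qed.

Variable C : R.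
Hypothesis f_lip : forall x y, `|f x - f y| <= C * `|x - y|.
Variable x : V.
Hypothesis f_strict : forall e, 0 < e -> exists2 d, 0 < d &
  forall y k, `|y - x| < d -> `|k| < d ->
    `|f (y + k) - f y - (f (x + k) - f x)| <= e * `|k|.

Let q (n : nat) (h : V) : W := n%:R *: (f (x + n%:R^-1 *: h) - f x).

(** The step h / n is cut into m equal steps l. By [f_strict] the increment of f over each of them
    differs from the one at x by at most e |l|, and these errors telescope. *)
Let q_refine (e : R) : 0 < e -> exists2 d, 0 < d &
  forall n m h, (0 < n)%N -> (0 < m)%N -> `|h| < d * n%:R ->
    `|q n h - q (n * m) h| <= e * `|h|.
Proof.
move=> e0; have [d d0 hd] := f_strict e0; exists d => // n m h n0 m0 hn.
have nr : 0 < n%:R :> R by rewrite ltr0n.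
have mr : 0 < m%:R :> R by rewrite ltr0n.
pose k := n%:R^-1 *: h; pose l := (n * m)%:R^-1 *: h.
have kl : k = m%:R *: l by rewrite /k /l scalerA natrM invfM mulrCA mulfV ?mulr1 ?gt_eqF.
have kd : `|k| < d by rewrite normrZ gtr0_norm ?invr_gt0// mulrC ltr_pdivrMr.
have kl' : `|k| = m%:R * `|l| by rewrite {1}kl (normrZ m%:R l) ger0_norm ?ler0n.
have ld : `|l| < d.
  by rewrite (le_lt_trans _ kd)// kl' ler_peMl// ler1n.
have tel j : (j <= m)%N ->
    `|f (x + j%:R *: l) - f x - j%:R *: (f (x + l) - f x)| <= j%:R * (e * `|l|).
  elim: j => [|j ih] jm; first by rewrite !scale0r addr0 !subrr normr0 mul0r.
  rewrite -natr1 !scalerDl !scale1r mulrDl mul1r.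
  have -> : f (x + (j%:R *: l + l)) - f x - (j%:R *: (f (x + l) - f x) + (f (x + l) - f x)) =
    (f (x + j%:R *: l) - f x - j%:R *: (f (x + l) - f x)) +
    (f (x + j%:R *: l + l) - f (x + j%:R *: l) - (f (x + l) - f x)).
    by rewrite addrA opprD [RHS]addrACA; congr (_ + _); rewrite [RHS]addrC subrKA.
  rewrite (le_trans (ler_normD _ _))// lerD//; first by apply: ih; exact: ltnW.
  apply: hd => //; rewrite (addrC x) addrK normrZ.
  rewrite (le_lt_trans _ kd)// kl' ler_wpM2r// ger0_norm ?ler0n//.
  by rewrite ler_nat ltnW.
have := tel m (leqnn m); rewrite -kl => t.
have -> : q n h - q (n * m) h = n%:R *: (f (x + k) - f x - m%:R *: (f (x + l) - f x)).
  by rewrite scalerBr scalerA -natrM.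
rewrite normrZ ger0_norm ?ler0n//.
have -> : e * `|h| = n%:R * (m%:R * (e * `|l|)).
  rewrite normrZ ger0_norm ?invr_ge0 ?ler0n// natrM.
  by field; rewrite !gt_eqF.
by rewrite ler_wpM2l ?ler0n.
Qed.

(** Both quotients are compared with the one of index n m, which refines n and m. *)
Let q_cauchy h (e : R) : 0 < e -> exists N, forall n m, (N < n)%N -> (N < m)%N ->
  `|q n h - q m h| <= e.
Proof.
move=> e0; pose e1 := e / (2 * (`|h| + 1)).
have h1 : 0 < `|h| + 1 by rewrite ltr_wpDl.
have e10 : 0 < e1 by rewrite divr_gt0// mulr_gt0.
have [d d0 hd] := q_refine e10.
exists (Num.bound (`|h| / d)) => n m nN mN.
have hn j : (Num.bound (`|h| / d) < j)%N -> `|h| < d * j%:R.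
  move=> jN; rewrite mulrC -ltr_pdivrMr//.
  have B := @archi_boundP R (`|h| / d); rewrite divr_ge0 ?(ltW d0)// in B.
  by rewrite (lt_trans (B isT))// ltr_nat.
have n0 : (0 < n)%N by exact: leq_ltn_trans nN.
have m0 : (0 < m)%N by exact: leq_ltn_trans mN.
have A := hd n m h n0 m0 (hn _ nN).
have B := hd m n h m0 n0 (hn _ mN).
rewrite -(subrKA (q (n * m) h)) (le_trans (ler_normD _ _))//.
rewrite distrC mulnC in B; rewrite (le_trans (lerD A B))//.
rewrite [X in X <= _](_ : _ = e * (`|h| / (`|h| + 1))); last by rewrite /e1; field; rewrite gt_eqF.
by rewrite ler_piMr ?(ltW e0)// ler_pdivrMr// mul1r lerDl.
Qed.

Let L h : W := lim ((fun n => q n h) @ \oo).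

Let q_cvg h : (fun n => q n h) @ \oo --> L h.
Proof.
suff : cvg ((fun n => q n h) @ \oo) by [].
apply: W_complete; apply: cauchy_exP => e e0.
have e2 : 0 < e / 2 by rewrite divr_gt0.
have [N hN] := q_cauchy h e2.
exists (q N.+1 h); exists N.+1 => // n /= nN; rewrite -ball_normE /=.
by rewrite (le_lt_trans (hN _ _ (ltnSn N) nN))// ltr_pdivrMr// ltr_pMr// ltr1n.
Qed.

Let q_le n h : (0 < n)%N -> `|q n h| <= C * `|h|.
Proof.
move=> n0; have nr : 0 < n%:R :> R by rewrite ltr0n.
rewrite normrZ ger0_norm ?ler0n//.
have := f_lip (x + n%:R^-1 *: h) x; rewrite (addrC x) addrK normrZ ger0_norm ?invr_ge0 ?ler0n//.
by rewrite mulrCA -ler_pdivlMl ?invr_gt0// invrK.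
Qed.

Let L_le h : `|L h| <= C * `|h|.
Proof.
have c : (fun n => `|q n h|) @ \oo --> `|L h| by apply: cvg_norm; exact: q_cvg.
rewrite -(cvg_lim (@Rhausdorff R) c); apply: limr_le; first by apply/cvg_ex; exists `|L h|.
by exists 1%N => // n /= n0; exact: q_le.
Qed.

(** The increments over k / n taken from x + h / n and from x agree up to e1 |k| / n. *)
Let L_D h k : L (h + k) = L h + L k.
Proof.
apply/eqP; rewrite -subr_eq0 -normr_eq0 eq_le normr_ge0 andbT.
apply/ler_addgt0Pl => e e0; rewrite addr0.
pose e1 := e / (`|k| + 1).
have k1 : 0 < `|k| + 1 by rewrite ltr_wpDl.
have e10 : 0 < e1 by rewrite divr_gt0.
have [d d0 hd] := f_strict e10.
have c : (fun n => `|q n (h + k) - (q n h + q n k)|) @ \oo --> `|L (h + k) - (L h + L k)|.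
  apply: cvg_norm; apply: cvgB; first exact: q_cvg.
  by apply: cvgD; exact: q_cvg.
rewrite -(cvg_lim (@Rhausdorff R) c); apply: limr_le.
  by apply/cvg_ex; exists `|L (h + k) - (L h + L k)|.
exists (Num.bound ((`|h| + `|k|) / d)).+1 => // n /= nN.
have n0 : (0 < n)%N by exact: leq_ltn_trans nN.
have nr : 0 < n%:R :> R by rewrite ltr0n.
have hk : `|h| + `|k| < n%:R * d.
  rewrite -ltr_pdivrMr//.
  have B := @archi_boundP R ((`|h| + `|k|) / d); rewrite divr_ge0 ?(ltW d0) ?addr_ge0// in B.
  by rewrite (lt_trans (B isT))// ltr_nat.
have hh : `|n%:R^-1 *: h| < d.
  rewrite normrZ ger0_norm ?invr_ge0// mulrC ltr_pdivrMr// mulrC.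
  by rewrite (le_lt_trans _ hk)// lerDl.
have kk : `|n%:R^-1 *: k| < d.
  rewrite normrZ ger0_norm ?invr_ge0// mulrC ltr_pdivrMr// mulrC.
  by rewrite (le_lt_trans _ hk)// lerDr.
have := hd (x + n%:R^-1 *: h) (n%:R^-1 *: k).
rewrite (addrC x (n%:R^-1 *: h)) addrK => /(_ hh kk); rewrite -(addrC x) => A.
have -> : q n (h + k) - (q n h + q n k) = n%:R *:
   (f (x + n%:R^-1 *: h + n%:R^-1 *: k) - f (x + n%:R^-1 *: h) -
   (f (x + n%:R^-1 *: k) - f x)).
  rewrite /q -scalerDr -scalerBr [n%:R^-1 *: (h + k)]scalerDr (addrA x).
  by rewrite opprD addrA (opprB _ (f x)) subrKA.
rewrite normrZ ger0_norm ?ler0n// (le_trans (ler_wpM2l (ler0n _ _) A))//.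
have -> : `|n%:R^-1 *: k| = n%:R^-1 * `|k| by rewrite normrZ ger0_norm ?invr_ge0 ?ler0n.
rewrite [X in X <= _](_ : _ = e1 * `|k|); last by field; rewrite gt_eqF.
by rewrite /e1 mulrAC ler_pdivrMr// ler_wpM2l ?(ltW e0)// lerDl.
Qed.

Let L_0 : L 0 = 0.
Proof. by have := L_D 0 0; rewrite addr0 => /esym/eqP; rewrite -subr_eq0 addrK => /eqP. Qed.

Let L_nat n h : L (n%:R *: h) = n%:R *: L h.
Proof.
elim: n => [|n ih]; first by rewrite !scale0r L_0.
by rewrite -natr1 !scalerDl !scale1r L_D ih.
Qed.

(** The defect D of homogeneity along h is additive and vanishes at integers, so n D a = D (n a)
    depends only on the fractional part of n a and is bounded in n; hence D a = 0. *)
Let L_Z a h : L (a *: h) = a *: L h.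
Proof.
pose D (r : R) := L (r *: h) - r *: L h.
have DD r s : D (r + s) = D r + D s.
  by rewrite /D !scalerDl L_D opprD addrACA.
have Dn n r : D (n%:R * r) = n%:R *: D r.
  by rewrite /D -!scalerA L_nat scalerBr.
have Dz (m : int) : D m%:~R = 0.
  have D1 n : D n%:R = 0 by rewrite -(mulr1 n%:R) Dn /D !scale1r subrr scaler0.
  case: (intP m) => [|n|n]; rewrite ?D1//.
  have := DD (- n.+1%:Z)%:~R n.+1%:R; rewrite D1 addr0 mulrNz addNr.
  by rewrite /D !scale0r L_0 subrr => <-.
have Db r : 0 <= r < 1 -> `|D r| <= 2 * (C * `|h|).
  move=> /andP[r0 r1]; rewrite (le_trans (ler_normB _ _))//.
  have Ch : 0 <= C * `|h| by rewrite (le_trans _ (L_le h)).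
  rewrite mulr_natl mulr2n lerD//.
    by rewrite (le_trans (L_le _))// normrZ ger0_norm// mulrCA ler_piMl// ltW.
  by rewrite normrZ ger0_norm// (le_trans _ (L_le h))// ler_piMl// ltW.
have D0 : D a = 0.
  apply/eqP; rewrite -normr_eq0 eq_le normr_ge0 andbT leNgt; apply/negP => Da.
  pose n := (Num.bound (2 * (C * `|h|) / `|D a|)).
  have Ch : 0 <= C * `|h| by rewrite (le_trans _ (L_le h)).
  have B := @archi_boundP R (2 * (C * `|h|) / `|D a|).
  have {}B := B (divr_ge0 (mulr_ge0 (ler0n R 2) Ch) (ltW Da)).
  rewrite ltr_pdivrMr// in B; move: B; apply/negP; rewrite -leNgt -/n.
  rewrite -[X in X * _](ger0_norm (ler0n _ _)) -normrZ -Dn.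
  have -> : D (n%:R * a) = D (n%:R * a - (Num.floor (n%:R * a))%:~R).
    have := DD (n%:R * a - (Num.floor (n%:R * a))%:~R) (Num.floor (n%:R * a))%:~R.
    by rewrite subrK Dz addr0.
  apply: Db; rewrite subr_ge0 Num.Theory.floor_le /=.
  by rewrite ltrBlDl -intrD1 Num.Theory.floorD1_gt.
by apply/eqP; rewrite -subr_eq0; apply/eqP.
Qed.

(** [f_strict] is strict differentiability with the derivative eliminated. The derivative is
    recovered as the limit L of the quotients, and [q_refine] from index 1, passed to the limit, is
    the Frechet estimate. *)
Lemma strict_differentiable : differentiable f x.
Proof.
apply: (@differentiable_of_linear x L C).
- by move=> a h k; rewrite L_D L_Z.
- exact: L_le.
- move=> e e0; have [d d0 hd] := q_refine e0; exists d => // h hh.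
  have c : (fun n => `|q 1 h - q n h|) @ \oo --> `|q 1 h - L h|.
    by apply: cvg_norm; apply: cvgB; [exact: cvg_cst|exact: q_cvg].
  have -> : f (x + h) - f x = q 1 h by rewrite /q invr1 !scale1r.
  rewrite -(cvg_lim (@Rhausdorff R) c); apply: limr_le.
    by apply/cvg_ex; exists `|q 1 h - L h|.
  exists 1%N => // n /= n0.
  by have := hd 1%N n h (leqnn _) n0; rewrite mul1n mulr1 => /(_ hh).
Qed.

End strict_differentiability.

Section dense_extension.
Variables (R : realType) (V W : normedModType R).
Hypothesis W_complete : forall F : set_system W, ProperFilter F -> cauchy F -> cvg F.
Variables (D : nat -> V) (f : nat -> W) (c : R).
Hypothesis D_dense : forall (x : V) (e : R), 0 < e -> exists n, `|x - D n| < e.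
Hypothesis c0 : 0 <= c.
Hypothesis f_lip : forall m n, `|f m - f n| <= c * `|D m - D n|.

(** The value at x is characterised by |y - f m| <= c |x - D m| for all m; agreement on D and the
    Lipschitz bound follow from these inequalities alone, whatever the approximating sequence. *)
Lemma lipschitz_extension : exists phi : V -> W,
  (forall m, phi (D m) = f m) /\ forall x y, `|phi x - phi y| <= c * `|x - y|.
Proof.
have ex x : exists y, forall m, `|y - f m| <= c * `|x - D m|.
  have /choice[a ha] (k : nat) : exists n, `|x - D n| < k.+1%:R^-1.
    by apply: D_dense; rewrite invr_gt0.
  have Da : (fun k => D (a k)) @ \oo --> x.
    apply/cvgrPdist_lt => e e0; near=> k; apply: (lt_trans (ha k)).
    by near: k; exact: near_infty_natSinv_lt (PosNum e0).
  have cf : cvg ((fun k => f (a k)) @ \oo).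
    apply: W_complete; apply: cauchy_exP => e e0.
    have ce : 0 < e / (c + 1) / 2 by rewrite !divr_gt0// ltr_wpDl.
    move/cvgrPdist_lt : Da => /(_ _ ce)[N _ hN].
    exists (f (a N)); exists N => // k /= Nk; rewrite -ball_normE /=.
    apply: (le_lt_trans (f_lip _ _)).
    have h : `|D (a N) - D (a k)| < e / (c + 1).
      rewrite -(subrKA x) (le_lt_trans (ler_normD _ _))// (splitr (e / _)) ltrD//.
        by rewrite distrC; exact: (hN N (leqnn _)).
      exact: hN.
    apply: (@le_lt_trans _ _ (c * (e / (c + 1)))); first by rewrite ler_wpM2l// ltW.
    have c1 : 0 < c + 1 by rewrite ltr_wpDl.
    by rewrite mulrCA gtr_pMr// ltr_pdivrMr// mul1r ltrDl.
  exists (lim ((fun k => f (a k)) @ \oo)) => m.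
  have h1 : (fun k => `|f (a k) - f m|) @ \oo --> `|lim ((fun k => f (a k)) @ \oo) - f m|.
    by apply: cvg_norm; apply: cvgB; [exact: cf|exact: cvg_cst].
  have h2 : (fun k => c * `|D (a k) - D m|) @ \oo --> c * `|x - D m|.
    by apply: cvgM; [exact: cvg_cst|apply: cvg_norm; apply: cvgB; [exact: Da|exact: cvg_cst]].
  apply: (ler_cvg_to h1 h2); apply: nearW => k; exact: f_lip.
have [phi hphi] := choice ex; exists phi; split=> [m|x y].
  apply/eqP; rewrite -subr_eq0 -normr_eq0 eq_le normr_ge0 andbT.
  by have := hphi (D m) m; rewrite subrr normr0 mulr0.
apply/ler_addgt0Pl => e e0.
have ce : 0 < e / (2 * c + 1) by rewrite divr_gt0// ltr_wpDl// mulr_ge0.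
have [m hm] := D_dense x ce.
rewrite -(subrKA (f m)) (le_trans (ler_normD _ _))//.
have h1 := hphi x m; have h2 := hphi y m; rewrite distrC in h2.
have h3 : `|y - D m| <= `|x - y| + `|x - D m|.
  by rewrite -(subrKA x) (le_trans (ler_normD _ _))// distrC.
have h4 : c * `|y - D m| <= c * `|x - y| + c * `|x - D m| by rewrite -mulrDr ler_wpM2l.
have h5 : 2 * c * `|x - D m| <= e.
  have c1 : 0 < 2 * c + 1 by rewrite ltr_wpDl// mulr_ge0.
  apply: (@le_trans _ _ ((2 * c + 1) * `|x - D m|)); first by rewrite ler_wpM2r// lerDl.
  by rewrite mulrC -ler_pdivlMr// ltW.
lra.
Unshelve. all: by end_near. Qed.

Hypothesis D_add : forall m n, exists l, D l = D m + D n.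
Hypothesis f_strict : forall (x : V) (e : R), 0 < e -> exists2 r, 0 < r &
  forall m n l a b, `|D m - x| < r -> `|D n - x| < r -> `|D l| < r ->
    D a = D m + D l -> D b = D n + D l ->
    `|f a - f m - (f b - f n)| <= e * `|D l|.

Lemma differentiable_extension : exists phi : V -> W,
  [/\ forall m, phi (D m) = f m, forall x y, `|phi x - phi y| <= c * `|x - y| &
      forall x, differentiable phi x].
Proof.
have [phi [phiD phi_lip]] := lipschitz_extension.
exists phi; split => // x; apply: (strict_differentiable W_complete phi_lip).
move=> e e0; have [r r0 hr] := f_strict x e0; exists r => // y k yx kr.
apply/ler_addgt0Pl => s s0.
(* Replacing the four values of phi by values of f costs c (2 t + 2 t + t + t) = 6 c t, and
   replacing |k| by |D l| costs e t. *)
pose C := e + 6 * c + 1.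
have C0 : 0 < C by rewrite /C ltr_wpDl// addr_ge0 ?mulr_ge0// ltW.
pose t := Num.min (s / C) (Num.min (r - `|y - x|) (r - `|k|)).
have t0 : 0 < t by rewrite !lt_min !subr_gt0 yx kr divr_gt0.
have [m hm] := D_dense y t0; have [n hn] := D_dense x t0; have [l hl] := D_dense k t0.
have [a ha] := D_add m l; have [b hb] := D_add n l.
have tr : t <= r - `|y - x| by rewrite /t !ge_min lexx orbT.
have tk : t <= r - `|k| by rewrite /t !ge_min lexx !orbT.
have ts : C * t <= s by rewrite mulrC -ler_pdivlMr// /t ge_min lexx.
have mx : `|D m - x| < r.
  rewrite -(subrKA y) (le_lt_trans (ler_normD _ _))// (distrC _ y); lra.
have nx : `|D n - x| < r.
  rewrite distrC (lt_le_trans hn)// (le_trans tr)// gerBl//.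
have lk : `|D l| <= `|k| + t.
  rewrite -[D l](subrK k) (le_trans (ler_normD _ _))// addrC (distrC _ k) lerD2l ltW//.
have lr : `|D l| < r.
  rewrite -[D l](subrK k) (le_lt_trans (ler_normD _ _))// (distrC _ k); lra.
have key := hr m n l a b mx nx lr ha hb.
have app u j (v : R) : `|u - D j| <= v -> `|phi u - f j| <= c * v.
  by move=> uv; rewrite -phiD (le_trans (phi_lip _ _))// ler_wpM2l.
have p1 : `|phi (y + k) - f a| <= c * (2 * t).
  apply: app; rewrite ha opprD addrACA (le_trans (ler_normD _ _))//; lra.
have p2 : `|phi (x + k) - f b| <= c * (2 * t).
  apply: app; rewrite hb opprD addrACA (le_trans (ler_normD _ _))//; lra.
have p3 : `|phi y - f m| <= c * t by apply: app; exact: ltW.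
have p4 : `|phi x - f n| <= c * t by apply: app; exact: ltW.
have -> : phi (y + k) - phi y - (phi (x + k) - phi x) =
  (f a - f m - (f b - f n)) +
  ((phi (y + k) - f a) - (phi y - f m) - ((phi (x + k) - f b) - (phi x - f n))).
  have sw (p q p' q' : W) : (p - q) - (p' - q') = (p - p') - (q - q').
    by rewrite !opprD !opprK addrACA.
  rewrite (sw _ (f a) (phi y)) (sw _ (f b) (phi x)).
  by rewrite (sw _ (f a - f m)) [RHS]addrC subrK.
apply: (le_trans (ler_normD _ _)).
set N := `|_ - _ - (_ - (phi x - f n))|.
have hN : N <= c * (2 * t) + c * t + (c * (2 * t) + c * t).
  by rewrite /N (le_trans (ler_normB _ _))// lerD// (le_trans (ler_normB _ _))// lerD.
have k2 : e * `|D l| <= e * `|k| + e * t by rewrite -mulrDr ler_wpM2l// ltW.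
have CE : C * t = e * t + 6 * (c * t) + t by rewrite /C; ring.
lra.
Qed.

End dense_extension.

(** * Oscillation of the derivative of the drift *)

(** If the set has no supremum, [sup] takes its default value 0. *)
Lemma nonneg_sup_ge0 (R : realType) (A : set R) : (forall r, A r -> 0 <= r) -> 0 <= sup A.
Proof.
move=> A0; have [hs|/sup_out -> //] := pselect (has_sup A).
have [[r Ar] ub] := hs; exact: le_trans (A0 r Ar) (ub_le_sup ub Ar).
Qed.

Lemma subr_subr (V : zmodType) (x y d : V) : x - y = (x - d) - (y - d).
Proof. by rewrite opprB addrA subrK. Qed.

Section drift.
Variables (R : realType) (H : normedModType R) (ip : H -> H -> R).
Hypothesis ipBl : forall x y z, ip (x - y) z = ip x z - ip y z.
Hypothesis ipZl : forall a x z, ip (a *: x) z = a * ip x z.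
Hypothesis ipxx : forall x, ip x x = `|x| ^+ 2.
Hypothesis ip_le : forall x y, `|ip x y| <= `|x| * `|y|.

Let ip_continuousl w : continuous (fun z => ip z w).
Proof.
apply: (@lipschitz_continuous R H R _ `|w|) => a b; rewrite -ipBl mulrC; exact: ip_le.
Qed.

(** Same body as [opnorm], over the abstract space of this section; at [Hper R] the two are
    convertible. *)
Definition opn (A : H -> H) : R := sup [set `|A h| | h in [set h | `|h| <= 1]].

Lemma opn_ge0 (A : H -> H) : 0 <= opn A.
Proof.
apply: nonneg_sup_ge0 => _ [h _ <-]; exact: normr_ge0.
Qed.

Lemma opn_le (A : H -> H) h : linear A -> continuous A -> `|A h| <= opn A * `|h|.
Proof.
move=> lA cA; have [C C0 hC] := linear_continuous_le lA cA.
have [->|h0] := eqVneq h 0; first by rewrite (linear_fun0 lA) !normr0 mulr0.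
have hp : 0 < `|h| by rewrite normr_gt0.
rewrite -ler_pdivrMr// mulrC -[X in X * _]gtr0_norm ?invr_gt0// -normrZ.
rewrite -(linear_funZ lA); apply: ub_le_sup.
  exists C => _ [k /= k1 <-]; rewrite (le_trans (hC k))// ler_piMr//.
by exists (`|h|^-1 *: h) => //=; rewrite normrZ gtr0_norm ?invr_gt0// mulVf ?gt_eqF.
Qed.

Lemma norm_ip_le (w : H) (K : R) : 0 <= K -> ip w w <= K * `|w| -> `|w| <= K.
Proof.
move=> K0; rewrite ipxx; have [->|w0] := eqVneq w 0; first by rewrite normr0.
by rewrite expr2 ler_pM2r// normr_gt0.
Qed.

Variable F : H -> H.

Lemma is_derive_ip_line (b u w : H) (s : R) : differentiable F (b + s *: u) ->
  is_derive s 1 (fun s : R => ip (F (b + s *: u)) w) (ip ('d F (b + s *: u) u) w).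
Proof.
move=> dF.
have h0 : h^-1 *: ((F \o shift (b + s *: u)) (h *: u) - F (b + s *: u)) @[h --> 0^'] -->
    'd F (b + s *: u) u.
  have := diff_derivable (v := u) dF; rewrite /derivable => /cvgP.
  by rewrite -(deriveE u dF) /derive.
have h1 : h^-1 *: (((fun s : R => ip (F (b + s *: u)) w) \o shift s) (h *: 1) -
    ip (F (b + s *: u)) w) @[h --> 0^'] --> ip ('d F (b + s *: u) u) w.
  have := cvg_comp _ (fun z => ip z w) h0 (@ip_continuousl w _).
  apply: cvg_trans; apply: near_eq_cvg; apply: nearW => h.
  have E : ip (h^-1 *: (F (h *: u + (b + s *: u)) - F (b + s *: u))) w =
      h^-1 * (ip (F (b + (h * 1 + s) *: u)) w - ip (F (b + s *: u)) w).
    by rewrite ipZl ipBl mulr1 scalerDl addrCA.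
  exact: E.
apply: DeriveDef; first by apply/cvg_ex; exists (ip ('d F (b + s *: u) u) w).
by apply: cvg_lim h1; exact: Rhausdorff.
Qed.

Hypothesis F_diff : forall x, differentiable F x.

(** The mean value theorem is scalar, so the error vector w = F a - F b - v is tested against
    itself: this gives |w|^2 <= K |w|. *)
Lemma segment_mvt (a b v : H) (K : R) : 0 <= K ->
  (forall s : R, 0 <= s <= 1 -> `|'d F (b + s *: (a - b)) (a - b) - v| <= K) ->
  `|F a - F b - v| <= K.
Proof.
move=> K0 hK; set u := a - b; pose w := F a - F b - v.
apply: norm_ip_le => //; rewrite -/w.
pose f (s : R) := ip (F (b + s *: u)) w - s * ip v w.
have df (s : R) : is_derive s 1 f (ip ('d F (b + s *: u) u - v) w).
  have h1 := is_derive_ip_line (b := b) (u := u) w (F_diff (b + s *: u)).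
  have h2 : is_derive s 1 (fun s => s * ip v w) (ip v w).
    by apply: is_derive_eq; rewrite /GRing.scale/= mulr1 mulr0 add0r.
  by rewrite ipBl; exact: is_deriveB.
have cf : continuous f.
  by move=> s; apply/differentiable_continuous/derivable1_diffP; case: (df s).
have [s s01] := MVT_segment ler01 (fun s _ => df s) (continuous_subspaceT cf).
rewrite subr0 mulr1 /f scale1r mul1r scale0r addr0 mul0r subr0.
rewrite /u [b + _]addrC subrK => e.
have -> : ip w w = ip (F a) w - ip v w - ip (F b) w by rewrite {1}/w !ipBl; ring.
rewrite e; apply: le_trans (ler_norm _) _; apply: le_trans (ip_le _ _) _.
by rewrite ler_wpM2r//; apply: hK; move: s01; rewrite in_itv.
Qed.

Lemma segment_ball (a b p : H) (d s : R) : `|a - p| <= d -> `|b - p| <= d ->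
  0 <= s <= 1 -> `|b + s *: (a - b) - p| <= d.
Proof.
move=> ad bd /andP[s0 s1].
have -> : b + s *: (a - b) - p = s *: (a - p) + (1 - s) *: (b - p).
  have e : a - b = (a - p) - (b - p) by rewrite opprB addrA subrK.
  by rewrite addrAC e scalerBr scalerBl scale1r addrCA.
rewrite (le_trans (ler_normD _ _))// !normrZ !ger0_norm ?subr_ge0//.
have -> : d = s * d + (1 - s) * d by ring.
by rewrite lerD// ler_wpM2l// subr_ge0.
Qed.

Hypothesis F_C1 : forall x, opn (fun h => 'd F y h - 'd F x h) @[y --> x] --> (0 : R).
Hypothesis F_bnd : has_ubound (range (fun x => opn ('d F x))).
Local Notation L := (sup (range (fun x => opn ('d F x)))).

Lemma dF_cont x : continuous ('d F x).
Proof. exact: diff_continuous. Qed.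

Lemma supnorm_ge0 : 0 <= L.
Proof. by apply: nonneg_sup_ge0 => _ [x _ <-]; exact: opn_ge0. Qed.

Lemma dF_le x h : `|'d F x h| <= L * `|h|.
Proof.
apply: le_trans (opn_le _ _ _) _; [exact: linearP|exact: dF_cont|].
by rewrite ler_wpM2r//; apply: ub_le_sup => //; exists x.
Qed.

Lemma F_lipschitz a b : `|F a - F b| <= L * `|a - b|.
Proof.
rewrite -(subr0 (F a - F b)); apply: segment_mvt.
  by rewrite mulr_ge0// supnorm_ge0.
by move=> s _; rewrite subr0 dF_le.
Qed.

Definition dF_osc_le (e : R) (p : H) (r : R) := forall z z' h : H,
  `|z - p| < r -> `|z' - p| < r -> `|'d F z h - 'd F z' h| <= e * `|h|.

(* The cap at 1 makes the supremum finite. *)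
Definition osc_radius (e : R) (p : H) : R :=
  sup [set r | 0 <= r <= 1 /\ dF_osc_le e p r].

Let has_sup_osc e p : has_sup [set r | 0 <= r <= 1 /\ dF_osc_le e p r].
Proof.
split; last by exists 1 => r [/andP[]].
(* Radius 0 always qualifies, the open ball being empty. *)
by exists 0; split; [rewrite lexx ler01|move=> z z' h; rewrite normr_lt0].
Qed.

Lemma osc_radius_gt0 e p : 0 < e -> 0 < osc_radius e p.
Proof.
move=> e0; have e2 : 0 < e / 2 by rewrite divr_gt0.
have /cvgrPdist_lt/(_ _ e2) := @F_C1 p.
move=> /nbhs_normP[d /= d0 hd].
have m0 : 0 < Num.min d 1 by rewrite lt_min d0 ltr01.
apply: (lt_le_trans m0); apply: ub_le_sup; first by case: (has_sup_osc e p).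
split; first by rewrite ltW// ge_min lexx orbT.
have one z h : `|z - p| < Num.min d 1 -> `|'d F z h - 'd F p h| <= e / 2 * `|h|.
  rewrite lt_min => /andP[zd _].
  have := hd z; rewrite /= distrC => /(_ zd); rewrite sub0r normrN ger0_norm ?opn_ge0// => /ltW op.
  apply: le_trans (opn_le (A := fun h => 'd F z h - 'd F p h) h _ _) _.
  - move=> a u v; rewrite (linearP ('d F z) a u v) (linearP ('d F p) a u v).
    by rewrite scalerBr opprD addrACA.
  - by move=> u; apply: cvgB; exact: dF_cont.
  - by rewrite ler_wpM2r.
move=> z z' h hz hz'.
rewrite -(subrKA ('d F p h)) (le_trans (ler_normD _ _))// (splitr e) mulrDl lerD ?one//.
by rewrite distrC one.
Qed.

Lemma osc_radiusP e p d : d < osc_radius e p -> forall z z' h : H,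
  `|z - p| <= d -> `|z' - p| <= d -> `|'d F z h - 'd F z' h| <= e * `|h|.
Proof.
move=> /sup_gt -/(_ (has_sup_osc e p).1)[r [_ hr] dr] z z' h zd zd'.
by apply: hr; exact: le_lt_trans dr.
Qed.

(** A radius r admissible at p makes r - |p - q| admissible at q, as the smaller ball lies inside
    the larger one. *)
Lemma osc_radius_sub e p q : osc_radius e p - `|p - q| <= osc_radius e q.
Proof.
rewrite lerBlDr; apply: ge_sup; first by case: (has_sup_osc e p).
move=> r [/andP[r0 r1] hr]; rewrite -lerBlDr.
have [h|h] := leP 0 (r - `|p - q|); last first.
  apply: (le_trans (ltW h)); apply: ub_le_sup; first by case: (has_sup_osc e q).
  by split; [rewrite lexx ler01|move=> z z' k; rewrite normr_lt0].
apply: ub_le_sup; first by case: (has_sup_osc e q).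
split; first by rewrite h (le_trans _ r1)// gerBl.
move=> z z' k hz hz'; apply: hr.
  rewrite -(subrKA q) (le_lt_trans (ler_normD _ _))// -ltrBrDr.
  by rewrite [`|q - p|]distrC.
rewrite -(subrKA q) (le_lt_trans (ler_normD _ _))// -ltrBrDr.
by rewrite [`|q - p|]distrC.
Qed.

(* Lipschitz in p, equal to 1 if the radius is at most d and to 0 if it is at least 2 d. *)
Definition osc_cutoff (e d : R) (p : H) : R :=
  Num.max 0 (Num.min 1 (2 - osc_radius e p / d)).

Lemma osc_cutoff01 e d p : 0 <= osc_cutoff e d p <= 1.
Proof. by rewrite /osc_cutoff le_max lexx /= ge_max ler01 ge_min lexx. Qed.

Lemma osc_cutoff_cases e d p : 0 < d -> osc_cutoff e d p = 1 \/ d < osc_radius e p.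
Proof.
move=> d0; have [h|h] := leP (osc_radius e p) d; [left|by right].
have : osc_radius e p / d <= 1 by rewrite ler_pdivrMr// mul1r.
rewrite /osc_cutoff => h1; rewrite min_l ?max_r//; lra.
Qed.

Lemma osc_cutoff0 e d p : 0 < d -> 2 * d <= osc_radius e p -> osc_cutoff e d p = 0.
Proof.
move=> d0 h; have : 2 <= osc_radius e p / d by rewrite ler_pdivlMr.
rewrite /osc_cutoff => h1; rewrite max_l// ge_min; apply/orP; right; lra.
Qed.

Lemma osc_cutoff_lipschitz e d p q : 0 < d ->
  `|osc_cutoff e d p - osc_cutoff e d q| <= d^-1 * `|p - q|.
Proof.
move=> d0.
have r : `|osc_radius e p / d - osc_radius e q / d| <= d^-1 * `|p - q|.
  rewrite -mulrBl mulrC normrM gtr0_norm ?invr_gt0// ler_wpM2l ?invr_ge0 ?(ltW d0)//.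
  rewrite ler_norml; have := osc_radius_sub e p q; have := osc_radius_sub e q p.
  by rewrite (distrC q p); lra.
apply: le_trans r; rewrite /osc_cutoff.
set a := _ / d; set b := _ / d.
rewrite /Num.max /Num.min; do !case: ifPn; rewrite -?leNgt => *; rewrite ?subrr ?normr0 ?sub0r ?subr0 ?normrN//; 
  have := ler_norm (a - b); have := ler_norm (b - a); rewrite (distrC b a) => *;
  rewrite ler_norml; lra.
Qed.

(** With v = b' - b, replacing a' by a + v costs L times the second difference. What remains
    compares the increments of F over the same v from a and from b: where the cutoff is 1 the
    Lipschitz bound 2 L M is used, otherwise both increments are within e |v| of ['d F a v]. *)
Lemma drift_second_diff (e d M : R) (a a' b b' : H) : 0 < e -> 0 < d ->
  `|b' - b| <= M -> `|b - a| <= d -> `|b' - a| <= d -> `|b' - b| <= d ->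
  `|F a' - F a - (F b' - F b)| <=
  L * `|a' - a - (b' - b)| + (2 * e + 2 * L * osc_cutoff e d a) * M.
Proof.
move=> e0 d0 bM ba b'a bb.
set v := b' - b.
have -> : F a' - F a - (F b' - F b) =
   (F a' - F (a + v)) + (F (a + v) - F a - (F b' - F b)).
  by rewrite addrA subrKA.
rewrite (le_trans (ler_normD _ _))// lerD//.
  by apply: le_trans (F_lipschitz _ _) _; rewrite opprD addrA.
have M0 : 0 <= M by exact: le_trans bM.
have L0 := supnorm_ge0.
have /andP[x0 x1] := osc_cutoff01 e d a.
have [h|h] := @osc_cutoff_cases e d a d0.
  rewrite h mulr1 (le_trans (ler_normB _ _))//.
  apply: (@le_trans _ _ (L * M + L * M)); last first.
    have eM : 0 <= e * M by rewrite mulr_ge0// ltW.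
    by set S := sup _; lra.
  rewrite lerD// (le_trans (F_lipschitz _ _))// ler_wpM2l//.
  by rewrite (addrC a) addrK.
have step x : `|x - a| <= d -> `|x + v - a| <= d -> `|F (x + v) - F x - 'd F a v| <= e * `|v|.
  move=> xa xva; apply: segment_mvt; first by rewrite mulr_ge0// ltW.
  move=> s s01; have xv : x + v - x = v by rewrite (addrC x) addrK.
  rewrite xv; apply: (osc_radiusP h); last by rewrite subrr normr0 ltW.
  have := segment_ball xva xa s01.
  by rewrite xv.
have A : `|F (a + v) - F a - 'd F a v| <= e * `|v|.
  by apply: step; rewrite ?subrr ?normr0 ?(ltW d0)// (addrC a) addrK.
have B : `|F b' - F b - 'd F a v| <= e * `|v|.
  have bv : b + v = b' by rewrite /v addrC subrK.
  by have := step b ba; rewrite bv; apply.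
have -> : F (a + v) - F a - (F b' - F b) =
    (F (a + v) - F a - 'd F a v) - (F b' - F b - 'd F a v).
  exact: subr_subr.
rewrite (le_trans (ler_normB _ _))// (le_trans (lerD A B))//.
have : e * `|v| <= e * M by rewrite ler_wpM2l// ltW.
have : 0 <= L * osc_cutoff e d a * M by rewrite !mulr_ge0.
by rewrite mulrDl -!mulrA; lra.
Qed.

(** The linear map ['d F a] acts on the defect k (a' - a) - u, and the Taylor remainder is treated
    as for second differences. Here k is the inverse step of a difference quotient, so M bounds k
    |a' - a|. *)
Lemma drift_first_diff (e d M k : R) (a a' u : H) : 0 < e -> 0 < d -> 0 <= k ->
  k * `|a' - a| <= M -> `|a' - a| <= d ->
  `|k *: (F a' - F a) - 'd F a u| <=
  L * `|k *: (a' - a) - u| + (2 * e + 2 * L * osc_cutoff e d a) * M.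
Proof.
move=> e0 d0 k0 kM aa.
have -> : k *: (F a' - F a) - 'd F a u =
   'd F a (k *: (a' - a) - u) + k *: (F a' - F a - 'd F a (a' - a)).
  have ld : linear ('d F a) by move=> c x y; exact: linearP.
  rewrite (linear_funB ld) (linear_funZ ld) (scalerBr k _ ('d F a (a' - a))).
  by rewrite [RHS]addrC subrKA.
rewrite (le_trans (ler_normD _ _))// lerD ?dF_le//.
have M0 : 0 <= M by rewrite (le_trans _ kM)// mulr_ge0.
have L0 := supnorm_ge0.
have /andP[x0 x1] := osc_cutoff01 e d a.
rewrite normrZ ger0_norm//.
have [h|h] := @osc_cutoff_cases e d a d0.
  rewrite h mulr1.
  have A : `|F a' - F a - 'd F a (a' - a)| <= 2 * L * `|a' - a|.
    rewrite (le_trans (ler_normB _ _))// -mulrA mulr_natl mulr2n lerD ?dF_le//.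
    exact: F_lipschitz.
  apply: (le_trans (ler_wpM2l k0 A)).
  rewrite mulrCA (@le_trans _ _ (2 * L * M))// ?ler_wpM2l ?mulr_ge0//.
  have eM : 0 <= e * M by rewrite mulr_ge0// ltW.
  by set S := sup _; lra.
have A : `|F a' - F a - 'd F a (a' - a)| <= e * `|a' - a|.
  apply: segment_mvt; first by rewrite mulr_ge0// ltW.
  move=> s s01; apply: (osc_radiusP h); last by rewrite subrr normr0 ltW.
  by apply: segment_ball s01 => //; rewrite subrr normr0 ltW.
apply: (le_trans (ler_wpM2l k0 A)); rewrite mulrCA.
have : e * (k * `|a' - a|) <= e * M by rewrite ler_wpM2l// ltW.
have : 0 <= L * osc_cutoff e d a * M by rewrite !mulr_ge0.
have : 0 <= e * M by rewrite mulr_ge0// ltW.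
by rewrite mulrDl -!mulrA; lra.
Qed.

End drift.

(** * Gronwall's inequality *)

Section lower_integral.
Context d (T : measurableType d) (R : realType) (mu : {measure set T -> \bar R}).

(* No measurability: the integral of a nonnegative function is a supremum over simple functions. *)
Lemma ge0_le_integral_upper (D : set T) (f g : T -> \bar R) :
  (forall x, D x -> (0 <= f x)%E) -> (forall x, D x -> (f x <= g x)%E) ->
  (\int[mu]_(x in D) f x <= \int[mu]_(x in D) g x)%E.
Proof.
move=> f0 fg; have g0 x : D x -> (0 <= g x)%E by move=> Dx; apply: le_trans (fg x Dx); exact: f0.
rewrite !ge0_integralE//; apply: ereal_sup_le => _ [h hf <-].
exists h => // x; apply: (le_trans (hf x)); rewrite !patchE.
by case: ifPn => // /set_mem/fg.
Qed.

End lower_integral.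

Section gronwall.
Variable R : realType.
Local Notation leb := (@lebesgue_measure R).

Lemma within_sub_itv (T t : R) (f : R -> R) : t <= T -> {within `[0, T], continuous f} ->
  {within `[0, t], continuous f}.
Proof.
move=> tT; apply: continuous_subspaceW => s /=; rewrite !in_itv /= => /andP[-> st].
exact: le_trans tT.
Qed.

Lemma within_integrable (t : R) (f : R -> R) : {within `[0, t], continuous f} ->
  leb.-integrable `[0, t] (EFin \o f).
Proof. by move=> cf; apply: continuous_compact_integrable => //; exact: segment_compact. Qed.

Lemma ae_singleton (t : R) : {ae leb, forall s, s <> t}.
Proof.
exists [set t]; split => //; first exact: lebesgue_measure_set1.
by move=> s /=; apply: contra_notP.
Qed.

Lemma Rintegral_FTC (t : R) (F f : R -> R) : 0 <= t ->
  (forall s : R, is_derive s 1 F (f s)) -> continuous f ->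
  \int[leb]_(s in `[0, t]) f s = F t - F 0.
Proof.
rewrite le_eqVlt => /predU1P[<- _ _|t0 Ff cf].
  by rewrite set_itv1 Rintegral_set1 subrr.
have cF : continuous F.
  by move=> x; apply/differentiable_continuous/derivable1_diffP; case: (Ff x).
rewrite /Rintegral (@continuous_FTC2 _ f F)//.
- exact: continuous_subspaceT.
- split; first by move=> x _; case: (Ff x).
  + by apply: cvg_at_right_filter; exact: cF.
  + by apply: cvg_at_left_filter; exact: cF.
- by move=> x _; rewrite derive1E; apply: derive_val.
Qed.

Lemma is_derive_expRZ (b s : R) : is_derive s 1 (fun s => expR (b * s)) (b * expR (b * s)).
Proof.
have h : is_derive s 1 (fun s : R => b * s) b by apply: is_derive_eq; rewrite /GRing.scale/= mulr1.
rewrite mulrC.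
exact: (@is_derive1_comp _ (@expR R) (fun s => b * s) s _ _ (is_derive_expR _) h).
Qed.

Lemma continuous_expRZ (b : R) : continuous (fun s => expR (b * s)).
Proof.
by move=> s; apply/differentiable_continuous/derivable1_diffP; case: (is_derive_expRZ b s).
Qed.

Lemma Rintegral_expRZ (b t : R) : 0 <= t ->
  b * \int[leb]_(s in `[0, t]) expR (b * s) = expR (b * t) - 1.
Proof.
move=> t0; rewrite -RintegralZl//; last first.
  by apply: within_integrable; apply: continuous_subspaceT; exact: continuous_expRZ.
rewrite (Rintegral_FTC t0 (is_derive_expRZ b)); first by rewrite mulr0 expR0.
by move=> s; apply: cvgM; [exact: cvg_cst|exact: continuous_expRZ].
Qed.

(** No integral is differentiated. If psi = phi - a exp (b t), rescaled by exp (- be t), had a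
    positive maximum, then inserting psi s <= max exp (be s) into the integral inequality at the
    maximum point would be contradictory. *)
Lemma gronwall (phi : R -> R) (T a b : R) : 0 <= T -> 0 <= b ->
  {within `[0, T], continuous phi} ->
  (forall t, 0 <= t <= T -> phi t <= a + b * \int[leb]_(s in `[0, t]) phi s) ->
  phi T <= a * expR (b * T).
Proof.
move=> T0 b0 cphi hphi.
pose psi t := phi t - a * expR (b * t).
have cae (c : R) : continuous (fun s => c * expR (b * s)).
  by move=> s; apply: cvgM; [exact: cvg_cst|exact: continuous_expRZ].
have cpsi : {within `[0, T], continuous psi}.
  move=> s; apply: cvgB; first exact: cphi.
  by have := continuous_subspaceT (A := `[0, T]%classic) (@cae a); apply.
have hpsi t : 0 <= t <= T -> psi t <= b * \int[leb]_(s in `[0, t]) psi s.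
  move=> /andP[t0 tT].
  rewrite /psi RintegralB//; last 2 first.
  - by apply: within_integrable; exact: within_sub_itv cphi.
  - by apply: within_integrable; exact: continuous_subspaceT.
  rewrite mulrBr RintegralZl//; last first.
    by apply: within_integrable; apply: continuous_subspaceT; exact: continuous_expRZ.
  rewrite (mulrCA b) Rintegral_expRZ//.
  have := hphi t; rewrite t0 tT => /(_ isT); lra.
(* With I the integral of exp (be s) over [0, c], a positive maximum forces be I + 1 <= b I, which a
   rate be >= b excludes. *)
pose be := 2 * b + 1.
have be0 : 0 < be by rewrite /be; lra.
pose chi t := psi t * expR (- be * t).
have cchi : {within `[0, T], continuous chi}.
  move=> s; apply: cvgM; first exact: cpsi.
  by have := continuous_subspaceT (A := `[0, T]%classic) (@continuous_expRZ (- be)); apply.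
have [c c0T cmax] := EVT_max T0 cchi.
have psiE t : psi t = chi t * expR (be * t).
  by rewrite /chi -mulrA -expRD mulNr addNr expR0 mulr1.
suff chi0 : chi c <= 0.
  have : psi T <= 0.
    rewrite psiE pmulr_lle0 ?expR_gt0//; apply: le_trans chi0.
    by apply: cmax; rewrite in_itv /= T0 lexx.
  by rewrite /psi subr_le0.
rewrite leNgt; apply/negP => M0.
move: (c0T); rewrite in_itv /= => /andP[c0 cT].
have := hpsi c; rewrite c0 cT => /(_ isT).
have ub : \int[leb]_(s in `[0, c]) psi s <= \int[leb]_(s in `[0, c]) (chi c * expR (be * s)).
  apply: le_Rintegral => //.
  - by apply: within_integrable; exact: within_sub_itv cpsi.
  - apply: within_integrable; apply: continuous_subspaceT => s.
    by apply: cvgM; [exact: cvg_cst|exact: continuous_expRZ].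
  - move=> s; rewrite /= in_itv /= => /andP[s0 sc].
    rewrite psiE ler_wpM2r ?expR_ge0//; apply: cmax.
    by rewrite in_itv /= s0 (le_trans sc).
rewrite RintegralZl// in ub; last first.
  by apply: within_integrable; apply: continuous_subspaceT; exact: continuous_expRZ.
have := @Rintegral_expRZ be c c0.
set I := \int[leb]_(s in _) expR _ in ub *; move=> e hc.
have I0 : 0 <= I by apply: Rintegral_ge0 => s _; exact: expR_ge0.
have : psi c <= b * (chi c * I) by apply: (le_trans hc); rewrite ler_wpM2l.
rewrite psiE mulrCA ler_pM2l// => h.
have : 0 <= b * I by rewrite mulr_ge0.
have : 0 <= I by [].
move: e h; rewrite /be; set E := expR _; lra.
Qed.

End gronwall.

(** * Square-integrable random variables *)

Section separable.
Variable R : realType.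
Local Notation H := (Hper R).

Lemma Hper_separable : exists D : nat -> H, forall (x : H) (e : R), 0 < e ->
  exists n, `|x - D n| < e.
Proof.
(* Finite rational combinations of the basis, coded by lists of rationals; a number that codes no
   list gives 0. *)
pose c (s : seq rat) : H := \sum_(0 <= i < size s) (ratr (nth 0 s i) : R) *: fbasis R i.
exists (fun n => oapp c 0 (unpickle n)) => x e e0.
have e2 : 0 < e / 2 by rewrite divr_gt0.
have ex := on_expansion (@fbasis_on R) (@fbasis_total R) (x := x).
move/cvgrPdist_lt : ex => /(_ _ e2)[N _ /(_ N (leqnn N)) hN].
have n1 i : `|fbasis R i| = 1.
  by apply/eqP; rewrite -(@eqrXn2 _ 2)// -ipxx fbasis_on eqxx expr1n.
have d0 : 0 < e / (2 * N.+1%:R) by rewrite divr_gt0// mulr_gt0.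
have /choice[q hq] : forall i, exists q : rat, `|ip x (fbasis R i) - ratr q| < e / (2 * N.+1%:R).
  move=> i; have lti : ip x (fbasis R i) - e / (2 * N.+1%:R) < ip x (fbasis R i).
    by rewrite gtrBl.
  have [q] := rat_in_itvoo lti.
  rewrite in_itv /= => /andP[q1 q2]; exists q; rewrite gtr0_norm ?subr_gt0//.
  by rewrite ltrBlDr -ltrBlDl.
exists (pickle (mkseq q N)); rewrite pickleK /= /c size_mkseq.
rewrite -(subrKA (\sum_(0 <= i < N) ip x (fbasis R i) *: fbasis R i)).
rewrite (le_lt_trans (ler_normD _ _))// [ltRHS]splitr ltr_leD//.
rewrite -sumrB (le_trans (ler_norm_sum _ _ _))//.
apply: (@le_trans _ _ (\sum_(0 <= i < N) (e / (2 * N.+1%:R)))).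
  rewrite big_nat [X in _ <= X]big_nat; apply: ler_sum => i /andP[_ iN].
  by rewrite -scalerBl normrZ n1 mulr1 nth_mkseq// ltW.
rewrite sumr_const_nat subn0 -[leLHS]mulr_natl.
rewrite [X in X <= _](_ : _ = e / 2 * (N%:R / N.+1%:R)); last by field; rewrite gt_eqF.
by rewrite ler_piMr ?(ltW e2)// ler_pdivrMr// mul1r ler_nat.
Qed.

End separable.

Lemma diff_seq_cvg (R : realType) (V W : normedModType R) (F : V -> W) (a h : V) :
  differentiable F a ->
  (fun n => n.+1%:R *: (F (a + n.+1%:R^-1 *: h) - F a)) @ \oo --> 'd F a h.
Proof.
move=> dF.
have h0 : t^-1 *: ((F \o shift a) (t *: h) - F a) @[t --> 0^'] --> 'd F a h.
  have := diff_derivable (v := h) dF; rewrite /derivable => /cvgP.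
  by rewrite -(deriveE h dF) /derive.
apply/cvgrPdist_lt => e e0; move/cvgrPdist_lt : h0 => /(_ _ e0)[d /= d0 hd].
exists (Num.bound d^-1) => // n /= nN.
have n0 : 0 < n.+1%:R^-1 :> R by rewrite invr_gt0.
have hb : ball_ [eta normr] 0 d n.+1%:R^-1.
  rewrite /ball_ /mkset sub0r normrN gtr0_norm//.
  rewrite -[ltRHS]invrK ltf_pV2 ?posrE ?invr_gt0//.
  have B := @archi_boundP R d^-1; rewrite invr_ge0 in B.
  by rewrite (lt_le_trans (B (ltW d0)))// ler_nat ltnW.
by have := hd _ hb (lt0r_neq0 n0); rewrite invrK /shift (addrC a).
Qed.

Section Hper_rv.
Context d (Omega : measurableType d) (R : realType).
Local Notation H := (Hper R).
Implicit Types (Y Z : Omega -> H).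

Definition borel_rv Y := forall U : set H, open U -> measurable (Y @^-1` U).

Lemma borel_rv_comp (F : H -> H) Y : continuous F -> borel_rv Y -> borel_rv (fun w => F (Y w)).
Proof.
move=> cF mY U oU; have /continuousP/(_ _ oU) oFU := cF.
exact: mY oFU.
Qed.

Lemma borel_rv_real (f : H -> R) Y : continuous f -> borel_rv Y ->
  measurable_fun setT (fun w => f (Y w)).
Proof.
move=> cf mY; apply: (measurability _ (RGenOpens.measurableE R)) => _ [_ [a [b ->]] <-].
rewrite setTI; have /continuousP/(_ `]a, b[%classic) := cf.
move=> /(_ (interval_open _ _)) oU; first exact: (mY _ (oU _ _)).
Qed.

Lemma borel_rv_ip Y c : borel_rv Y -> measurable_fun setT (fun w => ip (Y w) c).
Proof. exact: (borel_rv_real (@ip_continuousl R c)). Qed.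

Lemma borel_rv_norm Y : borel_rv Y -> measurable_fun setT (fun w => `|Y w|).
Proof. by apply: borel_rv_real => x; exact: norm_continuous. Qed.

(** By Parseval the distance to a fixed point is a limit of functions of the coordinates, so
    preimages of balls are measurable; by separability every open set is a countable union of
    balls. *)
Lemma borel_rvP Y : (forall k, measurable_fun setT (fun w => ip (Y w) (fbasis R k))) ->
  borel_rv Y.
Proof.
move=> mY; have [D hD] := Hper_separable R.
have mball (p : H) (r : R) : measurable [set w | `|Y w - p| < r].
  have m2 : measurable_fun setT (fun w => `|Y w - p| ^+ 2).
    apply: (@measurable_fun_cvg _ _ _ _ (fun n w => \sum_(0 <= i < n) ip (Y w - p) (fbasis R i) ^+ 2)).
      move=> n; apply: measurable_sum => i; apply: measurable_funX.
      under eq_fun do rewrite ipBl.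
      by apply: measurable_funB => //; exact: measurable_cst.
    by move=> w _; exact: (parseval (@fbasis_on R) (@fbasis_total R)).
  have [r0|r0] := leP r 0.
    rewrite (_ : [set _ | _] = set0); first exact: measurable0.
    by rewrite -subset0 => w /=; rewrite ltNge (le_trans r0).
  rewrite (_ : [set _ | _] = [set w | `|Y w - p| ^+ 2 < r ^+ 2]).
    have := m2 measurableT `]-oo, r ^+ 2[%classic (measurable_itv _).
    rewrite setTI; set A := _ @^-1` _; set B := [set w | _]; suff -> : A = B by [].
    by apply/seteqP; split => w; rewrite /A /B /= in_itv.
  by apply/seteqP; split => w /=; rewrite ltr_pXn2r// nnegrE// ltW.
move=> U oU.
pose I := [set nq : nat * nat | forall z, `|z - D nq.1| < nq.2.+1%:R^-1 -> U z].
rewrite (_ : Y @^-1` U = \bigcup_(nq in I) [set w | `|Y w - D nq.1| < nq.2.+1%:R^-1]).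
  rewrite bigcup_mkcond; apply: countable_bigcupT_measurable => // nq.
  by case: ifP => _; [exact: mball|exact: measurable0].
apply/seteqP; split=> [w Uw|w [nq hU /hU]]; last by [].
have /nbhs_normP[e /= e0 he] : nbhs (Y w) U by exact: open_nbhs_nbhs.
have [q hq] : exists q : nat, q.+1%:R^-1 < e / 2.
  exists (Num.bound (e / 2)^-1); have e2 : 0 < e / 2 by rewrite divr_gt0.
  rewrite -[ltRHS]invrK ltf_pV2 ?posrE ?invr_gt0//.
  have B := @archi_boundP R (e / 2)^-1; rewrite invr_ge0 ?(ltW e2) in B.
  by rewrite (lt_trans (B isT))// ltr_nat.
have q0 : 0 < q.+1%:R^-1 :> R by rewrite invr_gt0.
have [n hn] := hD (Y w) _ q0.
exists (n, q) => //= z hz; apply: he => /=.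
rewrite -(subrKA (D n)) (le_lt_trans (ler_normD _ _))// [ltRHS]splitr.
by rewrite ltrD// ?(lt_trans hn)// distrC (lt_trans hz).
Qed.

Lemma borel_rvD Y Z : borel_rv Y -> borel_rv Z -> borel_rv (fun w => Y w + Z w).
Proof.
move=> mY mZ; apply: borel_rvP => k; under eq_fun do rewrite ipDl.
by apply: measurable_funD; exact: borel_rv_ip.
Qed.

Lemma borel_rvZ a Y : borel_rv Y -> borel_rv (fun w => a *: Y w).
Proof.
move=> mY; apply: borel_rvP => k; under eq_fun do rewrite ipZl.
by apply: measurable_funM => //; exact: borel_rv_ip.
Qed.

Lemma borel_rvB Y Z : borel_rv Y -> borel_rv Z -> borel_rv (fun w => Y w - Z w).
Proof.
move=> mY mZ; apply: borel_rvP => k; under eq_fun do rewrite ipBl.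
by apply: measurable_funB; exact: borel_rv_ip.
Qed.

Lemma borel_rv_cst x : borel_rv (fun=> x).
Proof. by apply: borel_rvP => k; exact: measurable_cst. Qed.

(** The derivative applied to a random direction is a limit of difference quotients of F, which
    avoids measurability in a space of operators. *)
Lemma borel_rv_dF (F : H -> H) Y Z : (forall x, differentiable F x) -> borel_rv Y -> borel_rv Z ->
  borel_rv (fun w => 'd F (Y w) (Z w)).
Proof.
move=> dF mY mZ; apply: borel_rvP => k.
pose u n w := n.+1%:R *: (F (Y w + n.+1%:R^-1 *: Z w) - F (Y w)).
apply: (@measurable_fun_cvg _ _ _ _ (fun n w => ip (u n w) (fbasis R k))).
  move=> n; apply: borel_rv_ip; apply: borel_rvZ; apply: borel_rvB; last first.
    by apply: borel_rv_comp => // x; apply: differentiable_continuous.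
  apply: borel_rv_comp; first by move=> x; apply: differentiable_continuous.
  by apply: borel_rvD => //; exact: borel_rvZ.
move=> w _; apply: ip_cvgl.
exact: diff_seq_cvg.
Qed.

End Hper_rv.

Section L2_rv.
Context d (Omega : measurableType d) (R : realType) (P : probability Omega R).
Local Notation H := (Hper R).
Implicit Types (X Y Z : Omega -> H) (f g psi : Omega -> R).

Definition nrm2 f : R := Num.sqrt (\int[P]_w (f w ^+ 2)).

Lemma nrm2_L2of f (hf : f \in Lfun P 2%:E) : `|L2of hf| = nrm2 f.
Proof.
have := L2of_norm_int hf => e.
rewrite /nrm2 /Rintegral -e /= sqrtr_sqr ger0_norm//.
Qed.

Lemma Lfun2M_integrable f g : f \in Lfun P 2%:E -> g \in Lfun P 2%:E ->
  P.-integrable setT (EFin \o (fun w => f w * g w)).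
Proof. exact: Lfun2_mul_integrable. Qed.

Lemma Lfun2_measurable f : f \in Lfun P 2%:E -> measurable_fun setT f.
Proof. by rewrite inE => /andP[+ _]; rewrite inE. Qed.

Lemma Lfun2P f : f \in Lfun P 2%:E <->
  measurable_fun setT f /\ P.-integrable setT (EFin \o (fun w => f w ^+ 2)).
Proof.
split=> [hf|[mf /integrable_lty h]].
  by split; [exact: Lfun2_measurable|exact: Lfun2_integrable_sqr].
by apply: Lfun2_sqr_intP => //; exact: h.
Qed.

Lemma cauchy_schwarz_R f g : f \in Lfun P 2%:E -> g \in Lfun P 2%:E ->
  `|\int[P]_w (f w * g w)| <= nrm2 f * nrm2 g.
Proof.
move=> hf hg; rewrite -(nrm2_L2of hf) -(nrm2_L2of hg).
apply: le_trans (L2ip_le (L2of hf) (L2of hg)).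
rewrite L2ip_L2of le_eqVlt; apply/orP; left; apply/eqP; congr `|_|.
apply/esym; apply: ae_eq_Rintegral.
- by apply: measurable_funM; [exact: L2_measurable|exact: Lfun2_measurable].
- by apply: measurable_funM; exact: Lfun2_measurable.
- by apply: ae_mono (L2ofE hf) => w /(_ I) -> _.
Qed.

Lemma Lfun2_dom f g : measurable_fun setT f -> g \in Lfun P 2%:E ->
  (forall w, `|f w| <= `|g w|) -> f \in Lfun P 2%:E.
Proof.
move=> mf /Lfun2P[mg ig] fg; apply/Lfun2P; split => //.
apply: le_integrable ig => //; first by apply/measurable_EFinP; exact: measurable_funX.
by move=> w _ /=; rewrite lee_fin !normrX lerXn2r ?nnegrE.
Qed.

Lemma Lfun2D f g : f \in Lfun P 2%:E -> g \in Lfun P 2%:E -> (fun w => f w + g w) \in Lfun P 2%:E.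
Proof.
move=> hf hg.
have p1 : (1 <= 2%:E :> \bar R)%E by rewrite lee_fin ler1n.
by have [_ h] := Lfun_addr_closed P p1; exact: h hf hg.
Qed.

Lemma Lfun2Z a f : f \in Lfun P 2%:E -> (fun w => a * f w) \in Lfun P 2%:E.
Proof.
move=> /Lfun2P[mf i_f]; apply/Lfun2P; split; first exact: measurable_funM.
have := integrableZl measurableT (a ^+ 2) i_f.
by apply: eq_integrable => // w _ /=; rewrite exprMn.
Qed.

Lemma L2_rvP Y : L2_rv P Y <-> borel_rv Y /\ (fun w => `|Y w|) \in Lfun P 2%:E.
Proof.
split=> [[mY hY]|[mY hY]]; split => //.
  rewrite inE; apply/andP; split; rewrite inE//=; exact: borel_rv_norm.
by move: hY; rewrite inE => /andP[_]; rewrite inE.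
Qed.

Lemma L2_rv_ip Y c : L2_rv P Y -> (fun w => ip (Y w) c) \in Lfun P 2%:E.
Proof.
move=> /L2_rvP[mY hY]; apply: (Lfun2_dom _ (Lfun2Z `|c| hY)); first exact: borel_rv_ip.
by move=> w; rewrite normrM !normr_id mulrC ip_le.
Qed.

Lemma L2_rv_domR Y f : borel_rv Y -> f \in Lfun P 2%:E -> (forall w, `|Y w| <= f w) -> L2_rv P Y.
Proof.
move=> mY hf Yf; apply/L2_rvP; split => //.
apply: (Lfun2_dom _ hf); first exact: borel_rv_norm.
by move=> w; rewrite normr_id (le_trans (Yf w))// ler_norm.
Qed.

Lemma L2_rvD Y Z : L2_rv P Y -> L2_rv P Z -> L2_rv P (fun w => Y w + Z w).
Proof.
move=> /L2_rvP[mY hY] /L2_rvP[mZ hZ].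
by apply: (L2_rv_domR _ (Lfun2D hY hZ)); [exact: borel_rvD|move=> w; exact: ler_normD].
Qed.

Lemma L2_rvZ a Y : L2_rv P Y -> L2_rv P (fun w => a *: Y w).
Proof.
move=> /L2_rvP[mY hY].
by apply: (L2_rv_domR _ (Lfun2Z `|a| hY)); [exact: borel_rvZ|move=> w; rewrite normrZ].
Qed.

Lemma L2_rvB Y Z : L2_rv P Y -> L2_rv P Z -> L2_rv P (fun w => Y w - Z w).
Proof.
move=> hY hZ; have := L2_rvD hY (L2_rvZ (-1) hZ).
by under eq_fun do rewrite scaleN1r.
Qed.

Lemma Lfun2_cst (a : R) : (fun=> a) \in Lfun P 2%:E.
Proof. exact: Lfun_cst. Qed.

Lemma L2_rv_cst (x : H) : L2_rv P (fun=> x).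
Proof. by apply: (L2_rv_domR _ (Lfun2_cst `|x|)) => //; exact: borel_rv_cst. Qed.

Lemma L2_rv_sum (I : Type) (s : seq I) (Y : I -> Omega -> H) :
  (forall i, L2_rv P (Y i)) -> L2_rv P (fun w => \sum_(i <- s) Y i w).
Proof.
move=> hY; elim: s => [|i s ih].
  by under eq_fun do rewrite big_nil; exact: L2_rv_cst.
by under eq_fun do rewrite big_cons; exact: L2_rvD.
Qed.

Definition hnrm2 Y : R := nrm2 (fun w => `|Y w|).

Lemma nrm2_ge0 f : 0 <= nrm2 f. Proof. exact: sqrtr_ge0. Qed.

Lemma nrm2_sqr f : nrm2 f ^+ 2 = \int[P]_w (f w ^+ 2).
Proof. by rewrite sqr_sqrtr// Rintegral_ge0// => w _; exact: sqr_ge0. Qed.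

Lemma L2_normE Y : L2_rv P Y -> L2_norm P Y = (hnrm2 Y)%:E.
Proof.
move=> /L2_rvP[mY hY]; rewrite /L2_norm unlock.
have -> : (\int[P]_w (`|(EFin \o (fun w => `|Y w|%R)) w| `^ 2) =
    (\int[P]_w (`|Y w| ^+ 2))%:E)%E.
  rewrite /Rintegral fineK; last first.
    by apply: integrable_fin_num => //; exact: Lfun2_integrable_sqr.
  by apply: eq_integral => w _; rewrite /= normr_id powR_mulrn.
rewrite poweR_EFin powR12_sqrt// Rintegral_ge0// => w _; exact: sqr_ge0.
Qed.

Lemma nrm2_ip_le Y c : L2_rv P Y -> nrm2 (fun w => ip (Y w) c) <= `|c| * hnrm2 Y.
Proof.
move=> hY; have [mY nY] := (L2_rvP Y).1 hY.
rewrite -(@ler_pXn2r _ 2)// ?nnegrE ?nrm2_ge0 ?mulr_ge0 ?nrm2_ge0//.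
rewrite exprMn !nrm2_sqr -RintegralZl//; last exact: Lfun2_integrable_sqr.
apply: le_Rintegral => //.
- by apply: Lfun2_integrable_sqr; exact: L2_rv_ip.
- have := Lfun2_integrable_sqr (Lfun2Z `|c| nY).
  by apply: eq_integrable => // w _ /=; rewrite exprMn.
- move=> w _; rewrite -exprMn -[leLHS]real_normK ?num_real// lerXn2r ?nnegrE ?mulr_ge0//.
  by rewrite mulrC ip_le.
Qed.

Lemma scalar_le psi Y c : psi \in Lfun P 2%:E -> L2_rv P Y ->
  `|\int[P]_w (psi w * ip (Y w) c)| <= nrm2 psi * `|c| * hnrm2 Y.
Proof.
move=> hpsi hY; apply: (le_trans (cauchy_schwarz_R hpsi (L2_rv_ip c hY))).
by rewrite -mulrA ler_wpM2l ?nrm2_ge0// nrm2_ip_le.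
Qed.

Lemma scalar_integrable psi Y c : psi \in Lfun P 2%:E -> L2_rv P Y ->
  P.-integrable setT (EFin \o (fun w => psi w * ip (Y w) c)).
Proof. by move=> hpsi hY; apply: Lfun2M_integrable => //; exact: L2_rv_ip. Qed.

Lemma scalar_sub psi Y Z c : psi \in Lfun P 2%:E -> L2_rv P Y -> L2_rv P Z ->
  \int[P]_w (psi w * ip (Y w - Z w) c) =
  \int[P]_w (psi w * ip (Y w) c) - \int[P]_w (psi w * ip (Z w) c).
Proof.
move=> hpsi hY hZ; rewrite -RintegralB//; try exact: scalar_integrable.
by apply: eq_Rintegral => w _; rewrite ipBl mulrBr.
Qed.

Lemma scalar_lin psi Y Z c (a b : R) : psi \in Lfun P 2%:E -> L2_rv P Y -> L2_rv P Z ->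
  \int[P]_w (psi w * ip (a *: Y w + b *: Z w) c) =
  a * (\int[P]_w (psi w * ip (Y w) c)) + b * \int[P]_w (psi w * ip (Z w) c).
Proof.
move=> hpsi hY hZ; rewrite -!RintegralZl//; try exact: scalar_integrable.
have iZ (e : R) (V : Omega -> H) : L2_rv P V ->
    P.-integrable setT (EFin \o (fun w => e * (psi w * ip (V w) c))).
  by move=> hV; have := integrableZl measurableT e (scalar_integrable c hpsi hV).
rewrite -RintegralD//; try exact: iZ.
by apply: eq_Rintegral => w _; rewrite ipDl !ipZl; ring.
Qed.

Lemma scalar_sum psi c (n : nat) (a : nat -> R) (Y : nat -> Omega -> H) :
  psi \in Lfun P 2%:E -> (forall i, L2_rv P (Y i)) ->
  \int[P]_w (psi w * ip (\sum_(i < n) a i *: Y i w) c) =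
  \sum_(i < n) a i * \int[P]_w (psi w * ip (Y i w) c).
Proof.
move=> hpsi hY; elim: n => [|n ih].
  rewrite big_ord0; under eq_Rintegral do rewrite big_ord0 ip0l mulr0.
  by rewrite Rintegral_cst// mul0r.
have hs : L2_rv P (fun w => \sum_(i < n) a i *: Y i w).
  by apply: L2_rv_sum => i; exact: L2_rvZ.
transitivity (1 * (\int[P]_w (psi w * ip (\sum_(i < n) a i *: Y i w) c)) +
    a n * \int[P]_w (psi w * ip (Y n w) c)); last by rewrite mul1r ih big_ord_recr.
rewrite -(scalar_lin c 1 (a n) hpsi hs (hY n)); apply: eq_Rintegral => w _.
by rewrite big_ord_recr scale1r.
Qed.

End L2_rv.

Section integrable_real.
Context d (T : measurableType d) (R : realType) (mu : {measure set T -> \bar R}).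
Variables (D : set T) (mD : measurable D).
Implicit Types f g : T -> R.

Lemma integrableR_D f g : mu.-integrable D (EFin \o f) ->
  mu.-integrable D (EFin \o g) -> mu.-integrable D (EFin \o (fun s => f s + g s)).
Proof. by move=> hf hg; apply: eq_integrable (integrableD mD hf hg). Qed.

Lemma integrableR_B f g : mu.-integrable D (EFin \o f) ->
  mu.-integrable D (EFin \o g) -> mu.-integrable D (EFin \o (fun s => f s - g s)).
Proof. by move=> hf hg; apply: eq_integrable (integrableB mD hf hg). Qed.

Lemma integrableR_Z f k : mu.-integrable D (EFin \o f) ->
  mu.-integrable D (EFin \o (fun s => k * f s)).
Proof. by move=> hf; apply: eq_integrable (integrableZl mD k hf). Qed.

Lemma integrableR_sum (n : nat) (f : 'I_n -> T -> R) :
  (forall i, mu.-integrable D (EFin \o f i)) ->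
  mu.-integrable D (EFin \o (fun s => \sum_(i < n) f i s)) /\
  \int[mu]_(s in D) (\sum_(i < n) f i s) = \sum_(i < n) \int[mu]_(s in D) f i s.
Proof.
elim: n f => [|n ih] f hf.
  have e0 : (fun s => \sum_(i < 0) f i s) = cst 0 by apply/funext => s; rewrite big_ord0.
  rewrite e0 big_ord0; split; first exact: integrable0.
  by rewrite /Rintegral integral0_eq.
have e1 : (fun s => \sum_(i < n.+1) f i s) =
    (fun s => (\sum_(i < n) f (widen_ord (leqnSn n) i) s) + f ord_max s).
  by apply/funext => s; rewrite big_ord_recr.
have [i1 i2] := ih (fun i => f (widen_ord (leqnSn n) i)) (fun i => hf _).
by rewrite e1 big_ord_recr /= -i2; split; [exact: integrableR_D|exact: RintegralD].
Qed.

End integrable_real.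

(** * Bochner integrals tested against random variables *)

Section bochner.
Context d (Omega : measurableType d) (R : realType) (P : probability Omega R).
Local Notation H := (Hper R).
Local Notation leb := (@lebesgue_measure R).

Lemma Rintegral_step (D : set R) (A : nat -> set R) (b : nat -> R) (n : nat) :
  measurable D -> (leb D < +oo)%E -> (forall i, measurable (A i) /\ A i `<=` D) ->
  leb.-integrable D (EFin \o (fun s => \sum_(i < n) \1_(A i) s * b i)) /\
  \int[leb]_(s in D) (\sum_(i < n) \1_(A i) s * b i) =
  \sum_(i < n) fine (leb (A i)) * b i.
Proof.
move=> mD fD hA.
have i0 i : leb.-integrable D (EFin \o (\1_(A i) : R -> R)).
  have mAD : measurable (A i `&` D) by apply: measurableI => //; exact: (hA i).1.
  apply/integrableP; split.
    by apply/measurable_EFinP; apply: measurable_funTS; exact: measurable_indic (hA i).1.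
  under eq_integral do rewrite /= ger0_norm//.
  rewrite integral_indic//; last exact: (hA i).1.
  apply: le_lt_trans fD; apply: le_measure; rewrite ?inE//; exact: subIsetr.
have i1 i : leb.-integrable D (EFin \o (fun s => \1_(A i) s * b i)).
  have := @integrableZr _ _ _ leb D mD (b i) _ (i0 i).
  by apply: eq_integrable.
have e1 i : \int[leb]_(s in D) (\1_(A i) s * b i) = fine (leb (A i)) * b i.
  rewrite [LHS](@RintegralZr _ _ _ leb D _ (b i) mD (i0 i)).
  congr (_ * _); rewrite /Rintegral integral_indic//; last exact: (hA i).1.
  by rewrite setIidl//; exact: (hA i).2.
have [j1 j2] := @integrableR_sum _ _ _ leb D mD n _ (fun k : 'I_n => i1 k).
split => //; rewrite [LHS]j2; apply: eq_bigr => k _; exact: e1.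
Qed.

(** Pairing with psi and c is a bounded functional on L^2(Omega; H), so it passes through the simple
    functions and their limits. The scalar integrand is only prescribed for almost every s, whence
    the existential a. *)
Lemma bochner_scalar (t : R) (G : R -> Omega -> H) (Z : Omega -> H)
    (psi : Omega -> R) (c : H) :
  is_bochner_integral P t G Z -> psi \in Lfun P 2%:E ->
  exists a : R -> R, [/\ leb.-integrable `[0, t] (EFin \o a),
    {ae leb, forall s, `[0, t]%classic s ->
       L2_rv P (G s) /\ a s = \int[P]_w (psi w * ip (G s w) c)} &
    \int[P]_w (psi w * ip (Z w) c) = \int[leb]_(s in `[0, t]) a s].
Proof.
move=> [hZ [m [A [Y [h1 h2 h3 h4]]]]] hpsi.
pose D : set R := `[0, t]%classic.
have mD : measurable D by exact: measurable_itv.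
have fD : (leb D < +oo)%E.
  by rewrite /D lebesgue_measure_itv /= lte_fin; case: ifP => _; rewrite ?ltry// lte_fin.
pose sim n s w : H := \sum_(i < m n) \1_(A n i) s *: Y n i w.
pose be n i := \int[P]_w (psi w * ip (Y n i w) c).
pose a_ n s := \sum_(i < m n) \1_(A n i) s * be n i.
have L2Y n i : L2_rv P (Y n i) by case: (h1 n i).
have L2s n s : L2_rv P (sim n s) by apply: L2_rv_sum => i; exact: L2_rvZ.
have aE n s : \int[P]_w (psi w * ip (sim n s w) c) = a_ n s.
  exact: (scalar_sum c (m n) (fun i => \1_(A n i) s) hpsi (L2Y n)).
have stp n := Rintegral_step (be n) (m n) mD fD
  (fun i => let: And3 p q _ := h1 n i in conj p q).
have ia n : leb.-integrable D (EFin \o a_ n) := (stp n).1.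
have [N [mN N0 hN]] := h2.
(* A bound on the norm of the functional; adding 1 allows division by K. *)
pose K := nrm2 P psi * `|c| + 1.
have K0 : 0 < K by rewrite ltr_wpDl// mulr_ge0// nrm2_ge0.
pose al s := \int[P]_w (psi w * ip (G s w) c).
(* [al s] is meaningful only where [G s] is square integrable. Setting it to 0 on the exceptional
   set makes a an everywhere limit of measurable functions. *)
pose a := al \_ (D `\` N).
have good s : (D `\` N) s -> L2_rv P (G s) /\ L2_cvg P (fun n => sim n s) (G s).
  move=> [Ds Ns]; apply: contrapT => bad; apply: Ns; apply: hN => /=.
  by move=> /(_ Ds) h; apply: bad.
have adist n s : (D `\` N) s -> ((`|a_ n s - a s| / K)%:E <= L2_norm P (fun w => (sim n s w - G s w)%R))%E.
  move=> Es; have [L2G _] := good s Es.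
  have L2d := L2_rvB (L2s n s) L2G.
  rewrite L2_normE// lee_fin ler_pdivrMr// /a patchE mem_set//.
  rewrite -aE -scalar_sub//.
  rewrite (le_trans (scalar_le c hpsi L2d))// mulrC ler_wpM2l ?nrm2_ge0//.
  by rewrite lerDl.
have acvg s : (D `\` N) s -> (fun n => a_ n s) @ \oo --> a s.
  move=> Es; have [L2G cvG] := good s Es.
  apply/cvgrPdist_lt => e e0.
  have eK : 0 < e / K by rewrite divr_gt0.
  move: cvG => /fine_cvgP[_ /cvgrPdist_lt/(_ _ eK)].
  apply: filterS => n; rewrite /= sub0r normrN => hn.
  have := adist n s Es; rewrite L2_normE//; last exact: L2_rvB.
  rewrite lee_fin ler_pdivrMr// distrC => /le_lt_trans; apply.
  rewrite -ltr_pdivlMr//; apply: le_lt_trans hn.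
  by rewrite L2_normE//= ?ler_norm//; exact: L2_rvB.
have mDN : measurable (D `\` N) by exact: measurableD.
have ma : measurable_fun setT a.
  apply: (@measurable_fun_cvg _ _ _ _ (fun n => a_ n \_ (D `\` N))).
    move=> n; apply/(measurable_restrictT _ mDN).
    apply: (measurable_funS mD); first by move=> s [].
    by have /integrableP[/measurable_EFinP] := ia n.
  move=> s _; rewrite /a /patch; case: ifPn => [/set_mem sE|_]; last exact: cvg_cst.
  by have := acvg s sE; rewrite /a patchE mem_set.
have mdif n : measurable_fun D (fun s => a_ n s - a s).
  apply: measurable_funB; last exact: measurable_funTS.
  by have /integrableP[/measurable_EFinP] := ia n.
have mK n : measurable_fun D (fun s => (`|a_ n s - a s| / K)).
  apply: measurable_funM; last exact: measurable_cst.
  exact: (measurableT_comp (@normr_measurable R setT) (mdif n)).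
have mK1 n : measurable_fun D (fun s => (`|a_ n s - a s| / K * \1_(~` N) s)).
  apply: measurable_funM; first exact: (mK n).
  by apply: measurable_funTS; apply: measurable_indic; exact: measurableC.
pose I n := (\int[leb]_(s in D) (`|a_ n s - a s| / K)%:E)%E.
have I0 : I n @[n --> \oo] --> 0%E.
  apply: (@squeeze_cvge _ _ _ _ (cst 0%E) _
     (fun n => (\int[leb]_(s in D) L2_norm P (fun w => (sim n s w - G s w)%R))%E)).
  - apply: nearW => n; apply/andP; split.
      by apply: integral_ge0 => s _; rewrite lee_fin divr_ge0// ltW.
    rewrite /I (_ : (\int[leb]_(s in D) (`|a_ n s - a s| / K)%:E =
      \int[leb]_(s in D) (`|a_ n s - a s| / K * \1_(~` N) s)%:E)%E); last first.
      apply: ae_eq_integral => //.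
      - apply/measurable_EFinP; exact: (mK n).
      - apply/measurable_EFinP; exact: (mK1 n).
      - exists N; split => // s /=; apply: contra_notP => Ns _.
        by rewrite indicE mem_set// mulr1.
    apply: ge0_le_integral_upper => s Ds.
      by rewrite lee_fin mulr_ge0// divr_ge0// ltW.
    rewrite indicE; case: (boolP (s \in ~` N)) => /= sN.
      by rewrite mulr1; apply: adist; split => //; move/set_mem: sN.
    by rewrite mulr0; exact: Lnorm_ge0.
  - exact: cvg_cst.
  - exact: h3.
have idif n : (I n < +oo)%E -> leb.-integrable D (EFin \o (fun s => a_ n s - a s)).
  move=> In; apply/integrableP; split; first by apply/measurable_EFinP; exact: (mdif n).
  have -> : (\int[leb]_(s in D) `|(EFin \o (fun s => (a_ n s - a s)%R)) s| = K%:E * I n)%E.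
    rewrite /I -ge0_integralZl//; last 3 first.
    - apply/measurable_EFinP; exact: (mK n).
    - by move=> s _; rewrite lee_fin divr_ge0// ltW.
    - by rewrite lee_fin ltW.
    by apply: eq_integral => s _; rewrite -EFinM mulrC divfK// gt_eqF.
  by rewrite lte_mul_pinfty// lee_fin ltW.
(* One index with a finite integral suffices: a is then a step function minus an integrable
   difference. *)
have [N1 _ hN1] : \forall n \near \oo, (I n < +oo)%E.
  move/fine_cvgP : I0 => [+ _]; apply: filterS => n.
  by rewrite ltey => /fin_numP[_ /eqP]; move=> h; apply/eqP.
have iaa : leb.-integrable D (EFin \o a).
  have := @integrableR_B _ _ _ leb D mD _ _ (ia N1) (idif N1 (hN1 N1 (leqnn _))).
  by apply: eq_integrable => // s _ /=; rewrite opprB addrC subrK.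
exists a; split => //.
- exists N; split => // s /=; apply: contra_notP => Ns Ds.
  have Es : (D `\` N) s by [].
  by have [? _] := good s Es; split => //; rewrite /a patchE mem_set.
- have ca : (fun n => \int[leb]_(s in D) a_ n s) @ \oo --> \int[leb]_(s in D) a s.
    apply/cvgrPdist_lt => e e0; have eK : 0 < e / K by rewrite divr_gt0.
    move: I0 => /fine_cvgP[_ /cvgrPdist_lt/(_ _ eK)] hI.
    near=> n.
    have In : (I n < +oo)%E by near: n; exists N1.
    have hn : `|0 - fine (I n)| < e / K by near: n.
    rewrite distrC -RintegralB//.
    apply: (le_lt_trans (le_normr_Rintegral _ _)) => //; first exact: idif.
    have -> : \int[leb]_(s in D) `|a_ n s - a s| = K * fine (I n).
      rewrite -[X in X * _]/(fine K%:E) -fineM//; last first.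
        by rewrite ge0_fin_numE// integral_ge0// => s _; rewrite lee_fin divr_ge0// ltW.
      rewrite /Rintegral; congr fine; rewrite /I -ge0_integralZl//; last 3 first.
      - apply/measurable_EFinP; exact: (mK n).
      - by move=> s _; rewrite lee_fin divr_ge0// ltW.
      - by rewrite lee_fin ltW.
      by apply: eq_integral => s _; rewrite -EFinM mulrC divfK// gt_eqF.
    rewrite mulrC -ltr_pdivlMr//; apply: le_lt_trans hn.
    by rewrite sub0r normrN ler_norm.
  have cz : (fun n => \int[leb]_(s in D) a_ n s) @ \oo --> \int[P]_w (psi w * ip (Z w) c).
    pose Zn n w : H := \sum_(i < m n) fine (leb (A n i)) *: Y n i w.
    have L2Zn n : L2_rv P (Zn n) by apply: L2_rv_sum => i; exact: L2_rvZ.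
    apply/cvgrPdist_lt => e e0; have eK : 0 < e / K by rewrite divr_gt0.
    move: h4 => /fine_cvgP[_ /cvgrPdist_lt/(_ _ eK)]; apply: filterS => n /=.
    rewrite sub0r normrN => hn.
    rewrite (stp n).2 -(scalar_sum c (m n) (fun i => fine (leb (A n i))) hpsi (L2Y n)).
    rewrite distrC -scalar_sub//; last exact: (L2Zn n).
    apply: (le_lt_trans (scalar_le c hpsi (L2_rvB (L2Zn n) hZ))).
    apply: (@le_lt_trans _ _ (K * hnrm2 P (fun w => Zn n w - Z w))).
      by rewrite ler_wpM2r ?nrm2_ge0// lerDl.
    rewrite mulrC -ltr_pdivlMr//; apply: le_lt_trans hn.
    have -> := L2_normE (L2_rvB (L2Zn n) hZ); exact: ler_norm.
  exact: (cvg_unique (@Rhausdorff R) cz ca).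
Unshelve. all: by end_near. Qed.

End bochner.

(** * The energy estimate *)

Lemma le_Rintegral_ae d (T : measurableType d) (R : realType) (mu : {measure set T -> \bar R})
    (D : set T) (f g : T -> R) : measurable D ->
  mu.-integrable D (EFin \o f) -> mu.-integrable D (EFin \o g) ->
  {ae mu, forall x, D x -> f x <= g x} ->
  \int[mu]_(x in D) f x <= \int[mu]_(x in D) g x.
Proof.
move=> mD hf hg fg; rewrite -subr_ge0 -RintegralB//.
have mfg : measurable_fun D (fun x => g x - f x).
  move/integrableP : hf => [/measurable_EFinP mf _].
  by move/integrableP : hg => [/measurable_EFinP mg _]; exact: measurable_funB.
have -> : \int[mu]_(x in D) (g x - f x) = \int[mu]_(x in D) `|g x - f x|.
  rewrite /Rintegral; congr fine; apply: ae_eq_integral => //.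
  - exact/measurable_EFinP.
  - by apply/measurable_EFinP; exact: measurableT_comp.
  - by apply: filterS fg => x fg Dx; rewrite ger0_norm// subr_ge0 fg.
by apply: Rintegral_ge0 => x _.
Qed.

Lemma cvgr_le_of_near (R : realType) (u : nat -> R) (l c : R) : u @ \oo --> l ->
  (\forall n \near \oo, u n <= c) -> l <= c.
Proof.
move=> ul uc; have <- := cvg_lim (@Rhausdorff R) ul.
by apply: limr_le => //; apply/cvg_ex; exists l.
Qed.

Lemma continuous_expR_sub (R : realType) (c t : R) : continuous (fun s : R => expR (c * (t - s))).
Proof.
have -> : (fun s : R => expR (c * (t - s))) = (fun s => expR (c * t) * expR (- c * s)).
  by apply/funext => r; rewrite -expRD; congr expR; ring.
by move=> s; apply: cvgM; [exact: cvg_cst|exact: continuous_expRZ].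
Qed.

Section energy.
Context d (Omega : measurableType d) (R : realType) (P : probability Omega R).
Local Notation H := (Hper R).
Local Notation leb := (@lebesgue_measure R).
Implicit Types (B : set Omega) (u g : R -> Omega -> H) (h : H).

Lemma Lfun2_indic B (f : Omega -> R) : measurable B -> f \in Lfun P 2%:E ->
  (fun w => \1_B w * f w) \in Lfun P 2%:E.
Proof.
move=> mB hf; apply: (Lfun2_dom _ hf).
  by apply: measurable_funM; [exact: measurable_indic|exact: Lfun2_measurable hf].
move=> w; rewrite normrM ler_piMl// indicE; case: (_ \in _); by rewrite ?normr1 ?normr0.
Qed.

Lemma indic_mul_integrable B (f g : Omega -> R) : measurable B -> f \in Lfun P 2%:E ->
  g \in Lfun P 2%:E -> P.-integrable setT (EFin \o (fun w => \1_B w * (f w * g w))).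
Proof.
move=> mB hf hg; have := Lfun2M_integrable (Lfun2_indic mB hf) hg.
by apply: eq_integrable => // w _ /=; rewrite mulrA.
Qed.

Lemma indic_sqr_integrable B (f : Omega -> R) : measurable B -> f \in Lfun P 2%:E ->
  P.-integrable setT (EFin \o (fun w => \1_B w * f w ^+ 2)).
Proof. by move=> mB hf; exact: (indic_mul_integrable mB hf hf). Qed.

Lemma indic_integrable B : measurable B -> P.-integrable setT (EFin \o (\1_B : Omega -> R)).
Proof.
move=> mB; have := indic_mul_integrable mB (Lfun2_cst P 1) (Lfun2_cst P 1).
by apply: eq_integrable => // w _ /=; rewrite !mulr1.
Qed.

Lemma indic_ge0 B w : 0 <= \1_B w :> R.
Proof. by rewrite indicE. Qed.

(* The k-th Fourier coefficient of the mild equation, tested against psi in L^2(Omega). The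
   index - k on the right comes from D_xi (cos k xi + sin k xi) = k (cos (- k xi) + sin (- k xi)). *)
Definition mode_eq (T : R) h g u : Prop :=
  forall t, 0 <= t <= T -> forall (k : int) (psi : Omega -> R), psi \in Lfun P 2%:E ->
  exists a : R -> R, [/\ leb.-integrable `[0, t] (EFin \o a),
    {ae leb, forall s, `[0, t]%classic s ->
      a s = - k%:~R * expR (- lam R k * (t - s)) *
              \int[P]_w (psi w * ip (g s w) (cbasis R (- k)))} &
    \int[P]_w (psi w * ip (u t w) (cbasis R k)) =
      expR (- lam R k * t) * ip h (cbasis R k) * \int[P]_w (psi w) +
      \int[leb]_(s in `[0, t]) a s].

(* Young's inequality with weights such that the two terms in x add up, after integration over
   [0, t], to x / 2 for every k. *)
Lemma mode_energy B T h g u t (k : int) : measurable B -> mode_eq T h g u ->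
  0 <= t <= T -> L2_rv P (u t) -> (forall s, 0 <= s <= T -> L2_rv P (g s)) ->
  let x := \int[P]_w (\1_B w * ip (u t w) (cbasis R k) ^+ 2) in
  exists a : R -> R, [/\ leb.-integrable `[0, t] (EFin \o a),
    {ae leb, forall s, `[0, t]%classic s ->
      a s <= (k%:~R ^+ 2 * expR (- (2 * k%:~R ^+ 2) * (t - s))) * x +
             4^-1 * expR (- 2 * (t - s)) *
             \int[P]_w (\1_B w * ip (g s w) (cbasis R (- k)) ^+ 2)} &
    x <= 2^-1 * expR (- (2 * k%:~R ^+ 2) * t) * x +
         2^-1 * expR (- 2 * t) * ip h (cbasis R k) ^+ 2 * \int[P]_w (\1_B w) +
         \int[leb]_(s in `[0, t]) a s].
Proof.
move=> mB hm tT hu hg x.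
pose p w := ip (u t w) (cbasis R k).
have hp : p \in Lfun P 2%:E by exact: L2_rv_ip.
have hpsi := Lfun2_indic mB hp.
have [a [ia aE uE]] := hm t tT k _ hpsi.
have ix : P.-integrable setT (EFin \o (fun w => \1_B w * p w ^+ 2)) by exact: indic_sqr_integrable.
exists a; split => //.
- apply: ae_mono aE => s aE hs; rewrite aE//.
  set c := - k%:~R * _; pose q w := ip (g s w) (cbasis R (- k)).
  have sT : 0 <= s <= T.
    move: hs tT; rewrite /= in_itv /= => /andP[-> st] /andP[_]; exact: le_trans st.
  have hq : q \in Lfun P 2%:E by apply: L2_rv_ip; exact: hg.
  have iq := indic_sqr_integrable mB hq.
  set A := k%:~R ^+ 2 * _; set D := 4^-1 * _.
  rewrite /x -!RintegralZl//; last exact: Lfun2M_integrable.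
  rewrite -RintegralD//; [|exact: integrableR_Z|exact: integrableR_Z].
  apply: le_Rintegral => //.
  + by apply: integrableR_Z => //; exact: Lfun2M_integrable.
  + by apply: integrableR_D => //; exact: integrableR_Z.
  move=> w _; rewrite -/(p w) -/(q w).
  have -> : c * (\1_B w * p w * q w) = \1_B w * (c * (p w * q w)) by ring.
  have -> : A * (\1_B w * p w ^+ 2) + D * (\1_B w * q w ^+ 2) =
    \1_B w * (A * p w ^+ 2 + D * q w ^+ 2) by ring.
  apply: ler_wpM2l; first exact: indic_ge0.
  (* As [lam k] = k^2 + 1, the kernel is a product: the factor k exp (- k^2 r) goes with the
     coefficient of u and exp (- r) with that of g, so that the difference of the two sides is a
     square. *)
  have cE : c = - (k%:~R * expR (- k%:~R ^+ 2 * (t - s))) * expR (- (t - s)).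
    rewrite /c /lam !mulNr -mulrA -expRD; congr (- (_ * expR _)); ring.
  have AE : A = (k%:~R * expR (- k%:~R ^+ 2 * (t - s))) ^+ 2.
    rewrite /A exprMn; congr (_ * _); rewrite -expRM_natl; congr expR; ring.
  have DE : D = 4^-1 * expR (- (t - s)) ^+ 2.
    rewrite /D; congr (_ * _); rewrite -expRM_natl; congr expR; ring.
  rewrite cE AE DE; set y := k%:~R * _; set z := expR _.
  move: (p w) (q w) => p' q'; rewrite -subr_ge0.
  have -> : y ^+ 2 * p' ^+ 2 + 4^-1 * z ^+ 2 * q' ^+ 2 - - y * z * (p' * q') =
    (y * p' + 2^-1 * z * q') ^+ 2 by field.
  exact: sqr_ge0.
- have xE : \int[P]_w (\1_B w * p w * ip (u t w) (cbasis R k)) = x.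
    by apply: eq_Rintegral => w _; rewrite -mulrA -expr2.
  rewrite -{1}xE uE lerD2r.
  set c := expR _ * _; set A := 2^-1 * _; set D := 2^-1 * _ * _.
  rewrite /x -!RintegralZl//; last 2 first.
  + exact: indic_integrable.
  + by have := Lfun2M_integrable hpsi (Lfun2_cst P 1); apply: eq_integrable => // w _ /=; rewrite mulr1.
  rewrite -RintegralD//; [|exact: integrableR_Z|by apply: integrableR_Z => //; exact: indic_integrable].
  apply: le_Rintegral => //.
  + apply: integrableR_Z => //.
    by have := Lfun2M_integrable hpsi (Lfun2_cst P 1); apply: eq_integrable => // w _ /=; rewrite mulr1.
  + by apply: integrableR_D => //; apply: integrableR_Z => //; exact: indic_integrable.
  move=> w _; rewrite -/(p w).
  have -> : c * (\1_B w * p w) = \1_B w * (c * p w) by ring.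
  have -> : A * (\1_B w * p w ^+ 2) + D * \1_B w = \1_B w * (A * p w ^+ 2 + D) by ring.
  apply: ler_wpM2l; first exact: indic_ge0.
  have cE : c = expR (- k%:~R ^+ 2 * t) * (expR (- t) * ip h (cbasis R k)).
    rewrite /c /lam mulrA -expRD; congr (expR _ * _); ring.
  have AE : A = 2^-1 * (expR (- k%:~R ^+ 2 * t)) ^+ 2.
    rewrite /A; congr (_ * _); rewrite -expRM_natl; congr expR; ring.
  have DE : D = 2^-1 * (expR (- t) * ip h (cbasis R k)) ^+ 2.
    rewrite /D exprMn -mulrA; congr (_ * (_ * _)); rewrite -expRM_natl; congr expR; ring.
  rewrite cE AE DE; set y := expR _; set z := _ * ip _ _.
  have := sqr_ge0 (y * p w - z); nra.
Qed.

Lemma Rintegral_k2_exp (k t : R) : 0 <= t ->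
  \int[leb]_(s in `[0, t]) (k ^+ 2 * expR (- (2 * k ^+ 2) * (t - s))) =
  2^-1 * (1 - expR (- (2 * k ^+ 2) * t)).
Proof.
move=> t0.
under eq_Rintegral => s _.
  have -> : k ^+ 2 * expR (- (2 * k ^+ 2) * (t - s)) =
    (k ^+ 2 * expR (- (2 * k ^+ 2) * t)) * expR ((2 * k ^+ 2) * s).
    by rewrite -mulrA -expRD; congr (_ * expR _); ring.
  over.
rewrite RintegralZl//; last first.
  by apply: within_integrable; apply: continuous_subspaceT; exact: continuous_expRZ.
have h := Rintegral_expRZ (2 * k ^+ 2) t0.
have e0 : expR (- (2 * k ^+ 2) * t) * expR (2 * k ^+ 2 * t) = 1.
  by rewrite -expRD mulNr addNr expR0.
set I := Rintegral _ _ _ in h *; set y := expR (- _ * t) in e0 *; set z := expR _ in h e0.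
have -> : k ^+ 2 * y * I = 2^-1 * y * (2 * k ^+ 2 * I) by field.
have -> : 2^-1 * y * (2 * k ^+ 2 * I) = 2^-1 * (y * z - y) by rewrite h; ring.
by rewrite e0.
Qed.

(** Finitely many modes are summed before any limit. Since k -> - k permutes the modes, Bessel's
    inequality bounds the drift terms by |g|^2 and the initial terms by |h|^2; half of the left-hand
    side is absorbed, and multiplying by 2 exp (2 t) turns 1/4 into 1/2. Parseval and dominated
    convergence then remove the cutoff N on the left. *)
Lemma energy B T h g u t (b : R -> R) : measurable B -> mode_eq T h g u ->
  0 <= t <= T -> L2_rv P (u t) -> (forall s, 0 <= s <= T -> L2_rv P (g s)) ->
  {within `[0, T], continuous b} ->
  (forall s, 0 <= s <= T -> \int[P]_w (\1_B w * `|g s w| ^+ 2) <= b s) ->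
  expR (2 * t) * \int[P]_w (\1_B w * `|u t w| ^+ 2) <=
  `|h| ^+ 2 * \int[P]_w (\1_B w) + 2^-1 * \int[leb]_(s in `[0, t]) (expR (2 * s) * b s).
Proof.
move=> mB hm tT hu hg cb hb; have /andP[t0 tT'] := tT.
pose k i : R := (int_enum i)%:~R.
pose x i := \int[P]_w (\1_B w * ip (u t w) (fbasis R i) ^+ 2).
have mD : measurable (`[0, t] : set R) by exact: measurable_itv.
have ib : leb.-integrable `[0, t] (EFin \o (fun s => expR (2 * s) * b s)).
  apply: within_integrable; move=> s; apply: cvgM.
    by apply: continuous_subspaceT; exact: continuous_expRZ.
  exact: (within_sub_itv tT' cb).
set I := \int[leb]_(s in `[0, t]) (expR (2 * s) * b s).
set pB := \int[P]_w (\1_B w).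
have pB0 : 0 <= pB by apply: Rintegral_ge0 => w _; exact: indic_ge0.
have bound N : expR (2 * t) * (\sum_(i < N) x i) <= `|h| ^+ 2 * pB + 2^-1 * I.
  have [a ma] := choice (fun i => mode_energy (int_enum i) mB hm tT hu hg).
  have ia i : leb.-integrable `[0, t] (EFin \o a i) by have [] := ma i.
  have aE i := let: And3 _ p _ := ma i in p.
  have xE i := let: And3 _ _ p := ma i in p.
  have [isum sumE] := @integrableR_sum _ _ _ leb _ mD N (fun i => a i) (fun i => ia i).
  pose K i s := k i ^+ 2 * expR (- (2 * k i ^+ 2) * (t - s)).
  have iK i : leb.-integrable `[0, t] (EFin \o (fun s => x i * K i s)).
    apply: within_integrable; apply: continuous_subspaceT => s.
    apply: cvgM; first exact: cvg_cst.
    apply: cvgM; first exact: cvg_cst.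
    exact: continuous_expR_sub.
  have [iKs KsE] := @integrableR_sum _ _ _ leb _ mD N (fun i => (fun s => x i * K i s)) (fun i => iK i).
  pose J s := 4^-1 * expR (- 2 * t) * (expR (2 * s) * b s).
  have iJ : leb.-integrable `[0, t] (EFin \o J) by apply: integrableR_Z.
  have ale : \int[leb]_(s in `[0, t]) (\sum_(i < N) a i s) <=
             \int[leb]_(s in `[0, t]) (\sum_(i < N) x i * K i s + J s).
    apply: le_Rintegral_ae => //; first exact: integrableR_D.
    have : {ae leb, forall s, forall i : nat, `[0, t]%classic s ->
        a i s <= (k i ^+ 2 * expR (- (2 * k i ^+ 2) * (t - s))) * x i +
             4^-1 * expR (- 2 * (t - s)) * \int[P]_w (\1_B w * ip (g s w) (gbasis R i) ^+ 2)}.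
      by apply: ae_foralln => i; exact: aE.
    apply: ae_mono => s hs st.
    have le1 : \sum_(i < N) a i s <= \sum_(i < N) (x i * K i s +
       4^-1 * expR (- 2 * (t - s)) * \int[P]_w (\1_B w * ip (g s w) (gbasis R i) ^+ 2)).
      apply: ler_sum => i _; have := hs i st; rewrite [X in _ <= X + _]mulrC.
      exact.
    apply: (le_trans le1); rewrite big_split /= lerD2l -mulr_sumr.
    have -> : J s = 4^-1 * expR (- 2 * (t - s)) * b s.
      rewrite /J mulrA -(mulrA 4^-1); congr (_ * _ * _); rewrite -expRD; congr expR; ring.
    apply: ler_wpM2l; first by rewrite mulr_ge0// expR_ge0.
    have s0T : 0 <= s <= T.
      by move: st; rewrite /= in_itv /= => /andP[-> st]; exact: le_trans tT'.
    apply: le_trans (hb s s0T).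
    have ig i : P.-integrable setT (EFin \o (fun w => \1_B w * ip (g s w) (gbasis R i) ^+ 2)).
      by apply: indic_sqr_integrable => //; apply: L2_rv_ip; exact: hg.
    have [ig1 <-] := @integrableR_sum _ _ _ P _ measurableT N (fun i => _) (fun i => ig i).
    have [_ ng] := (L2_rvP P (g s)).1 (hg s s0T).
    apply: le_Rintegral => //; first exact: indic_sqr_integrable.
    move=> w _; rewrite -mulr_sumr; apply: ler_wpM2l; first exact: indic_ge0.
    rewrite -(big_mkord xpredT (fun i => ip (g s w) (gbasis R i) ^+ 2)).
    exact: (bessel (@gbasis_on R) (g s w) (iota_uniq 0 (N - 0))).  
  have JE : \int[leb]_(s in `[0, t]) J s = 4^-1 * expR (- 2 * t) * I by rewrite RintegralZl.
  rewrite sumE RintegralD// KsE JE in ale.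
  have KE i : \int[leb]_(s in `[0, t]) (x i * K i s) =
     x i * (2^-1 * (1 - expR (- (2 * k i ^+ 2) * t))).
    rewrite RintegralZl//; first by rewrite Rintegral_k2_exp.
    apply: within_integrable; apply: continuous_subspaceT => s.
    apply: cvgM; first exact: cvg_cst.
    exact: continuous_expR_sub.
  have KsE' := eq_bigr (fun i : 'I_N => x i * (2^-1 * (1 - expR (- (2 * k i ^+ 2) * t)))) (P := xpredT) (op := +%R) (idx := 0) (r := index_enum 'I_N) (fun i _ => KE i).
  rewrite KsE' in ale.
  have sumx : \sum_(i < N) x i <= \sum_(i < N) (2^-1 * expR (- (2 * k i ^+ 2) * t) * x i +
     2^-1 * expR (- 2 * t) * pB * ip h (fbasis R i) ^+ 2 + \int[leb]_(s in `[0, t]) a i s).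
    apply: ler_sum => i _; apply: (le_trans (xE i)).
    by rewrite lerD2r lerD2l -/pB [X in X <= _]mulrAC; exact: lexx.
  rewrite !big_split /= -mulr_sumr in sumx.
  have hbes : \sum_(i < N) ip h (fbasis R i) ^+ 2 <= `|h| ^+ 2.
    rewrite -(big_mkord xpredT (fun i => ip h (fbasis R i) ^+ 2)).
    exact: (bessel (@fbasis_on R) h (iota_uniq 0 (N - 0))).  
  have hb2 : 2^-1 * expR (- 2 * t) * pB * \sum_(i < N) ip h (fbasis R i) ^+ 2 <=
     2^-1 * expR (- 2 * t) * pB * `|h| ^+ 2.
    by apply: ler_wpM2l => //; rewrite !mulr_ge0// expR_ge0.
  have half : \sum_(i < N) x i * (2^-1 * (1 - expR (- (2 * k i ^+ 2) * t))) =
     2^-1 * (\sum_(i < N) x i) - \sum_(i < N) (2^-1 * expR (- (2 * k i ^+ 2) * t) * x i).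
    rewrite mulr_sumr -sumrB; apply: eq_bigr => i _; ring.
  rewrite half in ale.
  have e1 : expR (2 * t) * expR (- 2 * t) = 1 by rewrite -expRD mulNr addrN expR0.
  have fin : 2^-1 * (\sum_(i < N) x i) <= 2^-1 * expR (- 2 * t) * pB * `|h| ^+ 2 +
     4^-1 * expR (- 2 * t) * I by lra.
  have e2 := expR_ge0 (2 * t).
  have := ler_wpM2l e2 fin.
  set y := expR (2 * t) in e1 *; set z := expR (- 2 * t) in e1 *.
  have -> : y * (2^-1 * z * pB * `|h| ^+ 2 + 4^-1 * z * I) = (y * z) * (2^-1 * pB * `|h| ^+ 2 + 4^-1 * I) by ring.
  rewrite e1; lra.
have [_ nu] := (L2_rvP P (u t)).1 hu.
have cv : (fun N => \int[P]_w (\1_B w * \sum_(0 <= i < N) ip (u t w) (fbasis R i) ^+ 2)) @ \oo -->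
    \int[P]_w (\1_B w * `|u t w| ^+ 2).
  have iN N : P.-integrable setT
      (EFin \o (fun w => \1_B w * \sum_(0 <= i < N) ip (u t w) (fbasis R i) ^+ 2)).
    have ig i : P.-integrable setT (EFin \o (fun w => \1_B w * ip (u t w) (fbasis R i) ^+ 2)).
      by apply: indic_sqr_integrable => //; exact: L2_rv_ip.
    have [ig1 _] := @integrableR_sum _ _ _ P _ measurableT N (fun i => _) (fun i => ig i).
    by apply: eq_integrable ig1 => // w _ /=; rewrite -mulr_sumr big_mkord.
  have dcv := @Rintegral_dominated_cvg _ _ _ P
    (fun N w => \1_B w * \sum_(0 <= i < N) ip (u t w) (fbasis R i) ^+ 2)
    (fun w => \1_B w * `|u t w| ^+ 2) (fun w => `|u t w| ^+ 2).
  apply: (dcv _ _ _ _ _).2.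
  - by move=> N; have /integrableP[/measurable_EFinP] := iN N.
  - by have /integrableP[/measurable_EFinP] := indic_sqr_integrable mB nu.
  - apply: (ae_mono (P := setT)); last by apply: filterE.
    move=> w _; apply: cvgM; first exact: cvg_cst.
    exact: (parseval (@fbasis_on R) (@fbasis_total R) (x := u t w)).
  - have [_ h2] := (Lfun2P _ _).1 nu; exact: h2.
  - apply: (ae_mono (P := setT)); last by apply: filterE.
    move=> w _ N; have s0 : 0 <= \sum_(0 <= i < N) ip (u t w) (fbasis R i) ^+ 2.
      by apply: sumr_ge0 => i _; exact: sqr_ge0.
    rewrite normrM (ger0_norm s0) (ger0_norm (indic_ge0 B w)).
    apply: (@le_trans _ _ (\sum_(0 <= i < N) ip (u t w) (fbasis R i) ^+ 2)).
      by rewrite ler_piMl// indicE; case: (_ \in _).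
    by apply: (bessel (@fbasis_on R)); exact: iota_uniq.
have cvE : (fun N => \int[P]_w (\1_B w * \sum_(0 <= i < N) ip (u t w) (fbasis R i) ^+ 2)) =
   (fun N => \sum_(i < N) x i).
  apply/funext => N.
  have ig i : P.-integrable setT (EFin \o (fun w => \1_B w * ip (u t w) (fbasis R i) ^+ 2)).
    by apply: indic_sqr_integrable => //; exact: L2_rv_ip.
  have [_ <-] := @integrableR_sum _ _ _ P _ measurableT N (fun i => _) (fun i => ig i).
  by apply: eq_Rintegral => w _; rewrite big_mkord mulr_sumr.
rewrite cvE in cv.
have e2 := expR_gt0 (2 * t).
rewrite mulrC -ler_pdivlMr//.
apply: (cvgr_le_of_near cv); apply: nearW => N.
by rewrite ler_pdivlMr// mulrC.
Qed.

End energy.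

Lemma within_eps (R : realType) (T : R) (f : R -> R) :
  (forall t, 0 <= t <= T -> forall e, 0 < e -> exists2 d, 0 < d &
     forall s, 0 <= s <= T -> `|s - t| < d -> `|f s - f t| <= e) ->
  {within `[0, T], continuous f}.
Proof.
move=> h; apply/subspace_continuousP => t; rewrite /= in_itv /= => tT.
apply/cvgrPdist_le => e e0; have [d d0 hd] := h t tT e e0.
rewrite near_withinE; apply/nbhs_normP; exists d => // s /= ts sT.
by rewrite distrC; apply: hd; [move: sT; rewrite in_itv|rewrite distrC].
Qed.

Section L2_processes.
Context d (Omega : measurableType d) (R : realType) (P : probability Omega R).
Local Notation H := (Hper R).
Local Notation leb := (@lebesgue_measure R).
Implicit Types (B : set Omega) (u v g : R -> Omega -> H) (Y Z : Omega -> H).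

Lemma nrm2_le (f g : Omega -> R) : f \in Lfun P 2%:E -> g \in Lfun P 2%:E ->
  (forall w, `|f w| <= `|g w|) -> nrm2 P f <= nrm2 P g.
Proof.
move=> /Lfun2P[_ hf] /Lfun2P[_ hg] fg; rewrite /nrm2 ler_wsqrtr//.
apply: le_Rintegral => // w _.
by rewrite -(real_normK (num_real (f w))) -(real_normK (num_real (g w))) lerXn2r ?nnegrE.
Qed.

Lemma nrm2D (f g : Omega -> R) : f \in Lfun P 2%:E -> g \in Lfun P 2%:E ->
  nrm2 P (fun w => f w + g w) <= nrm2 P f + nrm2 P g.
Proof.
move=> hf hg; have hfg := Lfun2M_integrable hf hg.
have [_ hf2] := (Lfun2P _ _).1 hf; have [_ hg2] := (Lfun2P _ _).1 hg.
rewrite -(@ler_pXn2r _ 2)// ?nnegrE ?addr_ge0 ?nrm2_ge0//.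
rewrite sqrrD !nrm2_sqr.
have -> : \int[P]_w ((f w + g w) ^+ 2) =
    \int[P]_w (f w ^+ 2) + 2 * (\int[P]_w (f w * g w)) + \int[P]_w (g w ^+ 2).
  have hfg2 := integrableR_Z measurableT 2 hfg.
  rewrite -RintegralZl// -RintegralD// -RintegralD//; last exact: integrableR_D.
  by apply: eq_Rintegral => w _; ring.
rewrite lerD2r lerD2l -[leRHS]mulr_natl ler_pM2l//.
exact: le_trans (ler_norm _) (cauchy_schwarz_R hf hg).
Qed.

Lemma L2_rv_nrm Y : L2_rv P Y -> (fun w => `|Y w|) \in Lfun P 2%:E.
Proof. by move=> /L2_rvP[]. Qed.

Lemma hnrm2_le Y (f : Omega -> R) : L2_rv P Y -> f \in Lfun P 2%:E ->
  (forall w, `|Y w| <= f w) -> hnrm2 P Y <= nrm2 P f.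
Proof.
move=> /L2_rv_nrm hY hf Yf; apply: nrm2_le => // w.
by rewrite normr_id (le_trans (Yf w))// ler_norm.
Qed.

Lemma hnrm2D Y Z : L2_rv P Y -> L2_rv P Z ->
  hnrm2 P (fun w => Y w + Z w) <= hnrm2 P Y + hnrm2 P Z.
Proof.
move=> hY hZ; apply: le_trans (nrm2D (L2_rv_nrm hY) (L2_rv_nrm hZ)).
apply: hnrm2_le; [exact: L2_rvD|by apply: Lfun2D; exact: L2_rv_nrm|].
by move=> w; exact: ler_normD.
Qed.

Lemma nrm2Z a (f : Omega -> R) : f \in Lfun P 2%:E -> nrm2 P (fun w => a * f w) = `|a| * nrm2 P f.
Proof.
move=> /Lfun2P[_ hf].
rewrite /nrm2; under eq_Rintegral do rewrite exprMn.
by rewrite RintegralZl// sqrtrM ?sqr_ge0// sqrtr_sqr.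
Qed.

Lemma hnrm2Z a Y : L2_rv P Y -> hnrm2 P (fun w => a *: Y w) = `|a| * hnrm2 P Y.
Proof.
move=> /L2_rv_nrm hY; have := nrm2Z `|a| hY; rewrite normr_id => <-.
by rewrite /hnrm2; congr nrm2; apply/funext => w; exact: normrZ.
Qed.

Lemma hnrm2BC Y Z : hnrm2 P (fun w => Y w - Z w) = hnrm2 P (fun w => Z w - Y w).
Proof. by rewrite /hnrm2; congr nrm2; apply/funext => w; exact: distrC. Qed.

Definition L2_continuous (T : R) u : Prop :=
  (forall t, 0 <= t <= T -> L2_rv P (u t)) /\
  forall t, 0 <= t <= T -> forall e, 0 < e -> exists2 dl, 0 < dl &
     forall s, 0 <= s <= T -> `|s - t| < dl -> hnrm2 P (fun w => u s w - u t w) <= e.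

Lemma CW_L2_continuous beta T u : CW P beta T u -> L2_continuous T u.
Proof.
move=> [h1 h2 _]; split => // t tT e e0; have [dl d0 hd] := h2 t tT e e0.
exists dl => // s sT st; have := hd s sT st.
rewrite L2_normE; first by rewrite lte_fin => /ltW.
by apply: L2_rvB; exact: h1.
Qed.

Lemma L2_continuous_lin T u v (a b : R) : L2_continuous T u -> L2_continuous T v ->
  L2_continuous T (fun t w => a *: u t w + b *: v t w).
Proof.
move=> [u1 u2] [v1 v2]; split=> [t tT|t tT e e0].
  by apply: L2_rvD; apply: L2_rvZ; [exact: u1|exact: v1].
have p (c : R) : 0 < e / 2 / (`|c| + 1) by rewrite !divr_gt0// ltr_wpDl.
have [d1 d10 h1] := u2 t tT _ (p a); have [d2 d20 h2] := v2 t tT _ (p b).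
exists (Num.min d1 d2); first by rewrite lt_min d10.
move=> s sT; rewrite lt_min => /andP[/(h1 s sT) k1 /(h2 s sT) k2].
have uB := L2_rvB (u1 s sT) (u1 t tT); have vB := L2_rvB (v1 s sT) (v1 t tT).
have -> : (fun w => a *: u s w + b *: v s w - (a *: u t w + b *: v t w)) =
  (fun w => a *: (u s w - u t w) + b *: (v s w - v t w)).
  by apply/funext => w; rewrite !scalerBr opprD addrACA.
apply: (le_trans (hnrm2D (L2_rvZ a uB) (L2_rvZ b vB))).
rewrite !hnrm2Z//.
have q (c x : R) : 0 <= x -> x <= e / 2 / (`|c| + 1) -> `|c| * x <= e / 2.
  move=> x0 xc; apply: (@le_trans _ _ ((`|c| + 1) * x)); first by rewrite ler_wpM2r// lerDl.
  by rewrite mulrC -ler_pdivlMr// ltr_wpDl.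
apply: (le_trans (lerD (q a _ (nrm2_ge0 _ _) k1) (q b _ (nrm2_ge0 _ _) k2))).
by rewrite -splitr.
Qed.

Lemma L2_continuousB T u v : L2_continuous T u -> L2_continuous T v ->
  L2_continuous T (fun t w => u t w - v t w).
Proof.
move=> hu hv; have := L2_continuous_lin 1 (-1) hu hv.
by under eq_fun do under eq_fun do rewrite scale1r scaleN1r.
Qed.

Lemma L2_continuous_sub T T' u : T' <= T -> L2_continuous T u -> L2_continuous T' u.
Proof.
move=> TT [u1 u2].
have k s : 0 <= s <= T' -> 0 <= s <= T by move=> /andP[-> sT]; exact: le_trans TT.
split=> [t /k|t /k tT e e0]; first exact: u1.
by have [dl d0 h] := u2 t tT e e0; exists dl => // s /k; exact: h.
Qed.

(** Pointwise, the difference of |Y|^2 and |Z|^2 is at most |Y - Z| (|Y - Z| + 2 |Z|), a bound in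
    which only the norm at the base point Z survives. *)
Lemma indic_sqr_dist B Y Z : measurable B -> L2_rv P Y -> L2_rv P Z ->
  `|\int[P]_w (\1_B w * `|Y w| ^+ 2) - \int[P]_w (\1_B w * `|Z w| ^+ 2)| <=
  hnrm2 P (fun w => Y w - Z w) ^+ 2 + 2 * (hnrm2 P (fun w => Y w - Z w) * hnrm2 P Z).
Proof.
move=> mB hY hZ; have hD := L2_rvB hY hZ.
have nY := L2_rv_nrm hY; have nZ := L2_rv_nrm hZ; have nD := L2_rv_nrm hD.
have iY := indic_sqr_integrable mB nY; have iZ := indic_sqr_integrable mB nZ.
rewrite -RintegralB//.
apply: (le_trans (le_normr_Rintegral _ _)) => //; first exact: integrableR_B.
have [_ iD] := (Lfun2P _ _).1 nD; have iDZ := Lfun2M_integrable nD nZ.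
apply: (@le_trans _ _ (\int[P]_w (`|Y w - Z w| ^+ 2 + 2 * (`|Y w - Z w| * `|Z w|)))).
  apply: le_Rintegral => //.
  - by have := integrable_norm (integrableR_B measurableT iY iZ); apply: eq_integrable.
  - by apply: integrableR_D => //; exact: integrableR_Z.
  move=> w _; rewrite -mulrBr normrM ger0_norm ?indic_ge0//.
  apply: (@le_trans _ _ `| `|Y w| ^+ 2 - `|Z w| ^+ 2|).
    by rewrite ler_piMl// indicE; case: (_ \in _).
  have h1 := ler_normD (Y w - Z w) (Z w); rewrite subrK in h1.
  have h2 := ler_normD (Z w - Y w) (Y w); rewrite subrK distrC in h2.
  rewrite subr_sqr normrM (ger0_norm (addr_ge0 (normr_ge0 (Y w)) (normr_ge0 (Z w)))).
  set y := `|Y w| in h1 h2 *; set z := `|Z w| in h1 h2 *.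
  set x := `|Y w - Z w| in h1 h2 *.
  have k : `|y - z| <= x by rewrite ler_norml; apply/andP; split; lra.
  have y0 : 0 <= y by rewrite /y. have z0 : 0 <= z by rewrite /z.
  apply: (@le_trans _ _ (x * (y + z))); first by rewrite ler_wpM2r// addr_ge0.
  have x0 : 0 <= x by rewrite /x.
  nra.
rewrite RintegralD//; last exact: integrableR_Z.
rewrite RintegralZl// /hnrm2 nrm2_sqr lerD2l ler_wpM2l//.
exact: le_trans (ler_norm _) (cauchy_schwarz_R nD nZ).
Qed.

Lemma indic_sqr_continuous B T u : measurable B -> L2_continuous T u ->
  {within `[0, T], continuous (fun t => \int[P]_w (\1_B w * `|u t w| ^+ 2))}.
Proof.
move=> mB [u1 u2]; apply: within_eps => t tT e e0.
pose K := 1 + 2 * hnrm2 P (u t).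
have K0 : 0 < K by rewrite /K ltr_wpDr// mulr_ge0// nrm2_ge0.
have m0 : 0 < Num.min 1 (e / K) by rewrite lt_min ltr01 divr_gt0.
have [dl d0 hd] := u2 t tT _ m0; exists dl => // s sT st.
apply: (le_trans (indic_sqr_dist mB (u1 s sT) (u1 t tT))).
have := hd s sT st; set x := hnrm2 _ _; rewrite le_min => /andP[x1].
rewrite ler_pdivlMr// => xK.
have x0 : 0 <= x by exact: nrm2_ge0.
apply: le_trans xK; rewrite /K mulrDr mulr1 expr2 mulrCA lerD2r.
by rewrite ler_piMr.
Qed.

(** It suffices to test with the event where g < f. *)
Lemma ae_le_of_indic (f g : Omega -> R) :
  P.-integrable setT (EFin \o f) -> P.-integrable setT (EFin \o g) ->
  (forall B, measurable B -> \int[P]_w (\1_B w * f w) <= \int[P]_w (\1_B w * g w)) ->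
  {ae P, forall w, f w <= g w}.
Proof.
move=> hf hg hB.
have mf : measurable_fun setT f by have /integrableP[/measurable_EFinP] := hf.
have mg : measurable_fun setT g by have /integrableP[/measurable_EFinP] := hg.
pose B := [set w | g w < f w].
have mB : measurable B.
  have := measurable_fun_ltr mg mf; rewrite -[B]setTI => /(_ measurableT [set true]).
  by rewrite /preimage /= => h; exact: h.
have iB (k : Omega -> R) : P.-integrable setT (EFin \o k) ->
    P.-integrable setT (EFin \o (fun w => \1_B w * k w)).
  move=> hk; apply: (le_integrable _ _ _ hk) => //.
    apply/measurable_EFinP; apply: measurable_funM; first exact: measurable_indic.
    by have /integrableP[/measurable_EFinP] := hk.
  move=> w _ /=; rewrite lee_fin normrM ler_piMl// indicE.
  by case: (_ \in _); rewrite ?normr1 ?normr0.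
have i0 : P.-integrable setT (EFin \o (fun w => \1_B w * f w - \1_B w * g w)).
  by apply: integrableR_B => //; exact: iB.
have p0 w : 0 <= \1_B w * f w - \1_B w * g w.
  rewrite -mulrBr indicE; case: (boolP (w \in B)) => wB; last by rewrite mul0r.
  by rewrite mul1r subr_ge0 ltW//; move: wB; rewrite inE.
have z : \int[P]_w (\1_B w * f w - \1_B w * g w) = 0.
  apply/eqP; rewrite eq_le; apply/andP; split; last by apply: Rintegral_ge0 => w _.
  by rewrite RintegralB//; [rewrite subr_le0 hB|exact: iB|exact: iB].
have ze : (\int[P]_w `|(EFin \o (fun w => (\1_B w * f w - \1_B w * g w)%R)) w| = 0)%E.
  transitivity (\int[P]_w (\1_B w * f w - \1_B w * g w))%:E; last by rewrite z.
  rewrite /Rintegral fineK; last exact: integrable_fin_num.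
  by apply: eq_integral => w _ /=; rewrite ger0_norm.
have [mI _] := integrableP _ _ _ i0.
have := (ae_eq_integral_abs P measurableT mI).1 ze.
apply: ae_mono => w /(_ I) /= [] h; rewrite leNgt; apply/negP => gf.
by move: h; rewrite indicE mem_set//= !mul1r => /eqP; rewrite subr_eq0 gt_eqF.
Qed.

Lemma Rintegral_norm_le (Z : Omega -> H) : L2_rv P Z -> \int[P]_w `|Z w| <= hnrm2 P Z.
Proof.
move=> hZ; have h1 := le_trans (ler_norm _) (cauchy_schwarz_R (L2_rv_nrm hZ) (Lfun2_cst P 1)).
have n1 : nrm2 P (fun=> 1) = 1.
  rewrite /nrm2; under eq_Rintegral do rewrite expr1n.
  have -> : \int[P]__ 1 = 1 :> R.
    by rewrite /Rintegral integral_cst// mul1e; exact: (congr1 fine (@probability_setT _ _ _ P)).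
  exact: sqrtr1.
move: h1; rewrite n1 mulr1; under eq_Rintegral do rewrite mulr1; exact.
Qed.

Section lipschitz_observable.
Variables (chi : H -> R) (K : R).
Hypothesis (K0 : 0 <= K) (chi01 : forall p, 0 <= chi p <= 1).
Hypothesis chi_lip : forall p q, `|chi p - chi q| <= K * `|p - q|.

Lemma lipschitz_observable_measurable Y : L2_rv P Y -> measurable_fun setT (fun w => chi (Y w)).
Proof.
move=> /L2_rvP[mY _]; apply: (borel_rv_real _ mY); exact: lipschitz_continuous chi_lip.
Qed.

Lemma indic_lipschitz_integrable B Y : measurable B -> L2_rv P Y ->
  P.-integrable setT (EFin \o (fun w => \1_B w * chi (Y w))).
Proof.
move=> mB hY; apply: (le_integrable _ _ _ (indic_integrable P mB)) => //.
  apply/measurable_EFinP; apply: measurable_funM; first exact: measurable_indic.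
  exact: lipschitz_observable_measurable.
move=> w _ /=; rewrite lee_fin normrM ler_piMr//.
by have /andP[x0 x1] := chi01 (Y w); rewrite ger0_norm.
Qed.

Lemma indic_lipschitz_dist B Y Z : measurable B -> L2_rv P Y -> L2_rv P Z ->
  `|\int[P]_w (\1_B w * chi (Y w)) - \int[P]_w (\1_B w * chi (Z w))| <=
  K * hnrm2 P (fun w => Y w - Z w).
Proof.
move=> mB hY hZ; have hD := L2_rvB hY hZ.
have iY := indic_lipschitz_integrable mB hY; have iZ := indic_lipschitz_integrable mB hZ.
rewrite -RintegralB//.
apply: (le_trans (le_normr_Rintegral _ _)) => //; first exact: integrableR_B.
have iD : P.-integrable setT (EFin \o (fun w => `|Y w - Z w|)).
  have := Lfun2M_integrable (L2_rv_nrm hD) (Lfun2_cst P 1).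
  by apply: eq_integrable => // w _ /=; rewrite mulr1.
apply: (@le_trans _ _ (\int[P]_w (K * `|Y w - Z w|))).
  apply: le_Rintegral => //.
  - by have := integrable_norm (integrableR_B measurableT iY iZ); apply: eq_integrable.
  - exact: integrableR_Z.
  move=> w _; rewrite -mulrBr normrM (le_trans _ (chi_lip _ _))//.
  by rewrite ler_piMl// indicE; case: (_ \in _); rewrite ?normr1 ?normr0.
by rewrite RintegralZl// ler_wpM2l// Rintegral_norm_le.
Qed.

Lemma indic_lipschitz_continuous B T u : measurable B -> L2_continuous T u ->
  {within `[0, T], continuous (fun s => \int[P]_w (\1_B w * chi (u s w)))}.
Proof.
move=> mB [u1 u2]; apply: within_eps => t tT e e0.
have K1 : 0 < K + 1 by rewrite ltr_wpDl.
have eK : 0 < e / (K + 1) by rewrite divr_gt0.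
have [dl d0 hd] := u2 t tT _ eK; exists dl => // s sT st.
apply: (le_trans (indic_lipschitz_dist mB (u1 s sT) (u1 t tT))).
apply: (@le_trans _ _ (K * (e / (K + 1)))); first by rewrite ler_wpM2l// hd.
by rewrite mulrCA ler_piMr ?(ltW e0)// ler_pdivrMr// mul1r lerDl.
Qed.

End lipschitz_observable.

End L2_processes.

Section modes.
Context d (Omega : measurableType d) (R : realType) (P : probability Omega R).
Local Notation H := (Hper R).
Local Notation leb := (@lebesgue_measure R).
Implicit Types (B : set Omega) (u v g : R -> Omega -> H) (Y Z : Omega -> H) (h : H).

Lemma Rintegral_itv_mono (T t : R) (f : R -> R) : t <= T ->
  leb.-integrable `[0, T] (EFin \o f) -> (forall s, 0 <= s <= T -> 0 <= f s) ->
  \int[leb]_(s in `[0, t]) f s <= \int[leb]_(s in `[0, T]) f s.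
Proof.
move=> tT fi f0.
have sub : `[0, t]%classic `<=` (`[0, T]%classic : set R).
  by move=> s; rewrite /= !in_itv /= => /andP[-> st]; exact: le_trans tT.
have mt : measurable (`[0, t] : set R) by exact: measurable_itv.
have mT : measurable (`[0, T] : set R) by exact: measurable_itv.
have fi' : leb.-integrable `[0, t] (EFin \o f) := @integrableS _ _ _ leb _ _ _ mT mt sub fi.
rewrite /Rintegral; apply: fine_le.
- exact: integrable_fin_num.
- exact: integrable_fin_num.
apply: ge0_subset_integral => //.
- by have /integrableP[] := fi.

Qed.

Lemma fine_itv0 (T : R) : 0 <= T -> fine (leb `[0, T]%classic) = T.
Proof.
move=> T0; rewrite lebesgue_measure_itv /= lte_fin.
by case: ltP => [_|T0']; rewrite /= ?subr0//; apply/eqP; rewrite eq_le T0.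
Qed.

Lemma mode_eq_lin T h g u h' g' u' (a b : R) :
  mode_eq P T h g u -> mode_eq P T h' g' u' ->
  (forall s, 0 <= s <= T -> L2_rv P (u s)) -> (forall s, 0 <= s <= T -> L2_rv P (u' s)) ->
  (forall s, 0 <= s <= T -> L2_rv P (g s)) -> (forall s, 0 <= s <= T -> L2_rv P (g' s)) ->
  mode_eq P T (a *: h + b *: h') (fun s w => a *: g s w + b *: g' s w)
    (fun s w => a *: u s w + b *: u' s w).
Proof.
move=> hm hm' hu hu' hg hg' t tT k psi hpsi.
have [al [ial alE uE]] := hm t tT k psi hpsi.
have [al' [ial' alE' uE']] := hm' t tT k psi hpsi.
have mD : measurable (`[0, t] : set R) by exact: measurable_itv.
have i1 : leb.-integrable `[0, t] (EFin \o (fun s => a * al s)) := @integrableR_Z _ _ _ leb _ mD _ a ial.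
have i2 : leb.-integrable `[0, t] (EFin \o (fun s => b * al' s)) := @integrableR_Z _ _ _ leb _ mD _ b ial'.
exists (fun s => a * al s + b * al' s); split.
- exact: (@integrableR_D _ _ _ leb _ mD _ _ i1 i2).
- have : {ae leb, forall s, forall n : nat, `[0, t]%classic s ->
     (if n is 0%N then al s else al' s) =  - k%:~R * expR (- lam R k * (t - s)) *
              \int[P]_w (psi w * ip ((if n is 0%N then g else g') s w) (cbasis R (- k)))}.
    by apply: ae_foralln => -[|n]; [exact: alE|exact: alE'].
  apply: ae_mono => s hs st.
  have sT : 0 <= s <= T.
    move: st tT; rewrite /= in_itv /= => /andP[-> st] /andP[_]; exact: le_trans st.
  rewrite (hs 0%N st) (hs 1%N st) scalar_lin//; [|exact: hg|exact: hg'].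
  by rewrite [RHS]mulrDr; congr (_ + _); exact: mulrCA.
- rewrite scalar_lin//; [|exact: hu|exact: hu'].
  rewrite uE uE' [X in _ = _ + X](@RintegralD _ _ _ leb _ _ _ mD i1 i2).
  rewrite (@RintegralZl _ _ _ leb _ _ a mD ial) (@RintegralZl _ _ _ leb _ _ b mD ial').
  rewrite ipDl !ipZl; ring.
Qed.

(** Gronwall is applied to exp (2 t) E[1_B |u|^2] with rate L^2 / 2; removing the weight leaves L^2
    / 2 - 2, twice the rate claimed for |u|. As B is arbitrary, the bound in mean is an almost sure
    one. *)
Lemma energy_lipschitz T h g u L : 0 <= T -> 0 <= L -> mode_eq P T h g u ->
  L2_continuous P T u -> (forall s, 0 <= s <= T -> L2_rv P (g s)) ->
  (forall s w, 0 <= s <= T -> `|g s w| <= L * `|u s w|) ->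
  {ae P, forall w, `|u T w| <= expR ((L ^+ 2 / 4 - 1) * T) * `|h|}.
Proof.
move=> T0 L0 hm hu hg gL; have [u1 _] := hu.
have TT : 0 <= T <= T by rewrite T0 lexx.
set K := expR _ * _; have K0 : 0 <= K by rewrite mulr_ge0// expR_ge0.
have key B : measurable B -> \int[P]_w (\1_B w * `|u T w| ^+ 2) <= \int[P]_w (\1_B w * K ^+ 2).
  move=> mB.
  pose q s := \int[P]_w (\1_B w * `|u s w| ^+ 2).
  pose phi s := expR (2 * s) * q s.
  have cq : {within `[0, T], continuous q} := indic_sqr_continuous mB hu.
  have cphi : {within `[0, T], continuous phi}.
    move=> s; apply: cvgM; last exact: cq.
    by apply: continuous_subspaceT; exact: continuous_expRZ.
  have cb : {within `[0, T], continuous (fun s => L ^+ 2 * q s)}.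
    by move=> s; apply: cvgM; [exact: cvg_cst|exact: cq].
  set pB := \int[P]_w (\1_B w).
  have gb s : 0 <= s <= T -> \int[P]_w (\1_B w * `|g s w| ^+ 2) <= L ^+ 2 * q s.
    move=> sT.
    have ng := L2_rv_nrm (hg s sT); have nu := L2_rv_nrm (u1 s sT).
    have iu := indic_sqr_integrable mB nu.
    rewrite /q -RintegralZl//; apply: le_Rintegral => //.
    - exact: indic_sqr_integrable.
    - exact: integrableR_Z.
    move=> w _; rewrite [leRHS]mulrCA; apply: ler_wpM2l; first exact: indic_ge0.
    rewrite -exprMn.
    by rewrite lerXn2r ?nnegrE ?mulr_ge0 ?gL.
  have rec t : 0 <= t <= T -> phi t <= `|h| ^+ 2 * pB + L ^+ 2 / 2 * \int[leb]_(s in `[0, t]) phi s.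
    move=> tT; have := energy mB hm tT (u1 t tT) hg cb gb.
    have tT' : t <= T by case/andP: tT.
    have mD : measurable (`[0, t] : set R) by exact: measurable_itv.
    have iphi : leb.-integrable `[0, t] (EFin \o phi).
      by apply: within_integrable; exact: (within_sub_itv tT').
    have -> : \int[leb]_(s in `[0, t]) (expR (2 * s) * (L ^+ 2 * q s)) =
        L ^+ 2 * \int[leb]_(s in `[0, t]) phi s.
      rewrite -(@RintegralZl _ _ _ leb _ _ (L ^+ 2) mD iphi).
      by apply: eq_Rintegral => s _; rewrite mulrCA.
    by rewrite mulrA (mulrC 2^-1).
  have L2 : 0 <= L ^+ 2 / 2 by rewrite divr_ge0 ?sqr_ge0.
  have := gronwall T0 L2 cphi rec.
  have -> : \int[P]_w (\1_B w * K ^+ 2) = K ^+ 2 * pB.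
    have iB := indic_integrable P mB.
    rewrite -(@RintegralZl _ _ _ P _ _ (K ^+ 2) measurableT iB).
    by apply: eq_Rintegral => w _; rewrite mulrC.
  rewrite /phi -/(q T) mulrC -ler_pdivlMr ?expR_gt0// => /le_trans; apply.
  rewrite -expRN /K exprMn -expRM_natl.
  have -> : `|h| ^+ 2 * pB * expR (L ^+ 2 / 2 * T) * expR (- (2 * T)) =
    expR (L ^+ 2 / 2 * T) * expR (- (2 * T)) * `|h| ^+ 2 * pB by ring.
  rewrite -expRD; set a := expR _; set b := expR _; suff -> : a = b by [].
  by rewrite /a /b; congr expR; field.
have nu := L2_rv_nrm (u1 T TT).
have [_ iu] := (Lfun2P _ _).1 nu.
have iK : P.-integrable setT (EFin \o (fun=> K ^+ 2)).
  by have [_] := (Lfun2P _ _).1 (Lfun2_cst P K).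
have := ae_le_of_indic iu iK key.
by apply: ae_mono => w; rewrite ler_pXn2r// nnegrE.
Qed.

(** From (a + b)^2 <= 2 a^2 + 2 b^2 and chi^2 <= chi one gets |g|^2 <= 2 L^2 |u|^2 + 16 M^2 (e^2 +
    L^2 chi), half of which enters the energy estimate: hence the Gronwall rate L^2 and the constant
    8. The weight exp (2 s) <= exp (2 T) cancels at the end. *)
Lemma energy_cutoff B T g u (chi : R -> Omega -> R) L e M : measurable B ->
  0 <= T -> 0 <= L -> 0 <= e -> 0 <= M -> mode_eq P T 0 g u ->
  L2_continuous P T u -> (forall s, 0 <= s <= T -> L2_rv P (g s)) ->
  (forall s, 0 <= s <= T -> measurable_fun setT (chi s)) ->
  (forall s w, 0 <= chi s w <= 1) ->
  {within `[0, T], continuous (fun s => \int[P]_w (\1_B w * chi s w))} ->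
  (forall s, 0 <= s <= T ->
     {ae P, forall w, `|g s w| <= L * `|u s w| + (2 * e + 2 * L * chi s w) * M}) ->
  \int[P]_w (\1_B w * `|u T w| ^+ 2) <= 8 * expR (L ^+ 2 * T) * (T + L ^+ 2) * M ^+ 2 *
    (e ^+ 2 * \int[P]_w (\1_B w) +
     \int[leb]_(s in `[0, T]) \int[P]_w (\1_B w * chi s w)).
Proof.
move=> mB T0 L0 e0 M0 hm hu hg mchi chi01 cp gL; have [u1 _] := hu.
pose q s := \int[P]_w (\1_B w * `|u s w| ^+ 2).
pose p s := \int[P]_w (\1_B w * chi s w).
pose phi s := expR (2 * s) * q s.
have cq : {within `[0, T], continuous q} := indic_sqr_continuous mB hu.
have ce : {within `[0, T], continuous (fun s : R => expR (2 * s))}.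
  by apply: continuous_subspaceT; exact: continuous_expRZ.
have cphi : {within `[0, T], continuous phi}.
  by move=> s; apply: cvgM; [exact: ce|exact: cq].
set pB := \int[P]_w (\1_B w).
have iB := indic_integrable P mB.
have pB0 : 0 <= pB by apply: Rintegral_ge0 => w _; exact: indic_ge0.
have p0 s : 0 <= p s.
  apply: Rintegral_ge0 => w _; rewrite mulr_ge0 ?indic_ge0//; by case/andP: (chi01 s w).
pose r s := e ^+ 2 * pB + L ^+ 2 * p s.
have r0 s : 0 <= r s by rewrite addr_ge0// mulr_ge0// ?sqr_ge0.
have cr : {within `[0, T], continuous r}.
  move=> s; apply: cvgD; first exact: cvg_cst.
  by apply: cvgM; [exact: cvg_cst|exact: cp].
pose b s := 2 * L ^+ 2 * q s + 16 * M ^+ 2 * r s.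
have cb : {within `[0, T], continuous b}.
  move=> s; apply: cvgD; first by apply: cvgM; [exact: cvg_cst|exact: cq].
  by apply: cvgM; [exact: cvg_cst|exact: cr].
have gb s : 0 <= s <= T -> \int[P]_w (\1_B w * `|g s w| ^+ 2) <= b s.
  move=> sT.
  have ng := L2_rv_nrm (hg s sT); have nu := L2_rv_nrm (u1 s sT).
  have iu := indic_sqr_integrable mB nu.
  have ichi : P.-integrable setT (EFin \o (fun w => \1_B w * chi s w)).
    apply: (le_integrable _ _ _ iB) => //.
      apply/measurable_EFinP; apply: measurable_funM; first exact: measurable_indic.
      exact: mchi.
    move=> w _ /=; rewrite lee_fin normrM ler_piMr//.
    by have /andP[x0 x1] := chi01 s w; rewrite ger0_norm.
  pose A := 2 * L ^+ 2; pose C := 16 * M ^+ 2 * e ^+ 2; pose D := 16 * M ^+ 2 * L ^+ 2.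
  have -> : b s = A * q s + (C * pB + D * p s) by rewrite /b /r /A /C /D; ring.
  have i1 := integrableR_Z measurableT A iu.
  have i2 := integrableR_Z measurableT C iB.
  have i3 := integrableR_Z measurableT D ichi.
  have i4 := integrableR_D measurableT i2 i3.
  rewrite /q /pB /p -!RintegralZl// -RintegralD// -RintegralD//.
  apply: le_Rintegral_ae => //; first exact: indic_sqr_integrable.
    exact: (integrableR_D measurableT i1 i4).
  apply: ae_mono (gL s sT) => w gLw _.
  have -> : A * (\1_B w * `|u s w| ^+ 2) + (C * \1_B w + D * (\1_B w * chi s w)) =
    \1_B w * (A * `|u s w| ^+ 2 + (C + D * chi s w)) by ring.
  rewrite ler_wpM2l ?indic_ge0//.
  have /andP[x0 x1] := chi01 s w; have := gLw.
  have : 0 <= `|u s w| by []. have : 0 <= `|g s w| by [].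
  set G := `|g s w|; set U := `|u s w|; set x := chi s w in x0 x1 *.
  move=> G0 U0 GU.
  have V0 : 0 <= 2 * e + 2 * L * x by rewrite addr_ge0// ?mulr_ge0.
  have : G ^+ 2 <= (L * U + (2 * e + 2 * L * x) * M) ^+ 2.
    by rewrite lerXn2r ?nnegrE// addr_ge0// mulr_ge0.
  move/le_trans; apply.
  set V := (2 * e + 2 * L * x) in V0 *.
  apply: (@le_trans _ _ (2 * (L * U) ^+ 2 + 2 * V ^+ 2 * M ^+ 2)).
    have := sqr_ge0 (L * U - V * M); nra.
  have VV : V ^+ 2 <= 8 * e ^+ 2 + 8 * L ^+ 2 * x.
    apply: (@le_trans _ _ (8 * e ^+ 2 + 8 * L ^+ 2 * x ^+ 2)).
      rewrite /V; have := sqr_ge0 (e - L * x); nra.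
    rewrite lerD2l ler_wpM2l// ?mulr_ge0// ?sqr_ge0// expr2 ler_piMr//.
  have MM := sqr_ge0 M.
  rewrite /A /C /D exprMn.
  have := ler_wpM2l MM VV; lra.
have TT : 0 <= T <= T by rewrite T0 lexx.
have mDT : measurable (`[0, T] : set R) by exact: measurable_itv.
have ip_ : leb.-integrable `[0, T] (EFin \o p) by exact: within_integrable.
have ir : leb.-integrable `[0, T] (EFin \o r) by exact: within_integrable.
have ier : leb.-integrable `[0, T] (EFin \o (fun s => expR (2 * s) * r s)).
  by apply: within_integrable => s; apply: cvgM; [exact: ce|exact: cr].
set Q := \int[leb]_(s in `[0, T]) p s.
have Q0 : 0 <= Q by apply: Rintegral_ge0 => s _.
have rQ : \int[leb]_(s in `[0, T]) r s = T * (e ^+ 2 * pB) + L ^+ 2 * Q.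
  have ic : leb.-integrable `[0, T] (EFin \o (fun=> e ^+ 2 * pB)).
    by apply: within_integrable; apply: continuous_subspaceT => s; exact: cvg_cst.
  have iLp : leb.-integrable `[0, T] (EFin \o (fun s => L ^+ 2 * p s)) := @integrableR_Z _ _ _ leb _ mDT _ (L ^+ 2) ip_.
  rewrite (@RintegralD _ _ _ leb _ _ _ mDT ic iLp) (@RintegralZl _ _ _ leb _ _ (L ^+ 2) mDT ip_).
  rewrite (@Rintegral_cst _ _ _ leb _ mDT) fine_itv0// (mulrC T); reflexivity.
pose E := 8 * M ^+ 2 * (expR (2 * T) * (T * (e ^+ 2 * pB) + L ^+ 2 * Q)).
have rec t : 0 <= t <= T -> phi t <= E + L ^+ 2 * \int[leb]_(s in `[0, t]) phi s.
  move=> tT; have := energy mB hm tT (u1 t tT) hg cb gb.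
  have tT' : t <= T by case/andP: tT.
  have mD : measurable (`[0, t] : set R) by exact: measurable_itv.
  have iphi : leb.-integrable `[0, t] (EFin \o phi).
    by apply: within_integrable; exact: (within_sub_itv tT').
  have ier' : leb.-integrable `[0, t] (EFin \o (fun s => expR (2 * s) * r s)).
    apply: within_integrable; apply: (within_sub_itv tT') => s.
    by apply: cvgM; [exact: ce|exact: cr].
  have j1 : leb.-integrable `[0, t] (EFin \o (fun s => 2 * L ^+ 2 * phi s)) := @integrableR_Z _ _ _ leb _ mD _ _ iphi.
  have j2 : leb.-integrable `[0, t] (EFin \o (fun s => 16 * M ^+ 2 * (expR (2 * s) * r s))) := @integrableR_Z _ _ _ leb _ mD _ _ ier'.
  have -> : \int[leb]_(s in `[0, t]) (expR (2 * s) * b s) =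
      2 * L ^+ 2 * (\int[leb]_(s in `[0, t]) phi s) +
      16 * M ^+ 2 * (\int[leb]_(s in `[0, t]) (expR (2 * s) * r s)).
    rewrite -(@RintegralZl _ _ _ leb _ _ (2 * L ^+ 2) mD iphi).
    rewrite -(@RintegralZl _ _ _ leb _ _ (16 * M ^+ 2) mD ier').
    rewrite -(@RintegralD _ _ _ leb _ _ _ mD j1 j2).
    by apply: eq_Rintegral => s _; rewrite /b /phi; ring.
  rewrite normr0 expr0n /= mul0r add0r.
  have le1 : \int[leb]_(s in `[0, t]) (expR (2 * s) * r s) <=
      expR (2 * T) * (T * (e ^+ 2 * pB) + L ^+ 2 * Q).
    apply: (le_trans (Rintegral_itv_mono tT' ier _)).
      by move=> s _; rewrite mulr_ge0// expR_ge0.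
    rewrite -rQ -(@RintegralZl _ _ _ leb _ _ (expR (2 * T)) mDT ir).
    apply: le_Rintegral => //; first exact: (@integrableR_Z _ _ _ leb _ mDT _ _ ir).
    move=> s; rewrite /= in_itv /= => /andP[_ sT].
    by rewrite ler_wpM2r// ler_expR ler_pM2l.
  rewrite -/(q t) -/(phi t) => /le_trans; apply.
  have -> x y : 2^-1 * (2 * L ^+ 2 * x + 16 * M ^+ 2 * y) = 8 * M ^+ 2 * y + L ^+ 2 * x by field.
  rewrite lerD2r /E.
  by apply: ler_wpM2l le1; rewrite mulr_ge0// sqr_ge0.
have L2 : 0 <= L ^+ 2 by exact: sqr_ge0.
have := gronwall T0 L2 cphi rec.
rewrite /phi /E -/(q T) -/Q.
set y := expR (2 * T); have y0 : 0 < y by exact: expR_gt0.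
set z := expR (L ^+ 2 * T); have z0 : 0 < z by exact: expR_gt0.
have -> : 8 * M ^+ 2 * (y * (T * (e ^+ 2 * pB) + L ^+ 2 * Q)) * z =
  y * (8 * z * M ^+ 2 * (T * (e ^+ 2 * pB) + L ^+ 2 * Q)) by ring.
rewrite ler_pM2l// => /le_trans; apply.
have -> : 8 * z * (T + L ^+ 2) * M ^+ 2 * (e ^+ 2 * pB + Q) =
  8 * z * M ^+ 2 * ((T + L ^+ 2) * (e ^+ 2 * pB + Q)) by ring.
rewrite ler_wpM2l//; first by rewrite !mulr_ge0// ?sqr_ge0// ltW.
have : 0 <= T * Q by rewrite mulr_ge0.
have : 0 <= L ^+ 2 * (e ^+ 2 * pB) by rewrite !mulr_ge0// sqr_ge0.
lra.
Qed.

End modes.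

(** * Differences of mild solutions *)

Section spde.
Context d (Omega : measurableType d) (R : realType) (P : probability Omega R).
Local Notation H := (Hper R).
Local Notation leb := (@lebesgue_measure R).
Implicit Types (B : set Omega) (Y Z : Omega -> H) (x y z h k : H).
Variables (S : R -> H -> H) (hS : C0_semigroup S)
  (hSA : has_generator S (@H2per R) (@Aop R)).

Lemma bochner_mode (t : R) (g : R -> Omega -> H) Z (k : int) (psi : Omega -> R) :
  is_bochner_integral P t (fun s w => Kop S (t - s) (g s w)) Z ->
  (forall s, 0 <= s <= t -> L2_rv P (g s)) -> psi \in Lfun P 2%:E ->
  exists a : R -> R, [/\ leb.-integrable `[0, t] (EFin \o a),
    {ae leb, forall s, `[0, t]%classic s ->
      a s = - k%:~R * expR (- lam R k * (t - s)) *
              \int[P]_w (psi w * ip (g s w) (cbasis R (- k)))} &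
    \int[P]_w (psi w * ip (Z w) (cbasis R k)) = \int[leb]_(s in `[0, t]) a s].
Proof.
move=> hZ hg hpsi; have [a [ia aE ZE]] := bochner_scalar (cbasis R k) hZ hpsi.
exists a; split => //.
(* The endpoint s = t is discarded because the coefficients of [Kop S r] are computed for r > 0. *)
have : {ae leb, forall s, forall n : nat, if n is 0%N then s <> t else
   `[0, t]%classic s -> L2_rv P (fun w => Kop S (t - s) (g s w)) /\
     a s = \int[P]_w (psi w * ip (Kop S (t - s) (g s w)) (cbasis R k))}.
  by apply: ae_foralln => -[|n]; [exact: ae_singleton|exact: aE].
apply: ae_mono => s hs st; have [_ ->] := hs 1%N st; have nst := hs 0%N.
have s0t : 0 <= s <= t by move: st; rewrite /= in_itv.
have ts : 0 < t - s.
  rewrite subr_gt0 lt_neqAle; case/andP: s0t => _ ->; rewrite andbT; exact/eqP.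
have ig := scalar_integrable (cbasis R (- k)) hpsi (hg s s0t).
rewrite -RintegralZl//; apply: eq_Rintegral => w _.
by rewrite (Kop_coef hS hSA _ _ ts) mulrCA.
Qed.

Lemma mode_of_bochner (T : R) h (g u : R -> Omega -> H) :
  (forall t, 0 <= t <= T -> exists2 Z,
     is_bochner_integral P t (fun s w => Kop S (t - s) (g s w)) Z &
     {ae P, forall w, u t w = S t h + Z w}) ->
  (forall s, 0 <= s <= T -> L2_rv P (g s)) -> (forall s, 0 <= s <= T -> L2_rv P (u s)) ->
  mode_eq P T h g u.
Proof.
move=> hZ hg hu t tT k psi hpsi; have [Z bZ uZ] := hZ t tT; have /andP[t0 tT'] := tT.
have hgt s : 0 <= s <= t -> L2_rv P (g s).
  by move=> /andP[s0 st]; apply: hg; rewrite s0 (le_trans st).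
have [a [ia aE ZE]] := bochner_mode k bZ hgt hpsi.
exists a; split => //; rewrite -ZE -(S_coef hS hSA h k t0).
have L2Z : L2_rv P Z by case: bZ.
have ipsi : P.-integrable setT (EFin \o psi).
  by have := Lfun2M_integrable hpsi (Lfun2_cst P 1); apply: eq_integrable => // w _ /=; rewrite mulr1.
have iZ := scalar_integrable (cbasis R k) hpsi L2Z.
have iu := scalar_integrable (cbasis R k) hpsi (hu t tT).
rewrite -RintegralZl// -RintegralD//; last exact: integrableR_Z.
apply: ae_eq_Rintegral.
- by have /integrableP[/measurable_EFinP] := iu.
- have iS := integrableR_Z measurableT (ip (S t h) (cbasis R k)) ipsi.
  by have /integrableP[/measurable_EFinP] := integrableR_D measurableT iS iZ.
by apply: ae_mono uZ => w /= -> _; rewrite ipDl mulrDr mulrC.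
Qed.

Variables (beta : nat -> R -> Omega -> R) (WA : R -> Omega -> H).
Hypothesis hWA : forall t : R, 0 <= t -> L2_rv P (WA t).
Variables (F : H -> H) (hF : C1_bounded_derivative F).
Let L := supnorm_DF F.
Let L0 : 0 <= L := supnorm_ge0 F.
Let F_diff x : differentiable F x. Proof. by case: hF. Qed.
Let F_bnd : has_ubound (range (fun x => opn ('d F x))). Proof. by case: hF. Qed.
Let F_lip x y : `|F x - F y| <= L * `|x - y|.
Proof. exact: (F_lipschitz (@ipBl R) (@ipZl R) (@ipxx R) (@ip_le R) F_diff F_bnd). Qed.
Let F_cont : continuous F. Proof. exact: lipschitz_continuous F_lip. Qed.

Lemma L2_rv_F Y : L2_rv P Y -> L2_rv P (fun w => F (Y w)).
Proof.
move=> /L2_rvP[mY hY].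
apply: (L2_rv_domR _ (Lfun2D (Lfun2_cst P `|F 0|) (Lfun2Z L hY))).
  exact: (borel_rv_comp F_cont mY).
move=> w; have := F_lip (Y w) 0; rewrite subr0 => h.
by rewrite -[F (Y w)](subrK (F 0)) (le_trans (ler_normD _ _))// addrC lerD.
Qed.

Lemma L2_rv_dF Y Z : L2_rv P Y -> L2_rv P Z -> L2_rv P (fun w => 'd F (Y w) (Z w)).
Proof.
move=> /L2_rvP[mY _] /L2_rvP[mZ hZ].
apply: (L2_rv_domR _ (Lfun2Z L hZ)); first exact: borel_rv_dF.
by move=> w; exact: (dF_le F_diff F_bnd).
Qed.

Variables (X : H -> R -> Omega -> H).
Hypothesis hX : forall x : H, mild_solution P S beta WA F x (X x).
Variable (eta : H -> H -> R -> Omega -> H).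
Hypothesis heta : forall x h : H, linearized_mild_solution P S beta F (X x) h (eta x h).

Lemma X_L2_continuous x T : L2_continuous P T (X x).
Proof.
have [cX _] := hX x; apply: (@L2_continuous_sub _ _ _ P (`|T| + 1)).
  by rewrite (le_trans (ler_norm T))// lerDl.
by apply: (@CW_L2_continuous _ _ _ P beta); apply: cX; rewrite ltr_wpDl.
Qed.

Lemma eta_L2_continuous x h T : L2_continuous P T (eta x h).
Proof.
have [cX _] := heta x h; apply: (@L2_continuous_sub _ _ _ P (`|T| + 1)).
  by rewrite (le_trans (ler_norm T))// lerDl.
by apply: (@CW_L2_continuous _ _ _ P beta); apply: cX; rewrite ltr_wpDl.
Qed.

Lemma X_L2 x s : 0 <= s -> L2_rv P (X x s).
Proof. by move=> s0; have [h _] := X_L2_continuous x s; apply: h; rewrite s0 lexx. Qed.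

Lemma eta_L2 x h s : 0 <= s -> L2_rv P (eta x h s).
Proof. by move=> s0; have [k _] := eta_L2_continuous x h s; apply: k; rewrite s0 lexx. Qed.

(** Moving the stochastic convolution to the left turns the mild equation into a noise-free one for
    X - WA, with the drift still evaluated at X. *)
Lemma X_mode x T : mode_eq P T x (fun s w => F (X x s w)) (fun s w => X x s w - WA s w).
Proof.
apply: mode_of_bochner => [t /andP[t0 _]|s /andP[s0 _]|s /andP[s0 _]].
- have [_ /(_ t t0)[Z bZ XE]] := hX x; exists Z => //.
  by apply: ae_mono XE => w ->; rewrite addrK.
- by apply: L2_rv_F; exact: X_L2.
- by apply: L2_rvB; [exact: X_L2|exact: hWA].
Qed.

Lemma eta_mode x h T :
  mode_eq P T h (fun s w => 'd F (X x s w) (eta x h s w)) (eta x h).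
Proof.
apply: mode_of_bochner => [t /andP[t0 _]|s /andP[s0 _]|s /andP[s0 _]].
- by have [_ /(_ t t0)] := heta x h.
- by apply: L2_rv_dF; [exact: X_L2|exact: eta_L2].
- exact: eta_L2.
Qed.

Lemma X_diff_mode x y T : mode_eq P T (x - y) (fun s w => F (X x s w) - F (X y s w))
  (fun s w => X x s w - X y s w).
Proof.
have L2v z s : 0 <= s <= T -> L2_rv P (fun w => X z s w - WA s w).
  by move=> /andP[s0 _]; apply: L2_rvB; [exact: X_L2|exact: hWA].
have L2F z s : 0 <= s <= T -> L2_rv P (fun w => F (X z s w)).
  by move=> /andP[s0 _]; apply: L2_rv_F; exact: X_L2.
have := mode_eq_lin 1 (-1) (@X_mode x T) (@X_mode y T)
  (L2v x) (L2v y) (L2F x) (L2F y).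
rewrite !scale1r !scaleN1r.
have -> : (fun s w => 1 *: F (X x s w) + -1 *: F (X y s w)) = (fun s w => F (X x s w) - F (X y s w)).
  by apply/funext => s; apply/funext => w; rewrite !scale1r !scaleN1r.
have -> // : (fun s w => 1 *: (X x s w - WA s w) + -1 *: (X y s w - WA s w)) =
   (fun s w => X x s w - X y s w).
by apply/funext => s; apply/funext => w; rewrite !scale1r !scaleN1r -subr_subr.
Qed.

Lemma X_lipschitz x y t : 0 <= t ->
  {ae P, forall w, `|X x t w - X y t w| <= expR ((L ^+ 2 / 4 - 1) * t) * `|x - y|}.
Proof.
move=> t0; apply: (energy_lipschitz t0 L0 (@X_diff_mode x y t)).
- by apply: L2_continuousB; exact: X_L2_continuous.
- by move=> s /andP[s0 _]; apply: L2_rvB; apply: L2_rv_F; exact: X_L2.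
- by move=> s w _; exact: F_lip.
Qed.

Lemma eta_bound x h t : 0 <= t ->
  {ae P, forall w, `|eta x h t w| <= expR ((L ^+ 2 / 4 - 1) * t) * `|h|}.
Proof.
move=> t0; apply: (energy_lipschitz t0 L0 (@eta_mode x h t)).
- exact: eta_L2_continuous.
- by move=> s /andP[s0 _]; apply: L2_rv_dF; [exact: X_L2|exact: eta_L2].
- by move=> s w _; exact: (dF_le F_diff F_bnd).
Qed.

(** The decay - 1 of the rate is dropped to make the constant nondecreasing in time, so that one
    constant serves on all of [0, t]. *)
Definition flow_lip (t : R) : R := expR (L ^+ 2 / 4 * t).

Lemma X_lipschitz_le x y s t : 0 <= s <= t ->
  {ae P, forall w, `|X x s w - X y s w| <= flow_lip t * `|x - y|}.
Proof.
move=> /andP[s0 st]; apply: ae_mono (X_lipschitz x y s0) => w /le_trans; apply.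
rewrite ler_wpM2r// ler_expR.
apply: (@le_trans _ _ (L ^+ 2 / 4 * s)); first by rewrite ler_wpM2r// gerBl.
by rewrite ler_wpM2l// divr_ge0// sqr_ge0.
Qed.

Definition energy_cst (T : R) : R := 8 * expR (L ^+ 2 * T) * (T + L ^+ 2).

Let cutoff_measurable e dl x s : 0 < dl -> 0 <= s ->
  measurable_fun setT (fun w => osc_cutoff F e dl (X x s w)).
Proof.
move=> d0 s0; apply: (@borel_rv_real _ _ _ (osc_cutoff F e dl)).
  apply: (@lipschitz_continuous R H R _ dl^-1) => p q; exact: osc_cutoff_lipschitz.
by have /L2_rvP[] := X_L2 x s0.
Qed.

Lemma cutoff_continuous B T e dl x : measurable B -> 0 < dl ->
  {within `[0, T], continuous (fun s => \int[P]_w (\1_B w * osc_cutoff F e dl (X x s w)))}.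
Proof.
move=> mB d0.
have di : 0 <= dl^-1 by rewrite invr_ge0 ltW.
exact: (indic_lipschitz_continuous di (osc_cutoff01 F e dl)
  (fun p q => osc_cutoff_lipschitz F e p q d0) mB (X_L2_continuous x T)).
Qed.

(** The cutoff is evaluated along the single path from y: by the condition on dl, the paths from z
    and z + k stay almost surely within dl of it and of each other. *)
Lemma second_diff_energy B T e dl y z k : measurable B -> 0 <= T -> 0 < e -> 0 < dl ->
  flow_lip T * (`|k| + `|y - z|) <= dl ->
  \int[P]_w (\1_B w * `|X (y + k) T w - X y T w - (X (z + k) T w - X z T w)| ^+ 2) <=
  energy_cst T * (flow_lip T * `|k|) ^+ 2 * (e ^+ 2 * \int[P]_w (\1_B w) +
     \int[leb]_(s in `[0, T]) \int[P]_w (\1_B w * osc_cutoff F e dl (X y s w))).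
Proof.
move=> mB T0 e0 d0 hd.
pose D a b s w := X a s w - X b s w; pose G a b s w := F (X a s w) - F (X b s w).
have c0 : 0 <= flow_lip T by exact: expR_ge0.
have L2D a b s : 0 <= s <= T -> L2_rv P (D a b s).
  by move=> /andP[s0 _]; apply: L2_rvB; exact: X_L2.
have L2G a b s : 0 <= s <= T -> L2_rv P (G a b s).
  by move=> /andP[s0 _]; apply: L2_rvB; apply: L2_rv_F; exact: X_L2.
have hm : mode_eq P T 0 (fun s w => G (y + k) y s w - G (z + k) z s w)
    (fun s w => D (y + k) y s w - D (z + k) z s w).
  have := mode_eq_lin 1 (-1) (@X_diff_mode (y+k) y T)
    (@X_diff_mode (z+k) z T) (L2D (y+k) y) (L2D (z+k) z) (L2G (y+k) y) (L2G (z+k) z).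
  rewrite scale1r scaleN1r ![_ + k]addrC !addrK subrr.
  have -> : (fun s w => 1 *: (F (X (k + y) s w) - F (X y s w)) + -1 *: (F (X (k + z) s w) - F (X z s w)))
     = (fun s w => G (k + y) y s w - G (k + z) z s w).
    by apply/funext => s; apply/funext => w; rewrite scale1r scaleN1r.
  have -> // : (fun s w => 1 *: (X (k + y) s w - X y s w) + -1 *: (X (k + z) s w - X z s w))
     = (fun s w => D (k + y) y s w - D (k + z) z s w).
  by apply/funext => s; apply/funext => w; rewrite scale1r scaleN1r.
apply: (energy_cutoff mB T0 L0 (ltW e0) _ hm (chi := fun s w => osc_cutoff F e dl (X y s w))).
- by rewrite mulr_ge0.
- by apply: L2_continuousB; apply: L2_continuousB; exact: X_L2_continuous.
- by move=> s sT; apply: L2_rvB; exact: L2G.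
- by move=> s /andP[s0 _]; exact: cutoff_measurable.
- by move=> s w; exact: osc_cutoff01.
- exact: cutoff_continuous.
move=> s sT.
(* Packs three almost sure Lipschitz bounds into one family: for n = 0 the pair z + k, z, for n = 1
   the pair z, y, and from n = 2 on the pair z + k, y. *)
have : {ae P, forall w, forall n : nat,
   `|X (if n is 0%N then z + k else if n is 1%N then z else z + k) s w -
     X (if n is 0%N then z else y) s w| <=
   flow_lip T * `|(if n is 0%N then z + k else if n is 1%N then z else z + k) - (if n is 0%N then z else y)|}.
  by apply: ae_foralln => n; exact: X_lipschitz_le.
apply: ae_mono => w hw.
have h0 := hw 0%N; have h1 := hw 1%N; have h2 := hw 2%N; rewrite /= in h0 h1 h2.
rewrite (addrC z k) addrK -(addrC z k) in h0.
apply: (drift_second_diff (@ipBl R) (@ipZl R) (@ipxx R) (@ip_le R) F_diff F_bnd) => //.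
- apply: (le_trans h1); apply: le_trans hd; rewrite ler_wpM2l// distrC lerDr//.
- apply: (le_trans h2); apply: le_trans hd; rewrite ler_wpM2l//.
  by rewrite addrAC addrC (le_trans (ler_normD _ _))// (distrC z).
- by apply: (le_trans h0); apply: le_trans hd; rewrite ler_wpM2l// lerDl.
Qed.

Lemma first_diff_energy B T e dl x h (n : R) : measurable B -> 0 <= T -> 0 < e -> 0 < dl ->
  0 < n -> flow_lip T * `|h| / n <= dl ->
  \int[P]_w (\1_B w * `|n *: (X (x + n^-1 *: h) T w - X x T w) - eta x h T w| ^+ 2) <=
  energy_cst T * (flow_lip T * `|h|) ^+ 2 * (e ^+ 2 * \int[P]_w (\1_B w) +
     \int[leb]_(s in `[0, T]) \int[P]_w (\1_B w * osc_cutoff F e dl (X x s w))).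
Proof.
move=> mB T0 e0 d0 n0 hd; set y := x + _.
pose D s w := X y s w - X x s w; pose G s w := F (X y s w) - F (X x s w).
have c0 : 0 <= flow_lip T by exact: expR_ge0.
have L2D s : 0 <= s <= T -> L2_rv P (D s).
  by move=> /andP[s0 _]; apply: L2_rvB; exact: X_L2.
have L2G s : 0 <= s <= T -> L2_rv P (G s).
  by move=> /andP[s0 _]; apply: L2_rvB; apply: L2_rv_F; exact: X_L2.
have L2e s : 0 <= s <= T -> L2_rv P (eta x h s) by move=> /andP[s0 _]; exact: eta_L2.
have L2de s : 0 <= s <= T -> L2_rv P (fun w => 'd F (X x s w) (eta x h s w)).
  by move=> /andP[s0 _]; apply: L2_rv_dF; [exact: X_L2|exact: eta_L2].
have yx : y - x = n^-1 *: h by rewrite /y (addrC x) addrK.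
have hm : mode_eq P T 0 (fun s w => n *: G s w - 'd F (X x s w) (eta x h s w))
    (fun s w => n *: D s w - eta x h s w).
  have := mode_eq_lin n (-1) (@X_diff_mode (y) x T)
    (@eta_mode x h T) L2D L2e L2G L2de.
  rewrite yx scalerA divff ?gt_eqF// scale1r scaleN1r subrr.
  have -> : (fun s w => n *: (F (X y s w) - F (X x s w)) + -1 *: 'd F (X x s w) (eta x h s w))
     = (fun s w => n *: G s w - 'd F (X x s w) (eta x h s w)).
    by apply/funext => s; apply/funext => w; rewrite scaleN1r.
  have -> // : (fun s w => n *: (X y s w - X x s w) + -1 *: eta x h s w)
     = (fun s w => n *: D s w - eta x h s w).
  by apply/funext => s; apply/funext => w; rewrite scaleN1r.
apply: (energy_cutoff mB T0 L0 (ltW e0) _ hm (chi := fun s w => osc_cutoff F e dl (X x s w))).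
- by rewrite mulr_ge0.
- have := L2_continuous_lin n (-1) (L2_continuousB (X_L2_continuous y T) (X_L2_continuous x T))
    (eta_L2_continuous x h T).
  have -> // : (fun s w => n *: (X y s w - X x s w) + -1 *: eta x h s w)
     = (fun s w => n *: D s w - eta x h s w).
  by apply/funext => s; apply/funext => w; rewrite scaleN1r.
- by move=> s sT; apply: L2_rvB; [apply: L2_rvZ; exact: L2G|exact: L2de].
- by move=> s /andP[s0 _]; exact: cutoff_measurable.
- by move=> s w; exact: osc_cutoff01.
- exact: cutoff_continuous.
move=> s sT; apply: ae_mono (X_lipschitz_le y x sT) => w.
rewrite yx normrZ gtr0_norm ?invr_gt0// => hw.
apply: (drift_first_diff (@ipBl R) (@ipZl R) (@ipxx R) (@ip_le R) F_diff F_bnd) => //.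
- exact: ltW.
- by rewrite mulrC -ler_pdivlMr// -mulrA (mulrC `|h|).
- by apply: (le_trans hw); rewrite mulrCA mulrC.
Qed.

End spde.

(** * Step paths *)

Section cells.
Variables (R : realType) (T : R).
Hypothesis T0 : 0 <= T.
Local Notation leb := (@lebesgue_measure R).

Definition knot (N i : nat) : R := T * i%:R / N%:R.
(* The cells cover [0, T[ only: mesh sums and step paths vanish at s = T. *)
Definition cell (N i : nat) : set R := `[knot N i, knot N i.+1[%classic.

Lemma knot_le N i j : (i <= j)%N -> knot N i <= knot N j.
Proof. by move=> ij; rewrite /knot ler_wpM2r ?invr_ge0// ler_wpM2l// ler_nat. Qed.

Lemma knot0 N : knot N 0 = 0. Proof. by rewrite /knot mulr0 mul0r. Qed.

Lemma knot_max N : (0 < N)%N -> knot N N = T.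
Proof. by move=> N0; rewrite /knot mulfK// pnatr_eq0 -lt0n. Qed.

Lemma knot_itv N i : (0 < N)%N -> (i <= N)%N -> 0 <= knot N i <= T.
Proof. move=> N0 iN; apply/andP; split; first by rewrite -(knot0 N) knot_le.
by rewrite -[leRHS](knot_max N0) knot_le. Qed.

Lemma measurable_cell N i : measurable (cell N i).
Proof. exact: measurable_itv. Qed.

Lemma cell_sub N i s : (i < N)%N -> cell N i s -> 0 <= s < T.
Proof.
move=> iN; rewrite /cell /= in_itv /= => /andP[a b].
have N0 : (0 < N)%N by exact: leq_ltn_trans iN.
have /andP[k0 _] := knot_itv N0 (ltnW iN); have /andP[_ k1] := knot_itv N0 iN.
by rewrite (le_trans k0 a) (lt_le_trans b k1).
Qed.

Lemma cell_exists N s : (0 < N)%N -> 0 <= s < T -> exists2 i, (i < N)%N & cell N i s.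
Proof.
move=> N0 /andP[s0 sT].
suff : forall n, s < knot N n -> exists2 i, (i < n)%N & cell N i s.
  by apply; rewrite knot_max.
elim=> [|n ih] h; first by move: h; rewrite knot0 ltNge s0.
have [h'|h'] := ltP s (knot N n).
  by have [i iN ci] := ih h'; exists i => //; exact: ltnW.
by exists n => //; rewrite /cell /= in_itv /= h' h.
Qed.

Lemma cell_inj N i j s : cell N i s -> cell N j s -> i = j.
Proof.
suff h a b : cell N a s -> cell N b s -> (a <= b)%N.
  by move=> hi hj; apply/eqP; rewrite eqn_leq !h.
rewrite /cell /= !in_itv /= leqNgt => /andP[h1 h2] /andP[h3 h4]; apply/negP => ba.
by have := knot_le N ba; rewrite leNgt (le_lt_trans h1 h4).
Qed.

Lemma cell_sum (V : lmodType R) N i s (g : nat -> V) : (i < N)%N -> cell N i s ->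
  \sum_(j < N) \1_(cell N j) s *: g j = g i.
Proof.
move=> iN ci; rewrite (bigD1 (Ordinal iN))//= indicE mem_set//= scale1r big1 ?addr0//.
move=> j ji; rewrite indicE memNset ?scale0r// => cj.
by move/eqP: ji; apply; apply: val_inj; exact: cell_inj cj ci.
Qed.

Lemma cell_sumR N i s (g : nat -> R) : (i < N)%N -> cell N i s ->
  \sum_(j < N) \1_(cell N j) s * g j = g i.
Proof. exact: (@cell_sum R^o). Qed.

Lemma cell_sum0 N s (g : nat -> R) : ~ (0 <= s < T) -> \sum_(j < N) \1_(cell N j) s * g j = 0.
Proof.
move=> sT; apply: big1 => j _; rewrite indicE memNset ?mul0r// => cj.
by apply: sT; exact: cell_sub (ltn_ord j) cj.
Qed.

Lemma cell_dist N i s : cell N i s -> `|s - knot N i| <= T / N%:R.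
Proof.
rewrite /cell /= in_itv /= => /andP[a b].
rewrite ger0_norm ?subr_ge0// lerBlDl (le_trans (ltW b))//.
by rewrite /knot -mulrDl -natr1 mulrDr mulr1.
Qed.

Let mD : measurable (`[0, T] : set R). Proof. exact: measurable_itv. Qed.

Let fD : (leb `[0%R, T]%classic < +oo)%E.
Proof. by rewrite lebesgue_measure_itv /= lte_fin; case: ifP => _; rewrite ?ltry// lte_fin. Qed.

Lemma integral_supported (h : R -> R) : leb.-integrable `[0, T] (EFin \o h) ->
  (forall s, ~ (0 <= s <= T) -> h s = 0) ->
  (\int[leb]_s (h s)%:E)%E = (\int[leb]_(s in `[0, T]) h s)%:E.
Proof.
move=> hi h0; rewrite /Rintegral fineK; last exact: integrable_fin_num.
rewrite [RHS]integral_mkcond; apply: eq_integral => s _.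
rewrite patchE; case: ifPn => // sD; rewrite h0// => sT; move/negP: sD; apply.
by rewrite inE /= in_itv.
Qed.

Lemma Rintegral_mesh N (b : nat -> R) :
  leb.-integrable `[0, T] (EFin \o (fun s => \sum_(i < N) \1_(cell N i) s * b i)) /\
  \int[leb]_(s in `[0, T]) (\sum_(i < N) \1_(cell N i) s * b i) =
  \sum_(i < N) fine (leb (cell N i)) * b i.
Proof.
pose A i := if (i < N)%N then cell N i else set0.
have hA i : measurable (A i) /\ A i `<=` `[0, T]%classic.
  rewrite /A; case: ifPn => iN; last by split; [exact: measurable0|exact: sub0set].
  split; first exact: measurable_cell.
  by move=> s /(cell_sub iN) /andP[s0 sT]; rewrite /= in_itv /= s0 ltW.
have AE (i : 'I_N) : A i = cell N i by rewrite /A ltn_ord.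
have := Rintegral_step b N mD fD hA.
under [X in EFin \o X]eq_fun do under eq_bigr do rewrite AE.
under eq_Rintegral do under eq_bigr do rewrite AE.
by under [in X in _ = X]eq_bigr do rewrite AE.
Qed.

(** Two meshes need not be nested, so they are compared on the intersections of their cells. *)
Lemma Rintegral_mesh2 N M (b : nat -> nat -> R) :
  let h s := \sum_(i < N) \sum_(k < M) \1_(cell N i `&` cell M k) s * b i k in
  leb.-integrable `[0, T] (EFin \o h) /\
  \int[leb]_(s in `[0, T]) h s =
  \sum_(i < N) \sum_(k < M) fine (leb (cell N i `&` cell M k)) * b i k.
Proof.
move=> h.
have one (i : 'I_N) (k : 'I_M) :
  leb.-integrable `[0, T] (EFin \o (fun s => \1_(cell N i `&` cell M k) s * b i k)) /\
  \int[leb]_(s in `[0, T]) (\1_(cell N i `&` cell M k) s * b i k) =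
    fine (leb (cell N i `&` cell M k)) * b i k.
  have hA (j : nat) : measurable (cell N i `&` cell M k) /\
      cell N i `&` cell M k `<=` `[0, T]%classic.
    split; first by apply: measurableI; exact: measurable_cell.
    by move=> s [/(cell_sub (ltn_ord i)) /andP[s0 sT] _]; rewrite /= in_itv /= s0 ltW.
  have := @Rintegral_step R _ (fun=> cell N i `&` cell M k) (fun=> b i k) 1 mD fD hA.
  under [X in EFin \o X]eq_fun do rewrite big_ord1.
  by under eq_Rintegral do rewrite big_ord1; rewrite big_ord1.
have row (i : 'I_N) := @integrableR_sum _ _ _ leb _ mD M _ (fun k => (one i k).1).
have [i1 i2] := @integrableR_sum _ _ _ leb _ mD N _ (fun i => (row i).1).
split; first exact: i1.
rewrite [LHS]i2; apply: eq_bigr => i _; rewrite [LHS](row i).2.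
by apply: eq_bigr => k _; rewrite [LHS](one i k).2.
Qed.

Lemma cell_sum2 N M i k s (b : nat -> nat -> R) : (i < N)%N -> (k < M)%N ->
  cell N i s -> cell M k s ->
  \sum_(i < N) \sum_(k < M) \1_(cell N i `&` cell M k) s * b i k = b i k.
Proof.
move=> iN kM ci ck; rewrite -(cell_sumR (fun i => b i k) iN ci); apply: eq_bigr => j _.
rewrite -(cell_sumR (b j) kM ck) mulr_sumr; apply: eq_bigr => l _.
by rewrite indicI /= mulrA.
Qed.

Lemma cell_sum20 N M s (b : nat -> nat -> R) : ~ (0 <= s < T) ->
  \sum_(i < N) \sum_(k < M) \1_(cell N i `&` cell M k) s * b i k = 0.
Proof.
move=> sT; apply: big1 => j _; apply: big1 => k _; rewrite indicE memNset ?mul0r// => -[cj _].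
by apply: sT; exact: cell_sub (ltn_ord j) cj.
Qed.

(** The bound on b is needed only for overlapping cells; the others have an empty intersection, and
    the intersections that remain partition [0, T[. *)
Lemma cell_meas2_le N M (eps : R) (b : nat -> nat -> R) : 0 <= eps ->
  (forall i k s, (i < N)%N -> (k < M)%N -> cell N i s -> cell M k s -> b i k <= eps) ->
  \sum_(i < N) \sum_(k < M) fine (leb (cell N i `&` cell M k)) * b i k <= eps * T.
Proof.
move=> e0 hb; have [ih <-] := Rintegral_mesh2 N M b.
have ic : leb.-integrable `[0, T] (EFin \o (fun=> eps)).
  by apply: within_integrable; apply: continuous_subspaceT => s; exact: cvg_cst.
apply: (@le_trans _ _ (\int[leb]_(s in `[0, T]) eps)).
  apply: le_Rintegral => // s _.
  have [sT|sT] := pselect (0 <= s < T); last by rewrite cell_sum20.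
  have [N0|N0] := posnP N; first by rewrite N0 big_ord0.
  have [M0|M0] := posnP M; first by rewrite M0 big1// => i _; rewrite big_ord0.
  have [i iN ci] := cell_exists N0 sT; have [k kM ck] := cell_exists M0 sT.
  by rewrite (cell_sum2 b iN kM ci ck); exact: (hb i k s).
by rewrite (@Rintegral_cst _ _ _ leb _ mD) fine_itv0.
Qed.

End cells.

Section step_paths.
Context d (Omega : measurableType d) (R : realType) (P : probability Omega R).
Local Notation H := (Hper R).
Local Notation leb := (@lebesgue_measure R).
Implicit Types (B : set Omega) (Y : R -> Omega -> H).
Variables (T : R) (T0 : 0 <= T).

(** Heine's argument with values in L^2(Omega; H); radii are halved so that s and s' lie within a of
    the same centre x. *)
Lemma uniform_L2_continuous Y (e : R) : L2_continuous P T Y -> 0 < e ->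
  exists2 dl, 0 < dl & forall s s', 0 <= s <= T -> 0 <= s' <= T -> `|s - s'| < dl ->
    hnrm2 P (fun w => Y s w - Y s' w) <= e.
Proof.
move=> [Y1 Y2] e0; have e2 : 0 < e / 2 by rewrite divr_gt0.
have cpt : compact (`[0, T]%classic : set R) by exact: segment_compact.
move/compact_near_coveringP : cpt => /(_ _ (0 : R)^'+
  (fun dl s => forall s', 0 <= s <= T -> 0 <= s' <= T -> `|s - s'| < dl ->
    hnrm2 P (fun w => Y s w - Y s' w) <= e)) => hcov.
have : \forall dl \near (0 : R)^'+, `[0, T]%classic `<=`
   (fun s => forall s', 0 <= s <= T -> 0 <= s' <= T -> `|s - s'| < dl ->
    hnrm2 P (fun w => Y s w - Y s' w) <= e).
  apply: hcov => x; rewrite /= in_itv /= => xT.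
  have [a a0 ha] := Y2 x xT _ e2; have a2 : 0 < a / 2 by rewrite divr_gt0.
  exists ([set y | `|x - y| < a / 2], [set dl | dl < a / 2]).
    split; last exact: nbhs_right_lt.
    by apply/nbhs_normP; exists (a / 2).
  move=> [y dl] /= [xy dla] s' yT s'T ys'.
  have h1 : hnrm2 P (fun w => Y y w - Y x w) <= e / 2.
    by apply: ha => //; rewrite distrC (lt_trans xy)// ltr_pdivrMr// ltr_pMr// ltr1n.
  have h2 : hnrm2 P (fun w => Y s' w - Y x w) <= e / 2.
    apply: ha => //; rewrite -(subrKA y) (le_lt_trans (ler_normD _ _))// (splitr a) ltrD//.
      by rewrite distrC (lt_trans ys').
    by rewrite distrC.
  rewrite hnrm2BC in h2.
  have -> : (fun w => Y y w - Y s' w) = (fun w => (Y y w - Y x w) + (Y x w - Y s' w)).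
    by apply/funext => w; rewrite subrKA.
  have L1 := L2_rvB (Y1 y yT) (Y1 x xT); have L2 := L2_rvB (Y1 x xT) (Y1 s' s'T).
  by rewrite (le_trans (hnrm2D L1 L2))// (splitr e) lerD.
move=> hnear; have [dl [d0 hd]] := filter_ex (filterI (nbhs_right_gt (0 : R)) hnear).
exists dl => // s s' sT s'T; apply: (hd s _ s' sT s'T).
by rewrite /= in_itv.
Qed.

Definition step N Y s w : H := \sum_(i < N) \1_(cell T N i) s *: Y (knot T N i) w.

(* The L^1 norm over [0, T] of the difference of two consecutive step paths is a finite sum,
   and summable in j almost surely: this avoids any joint measurability of the process. *)
Lemma step_cvg_ae0 Y (N : nat -> nat) : L2_continuous P T Y ->
  (forall j, (0 < N j)%N) -> (forall j, (N j <= N j.+1)%N) ->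
  (forall j s s', 0 <= s <= T -> 0 <= s' <= T -> `|s - s'| <= 2 * (T / (N j)%:R) ->
     hnrm2 P (fun w => Y s w - Y s' w) <= (4 ^ j)%:R^-1) ->
  {ae P, forall w, {ae leb, forall s, 0 <= s < T -> cvgn (fun j => step (N j) Y s w)}}.
Proof.
move=> [Y1 Y2] N0 Nmono hN.
have YK M i : (0 < M)%N -> (i <= M)%N -> L2_rv P (Y (knot T M i)).
  by move=> M0 iM; apply: Y1; exact: knot_itv.
pose b j i k w := `|Y (knot T (N j.+1) i) w - Y (knot T (N j) k) w|.
pose m j i k := fine (leb (cell T (N j.+1) i `&` cell T (N j) k)).
have m0 j i k : 0 <= m j i k by exact: fine_ge0.
pose D j w := \sum_(i < N j.+1) \sum_(k < N j) m j i k * b j i k w.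
have L2b j (i : 'I_(N j.+1)) (k : 'I_(N j)) :
    L2_rv P (fun w => Y (knot T (N j.+1) i) w - Y (knot T (N j) k) w).
  by apply: L2_rvB; apply: YK => //; exact: ltnW.
have ib j (i : 'I_(N j.+1)) (k : 'I_(N j)) : P.-integrable setT (EFin \o b j i k).
  have := Lfun2M_integrable (L2_rv_nrm (L2b j i k)) (Lfun2_cst P 1).
  by apply: eq_integrable => // w _ /=; rewrite mulr1.
have row j (i : 'I_(N j.+1)) := @integrableR_sum _ _ _ P _ measurableT (N j) _
  (fun k => integrableR_Z measurableT (m j i k) (ib j i k)).
have dbl j := @integrableR_sum _ _ _ P _ measurableT (N j.+1) _ (fun i => (row j i).1).
have iD j : P.-integrable setT (EFin \o D j) := (dbl j).1.
have ED j : \int[P]_w D j w <= (4 ^ j)%:R^-1 * T.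
  rewrite [X in X <= _](dbl j).2.
  have -> : \sum_(i < N j.+1) \int[P]_w (\sum_(k < N j) m j i k * b j i k w) =
    \sum_(i < N j.+1) \sum_(k < N j) m j i k * \int[P]_w b j i k w.
    apply: eq_bigr => i _; rewrite [LHS](row j i).2; apply: eq_bigr => k _.
    by rewrite RintegralZl//; exact: ib.
  apply: (@cell_meas2_le R T T0 (N j.+1) (N j) _ (fun i k => \int[P]_w b j i k w)) => //.
  move=> i k s iN kN ci ck.
  have L2 := L2b j (Ordinal iN) (Ordinal kN).
  apply: (le_trans (Rintegral_norm_le L2)); apply: hN.
  - by apply: knot_itv => //; exact: ltnW.
  - by apply: knot_itv => //; exact: ltnW.
  (* The left knots of overlapping cells are at most T / N (j+1) + T / N j <= 2 T / N j apart: this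
     is the factor 2 in the hypothesis on N. *)
  have d1 := cell_dist ci; have d2 := cell_dist ck.
  rewrite -(subrKA s) (le_trans (ler_normD _ _))// distrC.
  have : T / (N j.+1)%:R <= T / (N j)%:R.
    by rewrite ler_wpM2l// lef_pV2 ?posrE ?ltr0n// ler_nat.
  rewrite /= in d1 d2 *; lra.
(* The rate 4^-j is split in two. One factor 2^-j makes the series of f converge almost surely, so
   that f is bounded in j; the other is left for the series in s. *)
pose f j w := (2 ^ j)%:R * D j w.
have D0 j w : 0 <= D j w.
  by apply: sumr_ge0 => i _; apply: sumr_ge0 => k _; rewrite mulr_ge0// normr_ge0.
have if_ j : P.-integrable setT (EFin \o f j) by exact: integrableR_Z.
have := @ae_cvg_series _ _ _ P f (2 * T) _ _ _ _.
have C0 : 0 <= 2 * T by rewrite mulr_ge0.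
move=> /(_ C0).
have h1 n : measurable_fun setT (f n) by have /integrableP[/measurable_EFinP] := if_ n.
have h2 n w : 0 <= f n w by rewrite mulr_ge0.
have h3 n : (\int[P]_w (f n w)%:E <= (2 * T / (2 ^ n.+1)%:R)%:E)%E.
  have -> : (\int[P]_w (f n w)%:E = (\int[P]_w f n w)%:E)%E.
    by rewrite /Rintegral fineK//; exact: (integrable_fin_num measurableT (if_ n)).
  rewrite lee_fin RintegralZl//.
  apply: (le_trans (ler_wpM2l (ler0n _ _) (ED n))).
  rewrite le_eqVlt; apply/orP; left; apply/eqP.
  have p : (2 ^ n)%:R != 0 :> R by rewrite pnatr_eq0 -lt0n expn_gt0.
  have -> : (4 ^ n)%:R = (2 ^ n)%:R * (2 ^ n)%:R :> R by rewrite -natrM -expnMn.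
  by rewrite expnS natrM; field.
move=> /(_ h1 h2 h3); apply: ae_mono => w cw.
have [K K0 fK] : exists2 K, 0 <= K & forall j, f j w <= K.
  have /cvgP/cvg_seq_bounded/pinfty_ex_gt0[K K0 hK] := cvg_series_cvg_0 cw.
  by exists K; [exact: ltW|move=> j; exact: le_trans (ler_norm _) (hK j I)].
pose h j s := \sum_(i < N j.+1) \sum_(k < N j)
  \1_(cell T (N j.+1) i `&` cell T (N j) k) s * b j i k w.
have [ih hE] := all_and2 (fun j => Rintegral_mesh2 T0 (N j.+1) (N j) (fun i k => b j i k w)).
have := @ae_cvg_series _ _ _ leb h (2 * K) _ _ _ _.
have CK : 0 <= 2 * K by rewrite mulr_ge0.
have g1 n : measurable_fun setT (h n).
  apply: measurable_sum => i; apply: measurable_sum => k; apply: measurable_funM.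
    by apply: measurable_indic; apply: measurableI; exact: measurable_cell.
  exact: measurable_cst.
have g2 n s : 0 <= h n s.
  apply: sumr_ge0 => i _; apply: sumr_ge0 => k _; rewrite mulr_ge0 ?normr_ge0//.
have hout n s : ~ (0 <= s < T) -> h n s = 0.
  by move=> sT; exact: (@cell_sum20 R T T0 (N n.+1) (N n) s (fun i k => b n i k w) sT).
have g3 n : (\int[leb]_s (h n s)%:E <= (2 * K / (2 ^ n.+1)%:R)%:E)%E.
  rewrite (integral_supported (ih n)); last first.
    by move=> s sT; apply: hout => /andP[s0 sT']; apply: sT; rewrite s0 ltW.
  rewrite lee_fin hE -[X in X <= _]/(D n w).
  have p : 0 < (2 ^ n)%:R :> R by rewrite ltr0n expn_gt0.
  have := fK n; rewrite /f mulrC -ler_pdivlMr// => /le_trans; apply.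
  by rewrite expnS natrM le_eqVlt; apply/orP; left; apply/eqP; field; rewrite gt_eqF.
move=> /(_ CK g1 g2 g3); apply: ae_mono => s cs sT.
have hs j : h j s = `|step (N j.+1) Y s w - step (N j) Y s w|.
  have [i iN ci] := cell_exists (N0 j.+1) sT; have [k kN ck] := cell_exists (N0 j) sT.
  rewrite /step (cell_sum T0 (fun i => Y (knot T (N j.+1) i) w) iN ci).
  rewrite (cell_sum T0 (fun i => Y (knot T (N j) i) w) kN ck).
  exact: (cell_sum2 T0 (fun i k => b j i k w) iN kN ci ck).
apply: (@cvg_telescope R (Hper_completeType R) (fun j => step (N j) Y s w)).
by have <- : h ^~ s = (fun j => `|step (N j.+1) Y s w - step (N j) Y s w|) by apply/funext.
Qed.

(** A mesh sequence shared by countably many processes controls each of them only from some index J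
    on; dropping the first J meshes does not affect convergence. *)
Lemma step_cvg_ae Y (N : nat -> nat) (J : nat) : L2_continuous P T Y ->
  (forall j, (0 < N j)%N) -> (forall j, (N j <= N j.+1)%N) ->
  (forall j s s', (J <= j)%N -> 0 <= s <= T -> 0 <= s' <= T ->
     `|s - s'| <= 2 * (T / (N j)%:R) -> hnrm2 P (fun w => Y s w - Y s' w) <= (4 ^ j)%:R^-1) ->
  {ae P, forall w, {ae leb, forall s, 0 <= s < T -> cvgn (fun j => step (N j) Y s w)}}.
Proof.
move=> hY N0 Nmono hN.
have := @step_cvg_ae0 Y (fun j => N (j + J)%N) hY.
move=> /(_ (fun j => N0 _) (fun j => Nmono _)) h.
have {}h := h (fun j s s' sT s'T ss => le_trans (hN (j + J)%N s s' (leq_addl _ _) sT s'T ss) _).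
have : forall j, (4 ^ (j + J))%:R^-1 <= (4 ^ j)%:R^-1 :> R.
  by move=> j; rewrite lef_pV2 ?posrE ?ltr0n ?expn_gt0// ler_nat leq_exp2l// leq_addr.
move=> /h; apply: ae_mono => w; apply: ae_mono => s hs sT.
have /cvg_ex[l hl] := hs sT; apply/cvg_ex; exists l.
by rewrite -(cvg_shiftn J).
Qed.

(** A diagonal choice: the j-th mesh is fine enough for the processes of index at most j, which are
    finitely many. *)
Lemma common_refinement (Y : nat -> R -> Omega -> H) : (forall i, L2_continuous P T (Y i)) ->
  exists N : nat -> nat, [/\ forall j, (0 < N j)%N, forall j, (N j <= N j.+1)%N &
    forall i j s s', (i <= j)%N -> 0 <= s <= T -> 0 <= s' <= T ->
     `|s - s'| <= 2 * (T / (N j)%:R) -> hnrm2 P (fun w => Y i s w - Y i s' w) <= (4 ^ j)%:R^-1].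
Proof.
move=> hY.
have unif j n : exists2 dl, 0 < dl & forall i s s', (i < n)%N -> 0 <= s <= T -> 0 <= s' <= T ->
    `|s - s'| < dl -> hnrm2 P (fun w => Y i s w - Y i s' w) <= (4 ^ j)%:R^-1.
  elim: n => [|n [dl d0 ih]]; first by exists 1.
  have e0 : 0 < (4 ^ j)%:R^-1 :> R by rewrite invr_gt0 ltr0n expn_gt0.
  have [dl' d0' h'] := uniform_L2_continuous (hY n) e0.
  exists (Num.min dl dl'); first by rewrite lt_min d0.
  move=> i s s'; rewrite ltnS leq_eqVlt => /predU1P[->|im] sT s'T; rewrite lt_min => /andP[a b].
    exact: h'.
  exact: ih.
have /choice[M hM] (j : nat) : exists M, (0 < M)%N /\ forall M', (M <= M')%N ->
    forall i s s', (i <= j)%N -> 0 <= s <= T -> 0 <= s' <= T ->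
    `|s - s'| <= 2 * (T / M'%:R) -> hnrm2 P (fun w => Y i s w - Y i s' w) <= (4 ^ j)%:R^-1.
  have [dl d0 hd] := unif j j.+1.
  have B := @archi_boundP R (2 * T / dl); rewrite divr_ge0 ?mulr_ge0 ?(ltW d0)// in B.
  set A := Num.bound _ in B; have {}B := B isT.
  exists A.+1; split => // M' AM i s s' ij sT s'T ss; apply: hd => //.
  apply: (le_lt_trans ss).
  have M0 : 0 < M'%:R :> R by rewrite ltr0n (leq_trans _ AM).
  rewrite mulrA ltr_pdivrMr// -ltr_pdivrMl// mulrC (lt_le_trans B)// ler_nat.
  exact: leq_trans AM.
(* Cumulative sums make the sequence nondecreasing while keeping it above M j, and every finer mesh
   qualifies as well. *)
exists (fun j => \sum_(i < j.+1) M i)%N; split.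
- by move=> j; rewrite big_ord_recr /= addn_gt0 (hM j).1 orbT.
- by move=> j; rewrite [X in (_ <= X)%N]big_ord_recr /= leq_addr.
- move=> i j s s' ij sT s'T ss.
  have Mj : (M j <= \sum_(i < j.+1) M i)%N by rewrite big_ord_recr /= leq_addl.
  exact: ((hM j).2 _ Mj i s s' ij sT s'T ss).
Qed.

(* The integral over [0, T] of chi along the step path of mesh T / N. *)
Definition occupation (chi : H -> R) Y N w : R :=
  \sum_(i < N) fine (leb (cell T N i)) * chi (Y (knot T N i) w).

Lemma occupation_integrable chi K Y N B : measurable B -> (forall p, 0 <= chi p <= 1) ->
  (forall p q, `|chi p - chi q| <= K * `|p - q|) -> L2_continuous P T Y -> (0 < N)%N ->
  P.-integrable setT (EFin \o (fun w => \1_B w * occupation chi Y N w)) /\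
  \int[P]_w (\1_B w * occupation chi Y N w) =
  \sum_(i < N) fine (leb (cell T N i)) * \int[P]_w (\1_B w * chi (Y (knot T N i) w)).
Proof.
move=> mB chi01 chiK [Y1 _] N0.
have i1 (i : 'I_N) := indic_lipschitz_integrable chi01 chiK mB (Y1 _ (knot_itv T0 N0 (ltnW (ltn_ord i)))).
have [i2 i3] := @integrableR_sum _ _ _ P _ measurableT N _
  (fun i => integrableR_Z measurableT (fine (leb (cell T N i))) (i1 i)).
have E : (fun w => \1_B w * occupation chi Y N w) = (fun w => \sum_(i < N)
    fine (leb (cell T N i)) * (\1_B w * chi (Y (knot T N i) w))).
  by apply/funext => w; rewrite mulr_sumr; apply: eq_bigr => i _; rewrite mulrCA.
rewrite E; split; first exact: i2.
rewrite [LHS]i3; apply: eq_bigr => i _; rewrite RintegralZl//; exact: i1.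
Qed.

(** Integrated over B, the occupation is a Riemann sum of the continuous function p; on each cell
    the error is at most K 4^-j by the Lipschitz bound on chi and the choice of the mesh. *)
Lemma occupation_cvg chi K Y (N : nat -> nat) (J : nat) B : measurable B -> 0 <= K ->
  (forall p, 0 <= chi p <= 1) -> (forall p q, `|chi p - chi q| <= K * `|p - q|) ->
  L2_continuous P T Y -> (forall j, (0 < N j)%N) ->
  (forall j s s', (J <= j)%N -> 0 <= s <= T -> 0 <= s' <= T ->
     `|s - s'| <= 2 * (T / (N j)%:R) -> hnrm2 P (fun w => Y s w - Y s' w) <= (4 ^ j)%:R^-1) ->
  (fun j => \int[P]_w (\1_B w * occupation chi Y (N j) w)) @ \oo -->
  \int[leb]_(s in `[0, T]) \int[P]_w (\1_B w * chi (Y s w)).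
Proof.
move=> mB K0 chi01 chiK hY N0 hN; have [Y1 _] := hY.
pose p s := \int[P]_w (\1_B w * chi (Y s w)).
have mD : measurable (`[0, T] : set R) by exact: measurable_itv.
have ip_ : leb.-integrable `[0, T] (EFin \o p).
  by apply: within_integrable; exact: (indic_lipschitz_continuous K0 chi01 chiK mB hY).
have bnd j : (J <= j)%N ->
    `|\int[leb]_(s in `[0, T]) p s - \int[P]_w (\1_B w * occupation chi Y (N j) w)| <=
    K * T * (4 ^ j)%:R^-1.
  move=> Jj; rewrite (occupation_integrable mB chi01 chiK hY (N0 j)).2.
  have [im imE] := Rintegral_mesh T0 (N j) (fun i => p (knot T (N j) i)).
  rewrite -[X in `|_ - X|]imE -(@RintegralB _ _ _ leb _ _ _ mD ip_ im).
  have id : leb.-integrable `[0, T] (EFin \o (fun s => p s -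
      \sum_(i < N j) \1_(cell T (N j) i) s * p (knot T (N j) i))).
    exact: (@integrableR_B _ _ _ leb _ mD _ _ ip_ im).
  apply: (le_trans (@le_normr_Rintegral _ _ _ leb _ _ mD id)).
  have ic : leb.-integrable `[0, T] (EFin \o (fun=> K * (4 ^ j)%:R^-1)).
    by apply: within_integrable; apply: continuous_subspaceT => s; exact: cvg_cst.
  have -> : K * T * (4 ^ j)%:R^-1 = \int[leb]_(s in `[0, T]) (K * (4 ^ j)%:R^-1).
    by rewrite (@Rintegral_cst _ _ _ leb _ mD) fine_itv0// mulrAC.
  apply: le_Rintegral_ae => //.
    exact: (integrable_norm id).
  (* The cells leave out s = T, where the mesh sum is 0. *)
  apply: ae_mono (ae_singleton T) => s sneT; rewrite /= in_itv /= => sT.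
  have sT' : 0 <= s < T.
    by case/andP: sT => -> sT; rewrite lt_neqAle sT andbT; exact/eqP.
  have [i iN ci] := cell_exists (N0 j) sT'.
  rewrite (cell_sumR T0 (fun i => p (knot T (N j) i)) iN ci).
  have kT := knot_itv T0 (N0 j) (ltnW iN).
  apply: (le_trans (indic_lipschitz_dist K0 chi01 chiK mB (Y1 s sT) (Y1 _ kT))).
  rewrite ler_wpM2l//; apply: hN => //.
  apply: (le_trans (cell_dist ci)).
  by rewrite mulr_natl mulr2n lerDl divr_ge0.
apply/cvgrPdist_le => e e0.
have c4 : (fun j => K * T * (4 ^ j)%:R^-1) @ \oo --> (0 : R).
  rewrite -[X in _ --> X](mulr0 (K * T)); apply: cvgM; first exact: cvg_cst.
  have -> : (fun j : nat => (4 ^ j)%:R^-1) = (fun j => (4^-1 : R) ^+ j).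
    by apply/funext => j; rewrite natrX exprVn.
  by apply: cvg_expr; rewrite ger0_norm// invf_lt1// ltr1n.
move/cvgrPdist_le : c4 => /(_ e e0)[M _ hM]; exists (maxn J M) => // j /=.
rewrite geq_max => /andP[Jj Mj]; apply: (le_trans (bnd j Jj)).
apply: le_trans (hM j Mj); rewrite sub0r normrN; exact: ler_norm.
Qed.

(* Testing with all events B turns a bound in expectation into an almost sure one. The
   approximations only converge after integration over B, so the pathwise bound is obtained
   for infinitely many j, up to an arbitrary p.+1%:R^-1. *)
Lemma occupation_bound chi K Y (N : nat -> nat) (J : nat) (U : Omega -> R) (a b : R) :
  0 <= b -> 0 <= K ->
  (forall p, 0 <= chi p <= 1) -> (forall p q, `|chi p - chi q| <= K * `|p - q|) ->
  L2_continuous P T Y -> (forall j, (0 < N j)%N) ->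
  (forall j s s', (J <= j)%N -> 0 <= s <= T -> 0 <= s' <= T ->
     `|s - s'| <= 2 * (T / (N j)%:R) -> hnrm2 P (fun w => Y s w - Y s' w) <= (4 ^ j)%:R^-1) ->
  P.-integrable setT (EFin \o U) ->
  (forall B, measurable B -> \int[P]_w (\1_B w * U w) <=
     a * \int[P]_w (\1_B w) + b * \int[leb]_(s in `[0, T]) \int[P]_w (\1_B w * chi (Y s w))) ->
  {ae P, forall w, forall m p, exists2 j, (m <= j)%N &
     U w <= a + b * occupation chi Y (N j) w + p.+1%:R^-1}.
Proof.
move=> b0 K0 chi01 chiK hY N0 hN iU hB.
have [Y1 _] := hY.
apply: ae_foralln => m; apply: ae_foralln => p.
have mocc j : measurable_fun setT (occupation chi Y (N j)).
  apply: measurable_sum => i; apply: measurable_funM => //.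
  by apply: (lipschitz_observable_measurable chiK); apply: Y1; apply: knot_itv => //; exact: ltnW.
have mU : measurable_fun setT U by have /integrableP[/measurable_EFinP] := iU.
pose eta : R := p.+1%:R^-1.
(* The event where the bound fails for every j >= m. Integrating the failure over it and letting j
   grow contradicts [hB] unless eta P(E) <= 0. *)
pose E := \bigcap_(j in [set j | (m <= j)%N]) [set w | a + b * occupation chi Y (N j) w + eta < U w].
have mE : measurable E.
  apply: bigcap_measurable => [|j _]; first by exists m => /=.
  have mf : measurable_fun setT (fun w => a + b * occupation chi Y (N j) w + eta).
    by apply: measurable_funD => //; apply: measurable_funD => //; exact: measurable_funM.
  have := measurable_fun_ltr mf mU; rewrite -[X in measurable X]setTI => /(_ measurableT [set true]).
  by rewrite /preimage /= => h; exact: h.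
have PE0 : \int[P]_w (\1_E w) <= 0.
  have iE := indic_integrable P mE.
  have cv := occupation_cvg mE K0 chi01 chiK hY N0 hN.
  set l := Rintegral _ _ _ in cv; set q := \int[P]_w _.
  have lowj j : (m <= j)%N -> a * q + b * (\int[P]_w (\1_E w * occupation chi Y (N j) w)) + eta * q
      <= \int[P]_w (\1_E w * U w).
    move=> mj; have [io _] := occupation_integrable mE chi01 chiK hY (N0 j).
    have i1 := integrableR_Z measurableT a iE.
    have i2 := integrableR_Z measurableT b io.
    have i3 := integrableR_Z measurableT eta iE.
    have i12 := integrableR_D measurableT i1 i2.
    rewrite /q -!RintegralZl// -RintegralD// -RintegralD//.
    have i123 := integrableR_D measurableT i12 i3.
    have iEU : P.-integrable setT (EFin \o (fun w => \1_E w * U w)).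
      apply: (le_integrable _ _ _ iU) => //.
        by apply/measurable_EFinP; apply: measurable_funM => //; exact: measurable_indic.
      move=> w _ /=; rewrite lee_fin normrM ler_piMl// indicE.
      by case: (_ \in _); rewrite ?normr1 ?normr0.
    apply: le_Rintegral => // w _.
    rewrite indicE; case: (boolP (w \in E)) => [|_]; last by rewrite !mul0r !mulr0 !addr0.
    rewrite inE => /(_ j mj) /= /ltW; by rewrite !mul1r !mulr1.
  have lim1 : (fun j => a * q + b * (\int[P]_w (\1_E w * occupation chi Y (N j) w)) + eta * q) @ \oo
      --> a * q + b * l + eta * q.
    apply: cvgD; last exact: cvg_cst.
    by apply: cvgD; [exact: cvg_cst|apply: cvgM; [exact: cvg_cst|exact: cv]].
  have low : a * q + b * l + eta * q <= \int[P]_w (\1_E w * U w).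
    by apply: (cvgr_le_of_near lim1); exists m.
  have up := hB E mE.
  have : eta * q <= 0 by rewrite -/q -/l in up; lra.
  by rewrite pmulr_rle0// invr_gt0.
have iE := indic_integrable P mE.
have : {ae P, forall w, \1_E w <= 0 :> R}.
  apply: ae_le_of_indic => // [|B mB]; first exact: integrable0.
  have -> : \int[P]_w (\1_B w * 0) = 0 :> R.
    by under eq_Rintegral do rewrite mulr0; rewrite Rintegral_cst// mul0r.
  apply: le_trans PE0; apply: le_Rintegral => //.
    by have := indic_integrable P (measurableI _ _ mB mE); rewrite indicI; exact.
  move=> w _; rewrite ler_piMl ?indic_ge0// indicE; by case: (_ \in _).
apply: ae_mono => w; rewrite indicE; case: (boolP (w \in E)) => [_|wE _].
  by rewrite ler10.
apply: contrapT => hno; move/negP: wE; apply; rewrite inE => j /= mj; rewrite ltNge.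
by apply/negP => hle; apply: hno; exists j.
Qed.

End step_paths.

(** * Second differences at a fixed sample point *)

Section pathwise.
Context d (Omega : measurableType d) (R : realType).
Local Notation H := (Hper R).
Local Notation leb := (@lebesgue_measure R).
Variables (T : R) (T0 : 0 <= T) (F : H -> H) (hF : C1_bounded_derivative F).
Variables (Y : nat -> R -> Omega -> H) (w : Omega) (D : nat -> H) (N : nat -> nat) (c C : R).
Hypothesis (c0 : 0 <= c) (C0 : 0 <= C) (N0 : forall j, (0 < N j)%N).
Hypothesis Y_lip : forall j i m n, (i <= N j)%N ->
  `|Y m (knot T (N j) i) w - Y n (knot T (N j) i) w| <= c * `|D m - D n|.
Hypothesis Y_cvg : forall m, {ae leb, forall s, 0 <= s < T -> cvgn (fun j => step T (N j) (Y m) s w)}.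

Let delta (k : nat) : R := k.+1%:R^-1.
Let delta_gt0 k : 0 < delta k. Proof. by rewrite invr_gt0. Qed.

Let delta_ex (e : R) : 0 < e -> exists i, forall k, (i <= k)%N -> delta k < e.
Proof.
move=> e0; have B := @archi_boundP R e^-1; rewrite invr_ge0 (ltW e0) in B.
exists (Num.bound e^-1) => k ik; rewrite /delta -[e]invrK ltf_pV2 ?posrE ?invr_gt0//.
by rewrite (lt_le_trans (B isT))// ler_nat (leq_trans ik).
Qed.

Section sequence.
Variables (e : R) (x : H) (m j : nat -> nat).
Hypothesis (e0 : 0 < e) (jk : forall k, (k <= j k)%N).
Hypothesis mx : forall k, c * `|D (m k) - x| <= delta k.

Let step_lip s k a b : 0 <= s < T ->
  `|step T (N k) (Y a) s w - step T (N k) (Y b) s w| <= c * `|D a - D b|.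
Proof.
move=> sT; have [i iN ci] := cell_exists (N0 k) sT.
rewrite /step (cell_sum T0 (fun i => Y a (knot T (N k) i) w) iN ci).
rewrite (cell_sum T0 (fun i => Y b (knot T (N k) i) w) iN ci).
by apply: Y_lip; exact: ltnW.
Qed.

(** For a fixed i the step path from D (m i) converges, and by the Lipschitz bound the moving path
    is eventually within delta i + delta k of it, uniformly over the meshes; so the diagonal
    sequence is Cauchy. *)
Let diag_cvg s : 0 <= s < T -> (forall a, cvgn (fun j => step T (N j) (Y a) s w)) ->
  cvgn (fun k => step T (N (j k)) (Y (m k)) s w).
Proof.
move=> sT hs; apply: (@Hper_complete R); apply: cauchy_exP => eps eps0.
have e4 : 0 < eps / 4 by rewrite divr_gt0.
have [i hi] := delta_ex e4.
have /cvg_ex[l hl] := hs (m i).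
have e2 : 0 < eps / 2 by rewrite divr_gt0.
move/cvgrPdist_lt : hl => /(_ _ e2)[K _ hK].
exists l; exists (maxn i K) => // k /=; rewrite geq_max => /andP[ik Kk].
rewrite -ball_normE /= -(subrKA (step T (N (j k)) (Y (m i)) s w)).
rewrite (le_lt_trans (ler_normD _ _))// (splitr eps) ltr_leD//.
  by apply: hK => /=; rewrite (leq_trans Kk).
rewrite (le_trans (step_lip _ _ _ sT))//.
have : c * `|D (m i) - D (m k)| <= c * `|D (m i) - x| + c * `|D (m k) - x|.
  by rewrite -mulrDr ler_wpM2l// -(subrKA x) (le_trans (ler_normD _ _))// (distrC x).
have := mx i; have := mx k; have := hi i (leqnn _); have := hi k ik.
rewrite (splitr (eps / 2)) -mulrA -invfM -natrM /=; lra.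
Qed.

(** At the limit z of the diagonal sequence the oscillation radius is a fixed positive number. As
    the radius is 1-Lipschitz, it eventually exceeds 2 delta k along the sequence, where the cutoff
    is 0; dominated convergence in s concludes. *)
Lemma occupation_cvg0 :
  (fun k => occupation T (osc_cutoff F e (delta k)) (Y (m k)) (N (j k)) w) @ \oo --> (0 : R).
Proof.
have [F_diff F_C1 _] := hF.
pose h k s := \sum_(i < N (j k)) \1_(cell T (N (j k)) i) s *
  osc_cutoff F e (delta k) (Y (m k) (knot T (N (j k)) i) w).
have hmesh k := Rintegral_mesh T0 (N (j k))
  (fun i => osc_cutoff F e (delta k) (Y (m k) (knot T (N (j k)) i) w)).
have hout k s : ~ (0 <= s < T) -> h k s = 0.
  by move=> sT; exact: (@cell_sum0 R T T0 _ s (fun i => osc_cutoff F e (delta k) (Y (m k) (knot T (N (j k)) i) w)) sT).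
have hin k s : 0 <= s < T -> h k s = osc_cutoff F e (delta k) (step T (N (j k)) (Y (m k)) s w).
  move=> sT; have [i iN ci] := cell_exists (N0 (j k)) sT.
  rewrite /step (cell_sum T0 (fun i => Y (m k) (knot T (N (j k)) i) w) iN ci).
  exact: (cell_sumR T0 (fun i => osc_cutoff F e (delta k) (Y (m k) (knot T (N (j k)) i) w)) iN ci).
have occE k : occupation T (osc_cutoff F e (delta k)) (Y (m k)) (N (j k)) w = \int[leb]_s h k s.
  rewrite /occupation -(hmesh k).2 [RHS]/Rintegral.
  rewrite (integral_supported (hmesh k).1)// => s sT; apply: hout => /andP[s0 sT'].
  by apply: sT; rewrite s0 ltW.
have -> : (fun k => occupation T (osc_cutoff F e (delta k)) (Y (m k)) (N (j k)) w) =
    (fun k => \int[leb]_s h k s) by apply/funext => k; exact: occE.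
have h01 k s : 0 <= h k s <= \1_(`[0, T]%classic) s.
  have [sT|sT] := pselect (0 <= s < T); last by rewrite hout// indicE lexx /=.
  rewrite hin// indicE mem_set/=; first exact: osc_cutoff01.
  by case/andP: sT => s0 sT; rewrite in_itv /= s0 ltW.
have mD : measurable (`[0, T] : set R) by exact: measurable_itv.
have fD : (leb `[0%R, T]%classic < +oo)%E.
  by rewrite lebesgue_measure_itv /= lte_fin; case: ifP => _; rewrite ?ltry// lte_fin.
have dcv := @Rintegral_dominated_cvg _ _ _ leb h (fun=> 0) (\1_(`[0, T]%classic)).
have int0 : \int[leb]_s (0 : R) = 0 by rewrite /Rintegral integral0_eq.
suff : (fun k => \int[leb]_s h k s) @ \oo --> \int[leb]_s (0 : R) by rewrite int0.
apply: (dcv _ _ _ _ _).2.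
- move=> k; apply: measurable_sum => i; apply: measurable_funM.
    by apply: measurable_indic; exact: measurable_cell.
  exact: measurable_cst.
- exact: measurable_cst.
- have : {ae leb, forall s a, 0 <= s < T -> cvgn (fun j => step T (N j) (Y a) s w)}.
    by apply: ae_foralln => a; exact: Y_cvg.
  apply: ae_mono => s hs.
  have [sT|sT] := pselect (0 <= s < T); last first.
    by under eq_fun do rewrite hout//; exact: cvg_cst.
  have /cvg_ex[z hz] := diag_cvg sT (fun a => hs a sT).
  under eq_fun do rewrite hin//.
  have r0 : 0 < osc_radius F e z := osc_radius_gt0 F_diff F_C1 z e0.
  have r2 : 0 < osc_radius F e z / 2 by rewrite divr_gt0.
  have r4 : 0 < osc_radius F e z / 4 by rewrite divr_gt0.
  have [i hi] := delta_ex r4.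
  move/cvgrPdist_lt : hz => /(_ _ r2)[K _ hK].
  apply: cvg_near_cst; exists (maxn i K) => // k /=; rewrite geq_max => /andP[ik Kk].
  apply: osc_cutoff0; first exact: delta_gt0.
  have := hi k ik; have := hK k Kk => /= h1 h2.
  have := osc_radius_sub F e z (step T (N (j k)) (Y (m k)) s w); lra.
- apply/integrableP; split; first by apply/measurable_EFinP; exact: measurable_indic.
  under eq_integral do rewrite /= ger0_norm//.
  by rewrite integral_indic// setIT.
- apply: (ae_mono (P := setT)); last by apply: filterE.
  by move=> s _ k; have /andP[a b] := h01 k s; rewrite ger0_norm.
Qed.

End sequence.

Variable f : nat -> H.
Hypothesis f_lip : forall m n, `|f m - f n| <= c * `|D m - D n|.
Hypothesis f_occ : forall q k m n l a b, D a = D m + D l -> D b = D n + D l ->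
  c * (`|D l| + `|D m - D n|) <= delta k -> forall J p, exists2 j, (J <= j)%N &
  `|f a - f m - (f b - f n)| ^+ 2 <= C * (c * `|D l|) ^+ 2 * delta q ^+ 2 +
    C * (c * `|D l|) ^+ 2 * occupation T (osc_cutoff F (delta q) (delta k)) (Y m) (N j) w + delta p.

(* By contradiction: step paths started from violating data converge, for almost every s, to a
   point where the derivative of the drift is continuous, so their occupation integrals vanish. *)
Lemma second_diff_small (x : H) (e : R) : 0 < e -> exists2 r, 0 < r &
  forall m n l a b, `|D m - x| < r -> `|D n - x| < r -> `|D l| < r ->
    D a = D m + D l -> D b = D n + D l ->
    `|f a - f m - (f b - f n)| <= e * `|D l|.
Proof.
move=> e0; apply: contrapT => hno.
have c1 : 0 < 3 * c + 1 by rewrite ltr_wpDl// mulr_ge0.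
(* |D l| is below r k and |D m - D n| below 2 r k, which gives the factor 3 in the constraint of
   [f_occ]. *)
pose r k := delta k / (3 * c + 1).
have r0 k : 0 < r k by rewrite divr_gt0.
have rc k : c * (3 * r k) <= delta k.
  rewrite /r mulrA mulrA ler_pdivrMr//; have := delta_gt0 k; nra.
have /choice[v hv] (k : nat) : exists v : nat * nat * nat * nat * nat,
   let: (m, n, l, a, b) := v in [/\ `|D m - x| < r k, `|D n - x| < r k & `|D l| < r k] /\
    [/\ D a = D m + D l, D b = D n + D l & e * `|D l| < `|f a - f m - (f b - f n)|].
  apply: contrapT => hk; apply: hno; exists (r k) => // m n l a b h1 h2 h3 h4 h5.
  by rewrite leNgt; apply/negP => h6; apply: hk; exists (m, n, l, a, b).
pose A := C * c ^+ 2; have A0 : 0 <= A by rewrite mulr_ge0// sqr_ge0.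
have ee : 0 < e ^+ 2 / 4 / (A + 1) by rewrite !divr_gt0 ?exprn_gt0// ltr_wpDl.
have [q hq] := delta_ex ee.
have Aq : A * delta q ^+ 2 <= e ^+ 2 / 4.
  have q1 : delta q <= 1 by rewrite invf_le1// ler1n.
  have h1 : delta q ^+ 2 <= delta q by rewrite expr2 ler_piMr// ltW.
  have := hq q (leqnn _); rewrite ltr_pdivlMr ?ltr_wpDl// => h2.
  have := delta_gt0 q; nra.
pose m k := (v k).1.1.1.1.
(* After division by |D l|^2 the violation exceeds e^2. One quarter is spent on the term with delta
   q and one on delta p; the remaining half must come from the occupation integral, for every k. *)
have /choice[j hj] (k : nat) : exists j, (k <= j)%N /\
   e ^+ 2 / 2 <= A * occupation T (osc_cutoff F (delta q) (delta k)) (Y (m k)) (N j) w.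
  rewrite /m; case: (v k) (hv k) => -[[[mk n] l] a] b /= [[h1 h2 h3] [h4 h5 h6]].
  have l0 : 0 < `|D l|.
    rewrite lt_neqAle normr_ge0 andbT eq_sym; apply/eqP => l0.
    move: h6; rewrite l0 mulr0; apply/negP; rewrite -leNgt.
    have z : D l = 0 by apply/eqP; rewrite -normr_eq0 l0.
    (* D may take a value at several indices: [f_lip] shows that f agrees at a and mk, and at b and
       n. *)
    have fa := f_lip a mk; have fb := f_lip b n.
    rewrite h4 z addr0 subrr normr0 mulr0 in fa; rewrite h5 z addr0 subrr normr0 mulr0 in fb.
    by rewrite (le_trans (ler_normB _ _))// -(addr0 0) lerD.
  have hd : c * (`|D l| + `|D mk - D n|) <= delta k.
    apply: le_trans (rc k); rewrite ler_wpM2l//.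
    have : `|D mk - D n| <= `|D mk - x| + `|D n - x|.
      by rewrite -(subrKA x) (le_trans (ler_normD _ _))// (distrC x).
    lra.
  have e4 : 0 < e ^+ 2 / 4 * `|D l| ^+ 2 by rewrite mulr_gt0// ?divr_gt0// exprn_gt0.
  have [p hp] := delta_ex e4.
  have [j kj hle] := f_occ q h4 h5 hd k p.
  exists j; split => //.
  have sq : (e * `|D l|) ^+ 2 < `|f a - f mk - (f b - f n)| ^+ 2.
    by rewrite ltrXn2r ?nnegrE// mulr_ge0// ltW.
  have l2 : 0 < `|D l| ^+ 2 by rewrite exprn_gt0.
  set O := occupation _ _ _ _ _ in hle *.
  have := hp p (leqnn _).
  have E1 y : C * (c * `|D l|) ^+ 2 * y = `|D l| ^+ 2 * (A * y) by rewrite /A; ring.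
  rewrite !E1 in hle; rewrite exprMn in sq => hp'.
  have k1 : `|D l| ^+ 2 * (A * delta q ^+ 2) <= `|D l| ^+ 2 * (e ^+ 2 / 4).
    by rewrite ler_wpM2l// ltW.
  rewrite -(ler_pM2l l2); lra.
have jk k : (k <= j k)%N := (hj k).1.
have mx k : c * `|D (m k) - x| <= delta k.
  apply: le_trans (rc k); rewrite ler_wpM2l//; rewrite /m.
  have := r0 k; case: (v k) (hv k) => -[[[mk n] l] a] b /= [[h1 _ _] _]; lra.
have cv := occupation_cvg0 (delta_gt0 q) jk mx.
have cvA : (fun k => A * occupation T (osc_cutoff F (delta q) (delta k)) (Y (m k)) (N (j k)) w) @ \oo
    --> A * 0 by apply: cvgM; [exact: cvg_cst|exact: cv].
rewrite mulr0 in cvA.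
have e2 : 0 < e ^+ 2 / 2 by rewrite divr_gt0// exprn_gt0.
move/cvgrPdist_lt : cvA => /(_ _ e2)[K _ hK].
have := hK K (leqnn _); rewrite /= sub0r normrN; apply/negP; rewrite -leNgt.
exact: le_trans (hj K).2 (ler_norm _).
Qed.

End pathwise.

(** * The differentiable version *)

(** Second differences with three corners in D must have the fourth in D. Points are sums over
    finite lists of indices, and concatenating lists adds them. *)
Lemma dense_additive (R : realType) : exists D : nat -> Hper R,
  (forall (x : Hper R) (e : R), 0 < e -> exists n, `|x - D n| < e) /\
  forall m n, exists l, D l = D m + D n.
Proof.
have [D0 hD0] := Hper_separable R.
pose c (s : seq nat) : Hper R := \sum_(i <- s) D0 i.
pose lst n : seq nat := odflt [::] (unpickle n).
pose D n := c (lst n).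
have Dc s : D (pickle s) = c s by rewrite /D /lst pickleK.
exists D; split=> [x e e0|m n].
  have [n hn] := hD0 x e e0; exists (pickle [:: n]).
  by rewrite Dc /c big_seq1.
exists (pickle (lst m ++ lst n)).
by rewrite Dc /c big_cat.
Qed.

Section flow.
Context d (Omega : measurableType d) (R : realType) (P : probability Omega R).
Local Notation H := (Hper R).
Local Notation leb := (@lebesgue_measure R).
Implicit Types (B : set Omega) (x y z h k : H).
Variables (S : R -> H -> H) (hS : C0_semigroup S)
  (hSA : has_generator S (@H2per R) (@Aop R)).
Variables (beta : nat -> R -> Omega -> R) (WA : R -> Omega -> H).
Hypothesis hWA : forall t : R, 0 <= t -> L2_rv P (WA t).
Variables (F : H -> H) (hF : C1_bounded_derivative F).
Variables (X : H -> R -> Omega -> H).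
Hypothesis hX : forall x : H, mild_solution P S beta WA F x (X x).
Variable (eta : H -> H -> R -> Omega -> H).
Hypothesis heta : forall x h : H, linearized_mild_solution P S beta F (X x) h (eta x h).

Let XL2 := X_L2_continuous hX.
Let Xrv := X_L2 hX.

Section fixed_time.
Variables (T : R) (T0 : 0 <= T).
Let c := flow_lip F T.
Let C := energy_cst F T.
Let c0 : 0 <= c. Proof. exact: expR_ge0. Qed.
Let C0 : 0 <= C.
Proof. by rewrite /C /energy_cst !mulr_ge0 ?expR_ge0// addr_ge0// sqr_ge0. Qed.

Variable D : nat -> H.
Hypothesis D_dense : forall x (e : R), 0 < e -> exists n, `|x - D n| < e.
Hypothesis D_add : forall m n, exists l, D l = D m + D n.

(** When D is dense these conditions determine phi; this is why later results may quantify over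
    every phi that satisfies them. *)
Definition flow_spec (w : Omega) (phi : H -> H) : Prop :=
  [/\ forall m, phi (D m) = X (D m) T w,
      forall x y, `|phi x - phi y| <= c * `|x - y| &
      forall x, differentiable phi x].

(** All conditions imposed on w are indexed by natural numbers, coding meshes, starting points and
    tolerances, so that their null sets can be united; arbitrary points of H enter only afterwards,
    by extension. *)
Lemma flow_ae : {ae P, forall w, exists phi, flow_spec w phi}.
Proof.
have [N [N0 Nmono hN]] := common_refinement T0 (fun i => XL2 (D i) T).
have lip : {ae P, forall w, forall j i m n, (i <= N j)%N ->
    `|X (D m) (knot T (N j) i) w - X (D n) (knot T (N j) i) w| <= c * `|D m - D n|}.
  apply: ae_foralln => j; apply: ae_foralln => i; apply: ae_foralln => m; apply: ae_foralln => n.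
  case: (leqP i (N j)) => [ij|_]; last first.
    by apply: (ae_mono (P := setT)); last exact: filterE.
  have := X_lipschitz_le hS hSA hWA hF hX (D m) (D n) (knot_itv T0 (N0 j) ij).
  by apply: ae_mono => w hw _.
have cvs : {ae P, forall w, forall m,
    {ae leb, forall s, 0 <= s < T -> cvgn (fun j => step T (N j) (X (D m)) s w)}}.
  apply: ae_foralln => m; apply: (step_cvg_ae T0 (XL2 (D m) T) N0 Nmono (J := m)).
  by move=> j s s' mj; exact: hN.
have occ : {ae P, forall w, forall q k m n l a b : nat, D a = D m + D l -> D b = D n + D l ->
  c * (`|D l| + `|D m - D n|) <= k.+1%:R^-1 -> forall J p : nat, exists2 j, (J <= j)%N &
  `|X (D a) T w - X (D m) T w - (X (D b) T w - X (D n) T w)| ^+ 2 <=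
    C * (c * `|D l|) ^+ 2 * q.+1%:R^-1 ^+ 2 + C * (c * `|D l|) ^+ 2 *
      occupation T (osc_cutoff F q.+1%:R^-1 k.+1%:R^-1) (X (D m)) (N j) w + p.+1%:R^-1}.
  apply: ae_foralln => q; apply: ae_foralln => k; apply: ae_foralln => m.
  apply: ae_foralln => n; apply: ae_foralln => l; apply: ae_foralln => a; apply: ae_foralln => b.
  (* The premises do not involve w, so they are decided before the almost sure statement is
     proved. *)
  have [[ha [hb hd]]|hno] := pselect (D a = D m + D l /\ D b = D n + D l /\
      c * (`|D l| + `|D m - D n|) <= k.+1%:R^-1); last first.
    apply: (ae_mono (P := setT)); last exact: filterE.
    by move=> w _ ha hb hd; exfalso; exact: hno.
  pose U w := `|X (D a) T w - X (D m) T w - (X (D b) T w - X (D n) T w)| ^+ 2.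
  have q0 : 0 < q.+1%:R^-1 :> R by rewrite invr_gt0.
  have k0 : 0 < k.+1%:R^-1 :> R by rewrite invr_gt0.
  have iU : P.-integrable setT (EFin \o U).
    have L2 : L2_rv P (fun w => X (D a) T w - X (D m) T w - (X (D b) T w - X (D n) T w)).
      by apply: L2_rvB; apply: L2_rvB; exact: Xrv.
    by have [_] := (Lfun2P _ _).1 (L2_rv_nrm L2).
  have ki : 0 <= (k.+1%:R^-1)^-1 :> R by rewrite invrK.
  have M0 : 0 <= C * (c * `|D l|) ^+ 2 by rewrite mulr_ge0// sqr_ge0.
  have hB B : measurable B -> \int[P]_w (\1_B w * U w) <=
      C * (c * `|D l|) ^+ 2 * q.+1%:R^-1 ^+ 2 * \int[P]_w (\1_B w) +
      C * (c * `|D l|) ^+ 2 * \int[leb]_(s in `[0, T]) \int[P]_w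
        (\1_B w * osc_cutoff F q.+1%:R^-1 k.+1%:R^-1 (X (D m) s w)).
    move=> mB.
    have := second_diff_energy hS hSA hWA hF hX (z := D n) mB T0 q0 k0 hd.
    rewrite -ha -hb mulrDr mulrA; exact.
  have := occupation_bound T0 M0 ki (osc_cutoff01 F _ _)
    (fun u v => osc_cutoff_lipschitz F _ u v k0) (XL2 (D m) T) N0 (J := m)
    (fun j s s' mj => hN m j s s' mj) iU hB.
  apply: ae_mono => w hw _ _ _ J p; exact: hw.
apply: (filterS3 _ _ lip cvs occ) => w lipw cvw occw.
(* The last knot of any mesh is T, so the bound at knots covers the final time. *)
have lipT m n : `|X (D m) T w - X (D n) T w| <= c * `|D m - D n|.
  by have := lipw 0%N (N 0%N) m n (leqnn _); rewrite (knot_max _ (N0 0%N)).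
have strict := second_diff_small T0 hF c0 C0 N0 lipw cvw lipT occw.
by have [phi hphi] := differentiable_extension (@Hper_complete R) D_dense c0 lipT D_add strict;
  exists phi.
Qed.

(** Both phi and X are almost surely Lipschitz between x and all the D m, and they agree on D. The
    null set depends on x, which is why the flow is a version of X and not X itself. *)
Lemma flow_spec_eq x : {ae P, forall w, forall phi, flow_spec w phi -> phi x = X x T w}.
Proof.
have : {ae P, forall w, forall m, `|X x T w - X (D m) T w| <= c * `|x - D m|}.
  apply: ae_foralln => m; apply: (X_lipschitz_le hS hSA hWA hF hX).
  by rewrite T0 lexx.
apply: ae_mono => w hw phi [phiD phi_lip _].
apply/eqP; rewrite -subr_eq0 -normr_eq0 eq_le normr_ge0 andbT.
apply/ler_addgt0Pl => e e0; rewrite addr0.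
have c1 : 0 < 2 * c + 1 by rewrite ltr_wpDl// mulr_ge0.
have ce : 0 < e / (2 * c + 1) by rewrite divr_gt0.
have [m hm] := D_dense x ce.
rewrite -(subrKA (X (D m) T w)) (le_trans (ler_normD _ _))//.
have h1 := phi_lip x (D m); rewrite phiD in h1.
have h2 := hw m; rewrite distrC in h2.
apply: (le_trans (lerD h1 h2)).
apply: (@le_trans _ _ ((2 * c + 1) * `|x - D m|)).
  by rewrite -mulrDl ler_wpM2r//; lra.
by rewrite mulrC -ler_pdivlMr// ltW.
Qed.

End fixed_time.

(** Here the starting point is fixed and only a mean is required, so no step paths are involved: for
    each s and w the cutoff vanishes as soon as 2 / (r + 1) is below the oscillation radius at X,
    and dominated convergence is applied in w and then in s. *)
Lemma cutoff_integral_cvg0 x (T e : R) : 0 <= T -> 0 < e ->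
  (fun r : nat => \int[leb]_(s in `[0, T]) \int[P]_w
     (\1_[set: Omega] w * osc_cutoff F e r.+1%:R^-1 (X x s w))) @ \oo --> (0 : R).
Proof.
move=> T0 e0; have [F_diff F_C1 _] := hF.
have d0 r : 0 < r.+1%:R^-1 :> R by rewrite invr_gt0.
pose g r s := \int[P]_w (\1_[set: Omega] w * osc_cutoff F e r.+1%:R^-1 (X x s w)).
have mg r s : 0 <= s -> P.-integrable setT (EFin \o (fun w => \1_[set: Omega] w * osc_cutoff F e r.+1%:R^-1 (X x s w))).
  move=> s0; exact: (indic_lipschitz_integrable (osc_cutoff01 F _ _)
    (fun u v => osc_cutoff_lipschitz F _ u v (d0 r)) measurableT (Xrv x s0)).
have gcv s : 0 <= s -> (fun r => g r s) @ \oo --> (0 : R).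
  move=> s0; have int0 : \int[P]_w (0 : R) = 0 by rewrite /Rintegral integral0_eq.
  suff : (fun r => g r s) @ \oo --> \int[P]_w (0 : R) by rewrite int0.
  have dcv := @Rintegral_dominated_cvg _ _ _ P
    (fun r w => \1_[set: Omega] w * osc_cutoff F e r.+1%:R^-1 (X x s w)) (fun=> 0) (fun=> 1).
  apply: (dcv _ _ _ _ _).2.
  - by move=> r; have /integrableP[/measurable_EFinP] := mg r s s0.
  - exact: measurable_cst.
  - apply: (ae_mono (P := setT)); last exact: filterE.
    move=> w _; have r0 := osc_radius_gt0 F_diff F_C1 (X x s w) e0.
    apply: cvg_near_cst.
    have r2 : 0 < osc_radius F e (X x s w) / 2 by rewrite divr_gt0.
    near=> r; rewrite osc_cutoff0 ?mulr0//.
    rewrite mulrC -ler_pdivlMr//; apply: ltW; near: r.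
    exact: near_infty_natSinv_lt (PosNum r2).
  - by have [_] := (Lfun2P _ _).1 (Lfun2_cst P 1); under eq_fun do rewrite expr1n.
  - apply: (ae_mono (P := setT)); last exact: filterE.
    move=> w _ r; have /andP[a b] := osc_cutoff01 F e r.+1%:R^-1 (X x s w).
    by rewrite indicE in_setT mul1r ger0_norm.
have g01 r s : 0 <= s -> 0 <= g r s <= 1.
  move=> s0; apply/andP; split.
    apply: Rintegral_ge0 => w _; rewrite mulr_ge0 ?indic_ge0//.
    by case/andP: (osc_cutoff01 F e r.+1%:R^-1 (X x s w)).
  have i1 : P.-integrable setT (EFin \o (\1_[set: Omega] : Omega -> R)) by exact: indic_integrable.
  apply: (@le_trans _ _ (\int[P]_w (\1_[set: Omega] w))).
    apply: le_Rintegral => //; first exact: mg.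
    move=> w _; rewrite ler_piMr ?indic_ge0//.
    by case/andP: (osc_cutoff01 F e r.+1%:R^-1 (X x s w)).
  rewrite /Rintegral integral_indic// setIT.
  by have -> : fine (P [set: Omega]) = 1 by exact: (congr1 fine (@probability_setT _ _ _ P)).
have mD : measurable (`[0, T] : set R) by exact: measurable_itv.
have ig r : leb.-integrable `[0, T] (EFin \o g r).
  apply: within_integrable.
  exact: (cutoff_continuous hX (T := T) (e := e) (x := x) measurableT (d0 r)).
have fD : (leb `[0%R, T]%classic < +oo)%E.
  by rewrite lebesgue_measure_itv /= lte_fin; case: ifP => _; rewrite ?ltry// lte_fin.
pose h r := g r \_ `[0, T]%classic.
have hE r : \int[leb]_(s in `[0, T]) g r s = \int[leb]_s h r s.
  rewrite /Rintegral integral_mkcond; congr fine; apply: eq_integral => s _.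
  by rewrite /h !patchE; case: ifP.
have int0 : \int[leb]_s (0 : R) = 0 by rewrite /Rintegral integral0_eq.
have -> : (fun r : nat => \int[leb]_(s in `[0, T]) g r s) = (fun r => \int[leb]_s h r s).
  by apply/funext => r; exact: hE.
suff : (fun r => \int[leb]_s h r s) @ \oo --> \int[leb]_s (0 : R) by rewrite int0.
have dcv := @Rintegral_dominated_cvg _ _ _ leb h (fun=> 0) (\1_(`[0, T]%classic)).
apply: (dcv _ _ _ _ _).2.
- move=> r; apply/(measurable_restrictT _ mD).
  by have /integrableP[/measurable_EFinP] := ig r.
- exact: measurable_cst.
- apply: (ae_mono (P := setT)); last exact: filterE.
  move=> s _; rewrite /h; have [sD|sD] := boolP (s \in `[0, T]%classic); last first.
    by under eq_fun do rewrite patchE (negbTE sD); exact: cvg_cst.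
  under eq_fun do rewrite patchE sD; apply: gcv.
  by move: sD; rewrite inE /= in_itv /= => /andP[].
- apply/integrableP; split; first by apply/measurable_EFinP; exact: measurable_indic.
  under eq_integral do rewrite /= ger0_norm//.
  by rewrite integral_indic// setIT.
- apply: (ae_mono (P := setT)); last exact: filterE.
  move=> s _ r; rewrite /h patchE indicE; case: ifPn => sD /=; last by rewrite normr0.
  have s0 : 0 <= s by move: sD; rewrite inE /= in_itv /= => /andP[].
  by have /andP[a b] := g01 r s s0; rewrite ger0_norm.
Unshelve. all: by end_near. Qed.

(** The tolerance e is fixed first, to make A e^2 small; then r, to make the cutoff integral small;
    then n, so large that the paths from x and x + h / n stay within 1 / (r + 1). *)
Lemma difference_quotient_cvg x h (T eps : R) : 0 <= T -> 0 < eps -> exists n0, forall n, (n0 <= n)%N ->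
  \int[P]_w (`|n.+1%:R *: (X (x + n.+1%:R^-1 *: h) T w - X x T w) - eta x h T w| ^+ 2) <= eps.
Proof.
move=> T0 eps0.
pose A := energy_cst F T * (flow_lip F T * `|h|) ^+ 2.
have A0 : 0 <= A.
  by rewrite mulr_ge0 ?sqr_ge0// /energy_cst !mulr_ge0 ?expR_ge0// addr_ge0// sqr_ge0.
have A1 : 0 < A + 1 by rewrite ltr_wpDl.
pose e := Num.min 1 (eps / 2 / (A + 1)).
have e0 : 0 < e by rewrite lt_min ltr01 !divr_gt0.
have Ae : A * e ^+ 2 <= eps / 2.
  have e1 : e <= 1 by rewrite ge_min lexx.
  have e2 : e <= eps / 2 / (A + 1) by rewrite ge_min lexx orbT.
  rewrite ler_pdivlMr// in e2.
  have : e ^+ 2 <= e by rewrite expr2 ler_piMr// ltW.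
  nra.
have e2 : 0 < eps / 2 / (A + 1) by rewrite !divr_gt0.
have := cutoff_integral_cvg0 x T0 e0 => /cvgrPdist_le/(_ _ e2)[r _ /(_ r (leqnn _))].
rewrite /= sub0r normrN; set Q := Rintegral _ _ _ => hQ.
have AQ : A * Q <= eps / 2.
  have := ler_norm Q; have := normr_ge0 Q; rewrite ler_pdivlMr// in hQ; nra.
have d0 : 0 < r.+1%:R^-1 :> R by rewrite invr_gt0.
have B := @archi_boundP R (flow_lip F T * `|h| * r.+1%:R).
rewrite !mulr_ge0 ?expR_ge0// in B.
exists (Num.bound (flow_lip F T * `|h| * r.+1%:R)) => n hn.
have n0 : 0 < n.+1%:R :> R by [].
have hd : flow_lip F T * `|h| / n.+1%:R <= r.+1%:R^-1.
  rewrite ler_pdivrMr// ler_pdivlMl// mulrC ltW//.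
  by rewrite (lt_le_trans (B isT))// ler_nat (leq_trans hn).
have := first_diff_energy hS hSA hWA hF hX heta x (h := h) measurableT T0 e0 d0 n0 hd.
rewrite -/A -/Q.
have -> : \int[P]_w (\1_[set: Omega] w) = 1 :> R.
  rewrite /Rintegral integral_indic// setIT; exact: (congr1 fine (@probability_setT _ _ _ P)).
under eq_Rintegral do rewrite indicE in_setT mul1r.
move/le_trans; apply; rewrite mulr1 mulrDr (splitr eps); exact: lerD.
Qed.

(** The difference quotients of X converge to eta in mean square, hence almost surely along fast
    indices; those of the differentiable map phi converge to its derivative, and both sequences
    coincide almost surely. *)
Lemma flow_derivative (D : nat -> H) x h (T : R) : 0 <= T ->
  (forall x (e : R), 0 < e -> exists n, `|x - D n| < e) ->
  {ae P, forall w, forall phi, flow_spec T D w phi -> 'd phi x h = eta x h T w}.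
Proof.
move=> T0 D_dense.
have e0 j : 0 < (2 ^ j.+1)%:R^-1 :> R by rewrite invr_gt0 ltr0n expn_gt0.
pose r n w := n.+1%:R *: (X (x + n.+1%:R^-1 *: h) T w - X x T w) - eta x h T w.
have /choice[n hn] (j : nat) : exists n, (j <= n)%N /\ \int[P]_w (`|r n w| ^+ 2) <= (2 ^ j.+1)%:R^-1.
  have [n0 h0] := difference_quotient_cvg x h T0 (e0 j).
  by exists (maxn j n0); split; [exact: leq_maxl|apply: h0; exact: leq_maxr].
have L2r m : L2_rv P (r m).
  by apply: L2_rvB; [apply: L2_rvZ; apply: L2_rvB; exact: Xrv|exact: (eta_L2 heta)].
have ir m : P.-integrable setT (EFin \o (fun w => `|r m w| ^+ 2)).
  by have [_] := (Lfun2P _ _).1 (L2_rv_nrm (L2r m)).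
have ser : {ae P, forall w, cvgn (series (fun j => `|r (n j) w| ^+ 2))}.
  apply: (@ae_cvg_series _ _ _ P (fun j w => `|r (n j) w| ^+ 2) 1) => //.
  - by move=> j; have /integrableP[/measurable_EFinP] := ir (n j).
  - move=> j; have -> : (\int[P]_w (`|r (n j) w| ^+ 2)%:E = (\int[P]_w (`|r (n j) w| ^+ 2)%R)%:E)%E.
      by rewrite /Rintegral fineK//; exact: (integrable_fin_num measurableT (ir (n j))).
    by rewrite lee_fin div1r (hn j).2.
have eqs : {ae P, forall w, forall m phi, flow_spec T D w phi ->
    phi (x + m.+1%:R^-1 *: h) = X (x + m.+1%:R^-1 *: h) T w}.
  by apply: ae_foralln => m; apply: (flow_spec_eq T0 D_dense).
have eq0 := flow_spec_eq T0 D_dense x.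
apply: (filterS3 _ _ ser eqs eq0) => w serw eqw eqx phi hphi.
have [_ _ dphi] := hphi.
have cvd := @diff_seq_cvg R _ _ phi x h (dphi x).
(* The indices n j need not increase; n j >= j is enough. *)
have nj : n @ \oo --> \oo.
  move=> A [M _ hM]; exists M => // j /= Mj; apply: hM; exact: leq_trans Mj (hn j).1.
have cvj : (fun j => `|r (n j) w| ^+ 2) @ \oo --> `|'d phi x h - eta x h T w| ^+ 2.
  have c1 : (fun j => (n j).+1%:R *: (phi (x + (n j).+1%:R^-1 *: h) - phi x)) @ \oo --> 'd phi x h.
    exact: (cvg_comp n (fun m => m.+1%:R *: (phi (x + m.+1%:R^-1 *: h) - phi x)) nj cvd).
  have rE : (fun j => `|r (n j) w| ^+ 2) =
      (fun j => `|(n j).+1%:R *: (phi (x + (n j).+1%:R^-1 *: h) - phi x) - eta x h T w| ^+ 2).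
    by apply/funext => j; rewrite (eqw (n j) phi hphi) (eqx phi hphi).
  rewrite rE; apply: cvgM; apply: cvg_norm; apply: cvgB; try exact: c1; exact: cvg_cst.
have z : `|'d phi x h - eta x h T w| ^+ 2 = 0.
  exact: (cvg_unique (@Rhausdorff R) cvj (cvg_series_cvg_0 serw)).
by apply/eqP; rewrite -subr_eq0 -normr_eq0 -sqrf_eq0; apply/eqP.
Qed.

End flow.

Theorem theorem2 (R : realType) (d : measure_display) (Omega : measurableType d)
  (P : probability Omega R)
  (S : R -> Hper R -> Hper R)
  (hS : C0_semigroup S) (hSA : has_generator S (@H2per R) (@Aop R))
  (e : nat -> Hper R) (beta : nat -> R -> Omega -> R)
  (hW : cylindrical_wiener P e beta)
  (WA : R -> Omega -> Hper R)
  (hWA : forall t : R, 0 <= t -> is_stochastic_convolution P S e beta t (WA t))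
  (F : Hper R -> Hper R) (hF : C1_bounded_derivative F)
  (X : Hper R -> R -> Omega -> Hper R)
  (hX : forall x : Hper R, mild_solution P S beta WA F x (X x))
  (eta : Hper R -> Hper R -> R -> Omega -> Hper R)
  (heta : forall x h : Hper R,
     linearized_mild_solution P S beta F (X x) h (eta x h)) :
  exists Xv : Hper R -> R -> Omega -> Hper R,
    [/\ forall (x : Hper R) (t : R), 0 <= t ->
          {ae P, forall w : Omega, Xv x t w = X x t w},
        {ae P, forall w : Omega, forall (t : R) (x : Hper R), 0 <= t ->
          differentiable (fun y : Hper R => Xv y t w) x},
        forall (x h : Hper R) (t : R), 0 <= t ->
          {ae P, forall w : Omega,
            'd (fun y : Hper R => Xv y t w) x h = eta x h t w} &
        forall (x h : Hper R) (t : R), 0 <= t ->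
          {ae P, forall w : Omega,
            `|eta x h t w| <=
              expR ((supnorm_DF F ^+ 2 / 4 - 1) * t) * `|h|}].
Proof.
have hWA2 t : 0 <= t -> L2_rv P (WA t) by move=> /hWA[].
have [D [D_dense D_add]] := dense_additive R.
(* Where no suitable map exists the flow is the constant 0, so differentiability holds at every w, t
   and x; only the identification with X and with eta costs a null set. *)
pose flow t w : Hper R -> Hper R :=
  if pselect (exists phi, flow_spec F X t D w phi) is left ex then sval (cid ex) else cst 0.
have flowP t : 0 <= t -> {ae P, forall w, flow_spec F X t D w (flow t w)}.
  move=> t0; have A := flow_ae hS hSA hWA2 hF hX t0 D_dense D_add; move: A; apply: ae_mono => w ex.
  by rewrite /flow; case: pselect => // ex'; exact: svalP.
exists (fun x t w => flow t w x); split.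
- move=> x t t0.
  apply: filterS2 (flowP t t0) (flow_spec_eq hS hSA hWA2 hF hX t0 D_dense x) => w h1 h2.
  exact: h2.
- apply: filterE => w t x _; rewrite /flow; case: pselect => [ex|_].
    by have [_ _] := svalP (cid ex).
  exact: differentiable_cst.
- move=> x h t t0.
  have := flow_derivative hS hSA hWA2 hF hX heta x h t0 D_dense.
  by apply: filterS2 (flowP t t0) => w h1 h2; exact: h2.
- by move=> x h t t0; exact: (eta_bound hS hSA hF hX heta).
Qed.
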